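(* Let $p>2$, $b\in\mathbb{R}\setminus\{0\}$, $\beta=1$, $\alpha>\frac p{p-2}$, $C>0$. Let $u_0\ge0$ be continuous on $\mathbb{R}$ with $\sup\{x:u_0(x)>0\}=0$ and $u_0(x)\sim C(-x)^\alpha$ as $x\to0-$, and let $u$ be the solution of $$u_t-(|u_x|^{p-2}u_x)_x+bu=0\ \ (x\in\mathbb{R},\ 0<t<T),\qquad u(x,0)=u_0(x).$$ Then for every $\varepsilon>0$ there exist $x_\varepsilon<0$ and $\delta_\varepsilon>0$ such that, for $x>x_\varepsilon$ and $0\le t\le\delta_\varepsilon$, $$(C-\varepsilon)(-x)_+^\alpha e^{-bt}\le u(x,t)\le(C+\varepsilon)(-x)_+^\alpha e^{-bt}\Big[1-\varepsilon b^{-1}(p-2)^{-p}\big(1-e^{-b(p-2)t}\big)\Big]^{1/(2-p)}.$$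
   Context: Notation: $y_+=\max\{y,0\}$; $F\sim G$ means $F/G\to1$ in the indicated limit. Weak solution: a measurable $u\ge0$ with $u\in C_{loc}(0,T;L^2_{loc}(\mathbb{R}))\cap L^p_{loc}(0,T;W^{1,p}_{loc}(\mathbb{R})\cap L^{1+\beta}_{loc}(\mathbb{R}))$ such that for every $[t_0,t_1]\subset(0,T]$ and all $\mu_1<\mu_2$ in $C^1[t_0,t_1]$, $$\int_{\mu_1(t)}^{\mu_2(t)}u\phi\,dx\Big|_{t_0}^{t_1}+\int_{t_0}^{t_1}\int_{\mu_1(t)}^{\mu_2(t)}\big(-u\phi_t+|u_x|^{p-2}u_x\phi_x+bu^\beta\phi\big)dx\,dt=0$$ for every $\phi\in C^{2,1}_{x,t}(\overline D)$ vanishing on $x=\mu_i(t)$, where $D=\{\mu_1(t)<x<\mu_2(t),\,t_0<t<t_1\}$. A solution of the Cauchy problem is a weak solution continuous up to $t=0$ with the prescribed initial values. Standing growth assumption: either $u_0$ is bounded (and $u$ is the unique solution bounded on $\mathbb{R}\times[0,T']$ for $T'<T$), or $b\ge0$ and $u_0(x)\le K(1+|x|)^\gamma$ for some $K>0$, $0<\gamma<p/(p-2)$ (and $u$ is the unique solution). Comparison holds in these classes. *)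

(* Defs.v *)
From HB Require Import structures.
From mathcomp Require Import all_boot all_order all_algebra.
From mathcomp Require Import all_classical all_reals all_analysis.
Set Implicit Arguments.
Unset Strict Implicit.
Unset Printing Implicit Defensive.
Import Order.TTheory GRing.Theory Num.Theory.
Import numFieldNormedType.Exports.
Local Open Scope classical_set_scope.
Local Open Scope ring_scope.

(* Functions of the space variable x and the time variable t
   are curried, [u x t]; the horizon T ranges over ]0, +oo]. *)

Section PLaplacian.
Context {R : realType}.
Implicit Types (u ux : R -> R -> R) (f g phi mu : R -> R) (T : \bar R).

Local Notation leb := (@lebesgue_measure R).

(* C^oo_c(R) *)
Definition test_function phi : Prop :=
  (forall (n : nat) (x : R), derivable (derive1n n phi) x 1) /\
  (exists M : R, forall x, M < `|x| -> phi x = 0).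

(* g is the distributional derivative of f on R *)
Definition weak_derivative f g : Prop :=
  [/\ locally_integrable setT f, locally_integrable setT g &
      forall phi, test_function phi ->
        \int[leb]_(x in setT) (f x * derive1 phi x)
        = - \int[leb]_(x in setT) (g x * phi x)].

(* Joint measurability on R x (0,T), for the product of the Borel
   sigma-algebras. *)
Definition measurable_strip T u : Prop :=
  measurable_fun
    [set z : measurableTypeR R * measurableTypeR R | 0 < z.2 /\ (z.2%:E < T)%E]
    (fun z => u z.1 z.2 : measurableTypeR R).

(* u in C_loc(0,T; L^2_loc(R)) *)
Definition C_loc_L2_loc T u : Prop :=
  forall a b t : R, 0 < t -> (t%:E < T)%E ->
    (\int[leb]_(x in `[a, b]) (`|u x t| ^+ 2)%:E < +oo)%E /\
    (\int[leb]_(x in `[a, b]) (`|u x s - u x t| ^+ 2)%:E)%E @[s --> t] --> 0%E.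

(* u in L^p_loc(0,T; W^{1,p}_loc(R)), with u_x = ux *)
Definition Lp_loc_W1p_loc (p : R) T u ux : Prop :=
  [/\ measurable_strip T ux,
      {ae leb, forall t, 0 < t -> (t%:E < T)%E ->
         weak_derivative (u ^~ t) (ux ^~ t)} &
      forall a b t0 t1 : R, 0 < t0 -> (t1%:E < T)%E ->
        (\int[leb]_(t in `[t0, t1]) \int[leb]_(x in `[a, b])
           (`|u x t| `^ p + `|ux x t| `^ p)%:E < +oo)%E].

(* u in L^p_loc(0,T; L^q_loc(R)): the L^p norm in time of the L^q norm in
   space is finite. *)
Definition Lp_loc_Lq_loc (p q : R) T u : Prop :=
  forall a b t0 t1 : R, 0 < t0 -> (t1%:E < T)%E ->
    (\int[leb]_(t in `[t0, t1])
       ((\int[leb]_(x in `[a, b]) (`|u x t| `^ q)%:E) `^ (p / q)) < +oo)%E.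

(* mu in C^1[t0,t1]: the derivative on the open interval extends continuously
   to the closed one. *)
Definition C1_on (t0 t1 : R) mu : Prop :=
  {within `[t0, t1], continuous mu} /\
  exists dmu : R -> R, {within `[t0, t1], continuous dmu} /\
    (forall t, t0 < t < t1 -> is_derive t 1 mu (dmu t)).

Definition curved_domain (t0 t1 : R) (mu1 mu2 : R -> R) : set (R * R) :=
  [set z | t0 < z.2 < t1 /\ mu1 z.2 < z.1 < mu2 z.2].

(* phi in C^{2,1}_{x,t}(closure D): the partial derivatives phi_x, phi_xx and
   phi_t exist in the open set D and extend continuously to its closure. *)
Definition C21_closure (D : set (R * R))
    (phi phix phixx phit : R -> R -> R) : Prop :=
  [/\ {within closure D, continuous (fun z => phi z.1 z.2)},
      {within closure D, continuous (fun z => phix z.1 z.2)},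
      {within closure D, continuous (fun z => phixx z.1 z.2)},
      {within closure D, continuous (fun z => phit z.1 z.2)} &
      forall x t, D (x, t) ->
        [/\ is_derive x 1 (phi ^~ t) (phix x t),
            is_derive x 1 (phix ^~ t) (phixx x t) &
            is_derive t 1 (phi x) (phit x t)]].

(* For t1 < T every integrand is integrable on the curved domain, so the
   iterated integral is the double one. *)
Definition integral_identity (p b beta : R) T u ux : Prop :=
  forall t0 t1 : R, 0 < t0 -> t0 < t1 -> (t1%:E <= T)%E ->
  forall mu1 mu2 : R -> R, C1_on t0 t1 mu1 -> C1_on t0 t1 mu2 ->
  (forall t, t0 <= t <= t1 -> mu1 t < mu2 t) ->
  forall phi phix phixx phit : R -> R -> R,
  C21_closure (curved_domain t0 t1 mu1 mu2) phi phix phixx phit ->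
  (forall t, t0 <= t <= t1 -> phi (mu1 t) t = 0 /\ phi (mu2 t) t = 0) ->
  \int[leb]_(x in `[mu1 t1, mu2 t1]) (u x t1 * phi x t1)
  - \int[leb]_(x in `[mu1 t0, mu2 t0]) (u x t0 * phi x t0)
  + \int[leb]_(t in `[t0, t1]) \int[leb]_(x in `[mu1 t, mu2 t])
      (- (u x t * phit x t)
       + `|ux x t| `^ (p - 2) * ux x t * phix x t
       + b * u x t `^ beta * phi x t) = 0.

(* Nonnegative weak solution of u_t - (|u_x|^(p-2) u_x)_x + b u^beta = 0 in
   R x (0,T). *)
Definition weak_solution (p b beta : R) T u : Prop :=
  [/\ measurable_strip T u,
      (forall x t : R, 0 < t -> (t%:E < T)%E -> 0 <= u x t),
      C_loc_L2_loc T u,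
      Lp_loc_Lq_loc p (1 + beta) T u &
      exists ux, Lp_loc_W1p_loc p T u ux /\ integral_identity p b beta T u ux].

(* u is identified with its continuous representative, as pointwise values
   require. *)
Definition cauchy_solution (p b beta : R) T (u0 : R -> R) u : Prop :=
  [/\ weak_solution p b beta T u,
      {within [set z : R * R | 0 <= z.2 /\ (z.2%:E < T)%E],
         continuous (fun z => u z.1 z.2)} &
      forall x, u x 0 = u0 x].

Definition bounded_on_strips T u : Prop :=
  forall T' : R, (T'%:E < T)%E ->
    exists M : R, forall x t, 0 <= t <= T' -> `|u x t| <= M.

(* u is the only element of the class S, up to its values outside
   R x [0,T). *)
Definition unique_on_strip T (S : set (R -> R -> R)) u : Prop :=
  S u /\ forall v, S v ->
    forall x t : R, 0 <= t -> (t%:E < T)%E -> v x t = u x t.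

Definition the_cauchy_solution (p b beta : R) T (u0 : R -> R) u : Prop :=
  ((exists M : R, forall x, u0 x <= M) /\
   unique_on_strip T
     [set v | cauchy_solution p b beta T u0 v /\ bounded_on_strips T v] u)
  \/
  [/\ 0 <= b,
      (exists K gamma : R, [/\ 0 < K, 0 < gamma < p / (p - 2) &
         forall x, u0 x <= K * (1 + `|x|) `^ gamma]) &
      unique_on_strip T [set v | cauchy_solution p b beta T u0 v] u].

End PLaplacian.

(* Main.v *)
(* With v = exp(b t) u and F(s) = |s|^(p-2) s the equation becomes
   v_t = (exp(-b(p-2)t) F(v_x))_x, so with A(t) = (1 - exp(-b(p-2)t)) / (b(p-2))
   as new time it is the p-Laplacian equation, for which barriers are explicit.
   The comparison principle holds on rectangles without any growth condition.

   - c(t) |x - x0|^(p/(p-2)) is a supersolution for a short time if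
     c = c0 (1 - k A)^(-1/(p-2)) with k large. As alpha > p/(p-2), such a barrier
     centred at the origin gives u(0, t) = 0 for small t.
   - Comparing u on [0, L] with its reflection across L, u is nondecreasing in
     x >= 0. A value of u at x > 0 that is large relative to x^(p/(p-2)) would let
     a Barenblatt solution below u reach the origin. Hence
     u <= K x^(p/(p-2)) for small t, uniformly in x > 0, and the same barriers
     centred at x0 > 0 give u(x0, t) = 0 for small t, uniformly in x0.
   - On [x_eps, 0] the functions (C - eps) (-x)^alpha and
     (C + eps) (-x)^alpha (1 - eps (p-2)^(1-p) A)^(-1/(p-2)) are a sub- and a
     supersolution for v: the flux of the latter has derivative
     O((-x)^(alpha(p-1)-p)), and alpha(p-1) - p > alpha. *)

Require Import Defs.
From HB Require Import structures.
From mathcomp Require Import all_boot all_order all_algebra.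
From mathcomp Require Import all_classical all_reals all_analysis.
From mathcomp Require Import measurable_realfun ring lra.
Set Implicit Arguments.
Unset Strict Implicit.
Unset Printing Implicit Defensive.
Import Order.TTheory GRing.Theory Num.Theory.
Import numFieldNormedType.Exports.
Local Open Scope classical_set_scope.
Local Open Scope ring_scope.

(** * Integration on segments *)

Section Integrals.
Context {R : realType}.
Notation mu := (@lebesgue_measure R).
Implicit Types (f g d : R -> R) (a b x y : R).

(** A weak solution has no time derivative, so the difference D of two solutions cannot be tested
    against itself. Only increments are available: over [s, t] the increment of D is the space
    derivative of the time integral of the flux difference j. Pairing it with D_+^2 at the later
    time produces products D_x(x, t) j(x, s) at two different times, which have no sign;
    monotonicity of F gives a sign only at s = t. Recovering that diagonal by Fatou's lemma, with an
    integrable majorant, is the core of the comparison principle. The estimate left of the interface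
    is a comparison on a rectangle with right side x = 0, so u(0, t) = 0 must be known beforehand.
    To the right, a single delta must serve all centres x0 > 0. The power p/(p-2) is the one that x
    -> (F(f'))' reproduces, so the lifetime of such a barrier depends on its amplitude alone, and an
    amplitude bound uniform in x0 suffices. The factor (p-2)^(1-p) is a normalisation: near 0 the
    surplus power of -x absorbs any positive coefficient. *)

Definition itg (a b : R) (f : R -> R) : R := \int[mu]_(x in `[a, b]) f x.
Definition itgbl (a b : R) (f : R -> R) : Prop :=
  mu.-integrable `[a, b] (EFin \o f).

Lemma itgblS a b x y f : a <= x -> y <= b -> itgbl a b f -> itgbl x y f.
Proof.
by move=> ax yb; apply: integrableS => //; apply: subset_itvScc; rewrite bnd_simp.
Qed.

Lemma itg_split a b x f : a <= x -> x <= b -> itgbl a b f ->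
  itg a b f = itg a x f + itg x b f.
Proof.
move=> ax xb fi; apply/eqP; rewrite addrC -subr_eq; apply/eqP.
rewrite /itg Rintegral_itvB ?bnd_simp//.
rewrite Rintegral_itv_obnd_cbnd//.
apply: integrableS fi => //; apply: subset_itvr; rewrite bnd_simp; exact: ax.
Qed.

Lemma itg1 a f : itg a a f = 0.
Proof. by rewrite /itg set_itv1 Rintegral_set1. Qed.

Lemma itgblD a b f g : itgbl a b f -> itgbl a b g -> itgbl a b (fun x => f x + g x).
Proof. by move=> fi gi; apply: (@integrableD _ _ _ mu `[a, b] _ (EFin \o f) (EFin \o g)). Qed.
Lemma itgblB a b f g : itgbl a b f -> itgbl a b g -> itgbl a b (fun x => f x - g x).
Proof. by move=> fi gi; apply: (@integrableB _ _ _ mu `[a, b] _ (EFin \o f) (EFin \o g)). Qed.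
Lemma itgblZ a b k f : itgbl a b f -> itgbl a b (fun x => k * f x).
Proof. by move=> fi; apply: (@integrableZl _ _ _ mu `[a, b] _ k (EFin \o f)). Qed.
Lemma itgbl_norm a b f : itgbl a b f -> itgbl a b (fun x => `|f x|).
Proof. by move=> fi; apply: integrable_norm. Qed.
Lemma itgD a b f g : itgbl a b f -> itgbl a b g ->
  itg a b (fun x => f x + g x) = itg a b f + itg a b g.
Proof. by move=> fi gi; apply: RintegralD. Qed.
Lemma itgB a b f g : itgbl a b f -> itgbl a b g ->
  itg a b (fun x => f x - g x) = itg a b f - itg a b g.
Proof. by move=> fi gi; apply: RintegralB. Qed.
Lemma itgZ a b k f : itgbl a b f -> itg a b (fun x => k * f x) = k * itg a b f.
Proof. by move=> fi; apply: RintegralZl. Qed.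
Lemma itg_norm a b f : itgbl a b f -> `|itg a b f| <= itg a b (fun x => `|f x|).
Proof. by move=> fi; apply: le_normr_Rintegral. Qed.
Lemma itg_le a b f g : itgbl a b f -> itgbl a b g ->
  (forall x, a <= x <= b -> f x <= g x) -> itg a b f <= itg a b g.
Proof.
by move=> fi gi fg; apply: le_Rintegral => // x /=; rewrite in_itv/= => /fg.
Qed.
Lemma itg_ge0 a b f : (forall x, a <= x <= b -> 0 <= f x) -> 0 <= itg a b f.
Proof. by move=> f0; apply: Rintegral_ge0 => x /=; rewrite in_itv/= => /f0. Qed.
Lemma eq_itg a b f g : (forall x, a <= x <= b -> f x = g x) -> itg a b f = itg a b g.
Proof. by move=> fg; apply: eq_Rintegral => x; rewrite inE/= in_itv/= => /fg. Qed.
Lemma eq_itgbl a b f g : (forall x, a <= x <= b -> f x = g x) -> itgbl a b f -> itgbl a b g.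
Proof.
move=> fg; apply: eq_integrable => // x; rewrite inE/= in_itv/= => /fg.
by move=> ->.
Qed.
Lemma itg_cst a b k : a <= b -> itg a b (fun=> k) = k * (b - a).
Proof.
move=> ab; rewrite /itg Rintegral_cst//; congr (_ * _).
rewrite -[RHS]/(fine (b - a)%:E); congr fine.
have : mu `[a, b]%classic = (b - a)%:E; last exact.
rewrite lebesgue_measure_itv/= lte_fin.
by move: ab; rewrite le_eqVlt => /predU1P[->|->//]; rewrite ltxx subrr.
Qed.
Lemma itgbl_within a b f : {within `[a, b], continuous f} -> itgbl a b f.
Proof.
by move=> cf; apply: continuous_compact_integrable => //; exact: segment_compact.
Qed.
Lemma itgbl_cont a b f : continuous f -> itgbl a b f.
Proof. by move=> cf; apply: itgbl_within; apply: continuous_subspaceT. Qed.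

Lemma itgbl_cst a b k : itgbl a b (fun=> k).
Proof. by apply: itgbl_cont => x; exact: cvg_cst. Qed.

Lemma itgbl_measurable a b f : itgbl a b f -> measurable_fun `[a, b] f.
Proof. by case/integrableP => /measurable_EFinP. Qed.

Lemma itgbl_mul a b f g M : itgbl a b f -> measurable_fun `[a, b] g ->
  (forall x, a <= x <= b -> `|g x| <= M) -> itgbl a b (fun x => g x * f x).
Proof.
move=> fi mg gM.
apply: (@le_integrable _ _ _ mu _ _ _ (EFin \o (fun x => M * `|f x|))) => //=.
- by apply/measurable_EFinP; apply: measurable_funM => //; exact: itgbl_measurable.
- move=> x; rewrite in_itv/= => /gM gx; rewrite lee_fin !normrM normr_id.
  by rewrite ler_wpM2r// (le_trans gx)// ler_norm.
- exact/itgblZ/itgbl_norm.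
Qed.

Lemma itg_cont_within a b f : a <= b -> itgbl a b f ->
  {within `[a, b], continuous (fun x => itg a x f)}.
Proof. exact: parameterized_integral_continuous. Qed.

Lemma itg_prim_diff a b f g x y : itgbl a b g ->
  (forall x, a <= x <= b -> f x - f a = itg a x g) ->
  a <= x -> x <= y -> y <= b -> f y - f x = itg x y g.
Proof.
move=> gi fE ax xy yb.
have -> : f y - f x = (f y - f a) - (f x - f a) by ring.
rewrite !fE ?ax ?(le_trans xy yb) ?(le_trans ax xy) ?yb//.
rewrite (@itg_split a y x g ax xy (itgblS (lexx a) yb gi)).
by rewrite addrAC subrr add0r.
Qed.

Lemma prim_cont a b f g : a <= b -> itgbl a b g ->
  (forall x, a <= x <= b -> f x - f a = itg a x g) ->
  {within `[a, b], continuous f}.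
Proof.
move=> ab gi fE.
have cg := itg_cont_within ab gi.
have cg' : {within `[a, b], continuous (fun x => f a + itg a x g)}.
  move=> x; apply: cvgD; first exact: cvg_cst.
  exact: cg.
apply: (@subspace_eq_continuous _ _ _ (fun x => f a + itg a x g)) => //.
by move=> x; rewrite inE/= in_itv/= => /fE <-; rewrite addrC subrK.
Qed.

Lemma comp_within_continuous (A : set R) (f g : R -> R) :
  {within A, continuous f} -> continuous g -> {within A, continuous (g \o f)}.
Proof.
by move=> cf cg x; exact: (@continuous_comp (subspace A) R R f g x (cf x) (cg _)).
Qed.

(* On a partition whose n pieces carry equal increments of A, the increments
   of H add up to O(1/n). *)
Lemma quadratic_increment_const a b C (H A : R -> R) : a <= b ->
  {within `[a, b], continuous A} ->
  (forall x y, a <= x -> x <= y -> y <= b -> A x <= A y) ->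
  (forall x y, a <= x -> x <= y -> y <= b -> `|H y - H x| <= C * (A y - A x) ^+ 2) ->
  H b = H a.
Proof.
move=> ab cA mA hH; set D := A b - A a.
have D0 : 0 <= D by rewrite subr_ge0 mA.
suff key n : (0 < n)%N -> `|H b - H a| <= (n%:R)^-1 * (C * D ^+ 2).
  apply/eqP; rewrite -subr_eq0 -normr_eq0 eq_le normr_ge0 andbT.
  apply/ler_addgt0Pl => e e0; rewrite addr0.
  have : (n.+1%:R)^-1 * (C * D ^+ 2) @[n --> \oo] --> 0 * (C * D ^+ 2).
    apply: cvgM; [exact: cvg_harmonic|exact: cvg_cst].
  rewrite mul0r => /cvgrPdist_le/(_ _ e0)[N _ /(_ N (leqnn N))].
  rewrite /= sub0r normrN => h.
  by rewrite (le_trans (key N.+1 _))// (le_trans (ler_norm _)).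
move=> n0.
have n0' : (0 : R) < n%:R by rewrite ltr0n.
have step i : (i <= n)%N -> exists x, [/\ a <= x, x <= b,
    A x = A a + i%:R / n%:R * D & `|H x - H a| <= i%:R * (C * (D / n%:R) ^+ 2)].
  elim: i => [_|i IH lein].
    by exists a; split => //; rewrite ?mul0r ?addr0 ?subrr ?normr0 ?mul0r.
  have [x [ax xb Ax Hx]] := IH (ltnW lein).
  have cA' : {within `[x, b], continuous A}.
    by apply: continuous_subspaceW cA; apply: subset_itvr; rewrite bnd_simp.
  have [] := @IVT _ A x b (A a + i.+1%:R / n%:R * D) xb cA'.
    have Axb := mA _ _ ax xb (lexx b).
    rewrite min_l// max_r//; apply/andP; split.
      by rewrite Ax lerD2l ler_wpM2r// ler_wpM2r ?invr_ge0 ?ler_nat// ltW.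
    have -> : A b = A a + 1 * D by rewrite /D; ring.
    by rewrite lerD2l ler_wpM2r// ler_pdivrMr// mul1r ler_nat.
  move=> y; rewrite in_itv/= => /andP[xy yb] Ay.
  exists y; split => //; first exact: le_trans xy.
  have -> : H y - H a = (H y - H x) + (H x - H a) by ring.
  rewrite (le_trans (ler_normD _ _))//.
  rewrite -natr1 mulrDl mul1r addrC lerD// (le_trans (hH _ _ ax xy yb))//.
  rewrite Ay Ax -natr1.
  by rewrite (_ : _ - _ = D / n%:R)//; field; rewrite gt_eqF.
have [x [ax xb Ax Hx]] := step n (leqnn n).
have HH : `|H b - H x| <= 0.
  rewrite (le_trans (hH _ _ ax xb (lexx b)))// Ax /D divff ?gt_eqF//.
  by rewrite mul1r addrCA subrr addr0 subrr expr0n mulr0.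
have -> : H b - H a = (H b - H x) + (H x - H a) by ring.
rewrite (le_trans (ler_normD _ _))// -[leRHS]add0r lerD//.
rewrite (le_trans Hx)// le_eqVlt; apply/orP; left; apply/eqP.
by field; rewrite gt_eqF.
Qed.

(** Absolute continuity is encoded as being a primitive of an integrable function, and nothing is
    differentiated almost everywhere. The defect P(f) - (integral of P'(f) g) has increments of
    second order in the increments of the integral of |g|, so [quadratic_increment_const] makes it
    constant. *)
Lemma ac_chain_rule a b f g C (P P' : R -> R) : a <= b -> itgbl a b g ->
  (forall x, a <= x <= b -> f x - f a = itg a x g) ->
  (forall x y, `|P y - P x - P' x * (y - x)| <= C * (y - x) ^+ 2) ->
  (forall x y, `|P' y - P' x| <= C * `|y - x|) ->
  continuous P' ->
  itgbl a b (fun x => P' (f x) * g x) /\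
  P (f b) - P (f a) = itg a b (fun x => P' (f x) * g x).
Proof.
move=> ab gi fE hP hP' cP'.
have C0 : 0 <= C by have := hP' 0 1; rewrite subr0 normr1 mulr1; exact: le_trans.
have cf := prim_cont ab gi fE.
have cPf : {within `[a, b], continuous (P' \o f)}.
  exact: comp_within_continuous.
have mPf : measurable_fun `[a, b] (P' \o f).
  by apply: subspace_continuous_measurable_fun.
have [M hM] : exists M, forall x, a <= x <= b -> `|P' (f x)| <= M.
  have cn : {within `[a, b], continuous (fun x => `|P' (f x)|)}.
    by apply: (comp_within_continuous cPf); exact: norm_continuous.
  have [c _ hc] := EVT_max ab cn.
  by exists `|P' (f c)| => x xab; apply: hc; rewrite in_itv.
have Pgi : itgbl a b (fun x => P' (f x) * g x) by exact: itgbl_mul gi mPf hM.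
split => //.
pose H x := P (f x) - itg a x (fun x => P' (f x) * g x).
pose A x := itg a x (fun x => `|g x|).
suff : H b = H a by rewrite /H itg1 subr0 => <-; rewrite opprB addrCA subrr addr0.
apply: (@quadratic_increment_const _ _ (C + C) H A ab).
- exact/itg_cont_within/itgbl_norm.
- move=> x y ax xy yb; rewrite /A (@itg_split a y x)//.
    by rewrite lerDl itg_ge0.
  exact/itgbl_norm/(itgblS _ _ gi).
- move=> x y ax xy yb; rewrite /A (@itg_split a y x)//; last first.
    exact/itgbl_norm/(itgblS _ _ gi).
  rewrite [X in _ * X ^+ 2](_ : _ = itg x y (fun z => `|g z|)); last by ring.
  rewrite /H (@itg_split a y x)//; last exact: itgblS Pgi.
  set S := itg x y _; set G := itg x y _; set S0 := itg a x _.
  have fyx : f y - f x = itg x y g by exact: itg_prim_diff gi fE ax xy yb.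
  have gxy : itgbl x y g by exact: itgblS gi.
  have fG : `|f y - f x| <= G by rewrite fyx; exact: itg_norm.
  have G0 : 0 <= G by rewrite (le_trans _ fG).
  (* Freezing P'(f z) at z = x costs at most C |f z - f x| <= C G pointwise, hence C G^2 after
     integration against |g|. The Taylor remainder costs another C G^2, whence the constant C +
     C. *)
  have Sx : `|S - P' (f x) * (f y - f x)| <= C * G ^+ 2.
    rewrite fyx -itgZ// /S -itgB//; [|exact: itgblS Pgi|exact: itgblZ].
    have i1 : itgbl x y (fun z => P' (f z) * g z - P' (f x) * g z).
      by apply: itgblB; [exact: itgblS Pgi|exact: itgblZ].
    rewrite (le_trans (itg_norm i1))//.
    apply: (@le_trans _ _ (itg x y (fun z => (C * G) * `|g z|))).
      apply: itg_le; [exact: itgbl_norm|exact/itgblZ/itgbl_norm|].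
      move=> z /andP[xz zy]; rewrite -mulrBl normrM ler_wpM2r//.
      rewrite (le_trans (hP' _ _))// ler_wpM2l//.
      rewrite (itg_prim_diff gi fE ax xz (le_trans zy yb)).
      have gxz : itgbl x z g by exact: itgblS gxy.
      rewrite (le_trans (itg_norm gxz))// /G (@itg_split x y z)//.
        by rewrite lerDl itg_ge0.
      exact: itgbl_norm.
    rewrite (itgZ _ (itgbl_norm gxy)) -/G.
    by rewrite expr2 mulrA.
  have -> : P (f y) - (S0 + S) - (P (f x) - S0) =
    (P (f y) - P (f x) - P' (f x) * (f y - f x)) - (S - P' (f x) * (f y - f x)).
    by ring.
  rewrite (le_trans (ler_normB _ _))// mulrDl lerD//.
  rewrite (le_trans (hP _ _))// ler_wpM2l//.
  by rewrite -[leLHS]real_normK ?num_real// lerXn2r ?nnegrE.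
Qed.

Lemma continuous_scale (k : R) : continuous (fun s : R => k * s).
Proof. by move=> s; apply: cvgM; [exact: cvg_cst|exact: cvg_id]. Qed.

Lemma continuous_expR_scale (k : R) : continuous (fun t => expR (k * t)).
Proof.
move=> t; apply: (@continuous_comp _ _ _ (fun t => k * t) expR); last exact: continuous_expR.
exact: continuous_scale.
Qed.

Lemma ac_chain_rule_sqr a b f g : a <= b -> itgbl a b g ->
  (forall x, a <= x <= b -> f x - f a = itg a x g) ->
  itgbl a b (fun x => 2 * f x * g x) /\
  f b ^+ 2 - f a ^+ 2 = itg a b (fun x => 2 * f x * g x).
Proof.
move=> ab gi fE.
apply: (@ac_chain_rule _ _ _ _ 2 (fun s => s ^+ 2) (fun s => 2 * s)) => //.
- move=> x y; rewrite (_ : _ - _ = (y - x) ^+ 2); last by ring.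
  by rewrite ger0_norm ?sqr_ge0// ler_peMl ?sqr_ge0// ler1n.
- by move=> x y; rewrite -mulrBr normrM ger0_norm.
- exact: continuous_scale.
Qed.

Definition pos (s : R) : R := Num.max s 0.

Lemma pos_ge0 s : 0 <= pos s. Proof. by rewrite /pos le_max lexx orbT. Qed.
Lemma pos_gt0E s : 0 <= s -> pos s = s. Proof. by move=> ?; rewrite /pos max_l. Qed.
Lemma pos_le0E s : s <= 0 -> pos s = 0. Proof. by move=> ?; rewrite /pos max_r. Qed.
Lemma pos_continuous : continuous pos.
Proof. by move=> s; apply: continuous_max; [exact: cvg_id|exact: cvg_cst]. Qed.

(** The function s_+^2 has the Lipschitz derivative 2 s_+, which is what the chain rule asks for;
    s_+ itself does not qualify. This fixes D_+^2 as the multiplier in the energy estimate. *)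
Lemma ac_chain_rule_pos a b f g : a <= b -> itgbl a b g ->
  (forall x, a <= x <= b -> f x - f a = itg a x g) ->
  itgbl a b (fun x => 2 * pos (f x) * g x) /\
  pos (f b) ^+ 2 - pos (f a) ^+ 2 = itg a b (fun x => 2 * pos (f x) * g x).
Proof.
move=> ab gi fE.
apply: (@ac_chain_rule _ _ _ _ 2 (fun s => pos s ^+ 2) (fun s => 2 * pos s)) => //.
- move=> x y; rewrite ler_norml.
  have hx := sqr_ge0 x; have hy := sqr_ge0 y; have hxy := sqr_ge0 (x - y).
  have [x0|/ltW x0] := leP 0 x; have [y0|/ltW y0] := leP 0 y.
  + by rewrite (pos_gt0E x0) (pos_gt0E y0); apply/andP; split; nra.
  + have xy0 : x * y <= 0 by rewrite mulr_ge0_le0.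
    by rewrite (pos_gt0E x0) (pos_le0E y0); apply/andP; split; nra.
  + have xy0 : x * y <= 0 by rewrite mulr_le0_ge0.
    by rewrite (pos_le0E x0) (pos_gt0E y0); apply/andP; split; nra.
  + by rewrite (pos_le0E x0) (pos_le0E y0); apply/andP; split; nra.
- move=> x y; rewrite -mulrBr normrM ger0_norm// ler_wpM2l//.
  have h1 := ler_norm (y - x); have h2 := ler_norm (x - y).
  rewrite distrC in h2; rewrite ler_norml.
  by rewrite /pos; have [x0|/ltW x0] := leP x 0; have [y0|/ltW y0] := leP y 0;
    apply/andP; split; lra.
- move=> s; apply: cvgM; first exact: cvg_cst.
  exact: pos_continuous.
Qed.

(** Polarisation: the rule for squares is applied to F + G and to F - G, and the two identities are
    subtracted. *)
Lemma ac_parts a b (F G f g : R -> R) : a <= b -> itgbl a b f -> itgbl a b g ->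
  (forall x, a <= x <= b -> F x - F a = itg a x f) ->
  (forall x, a <= x <= b -> G x - G a = itg a x g) ->
  [/\ itgbl a b (fun x => F x * g x), itgbl a b (fun x => f x * G x) &
  F b * G b - F a * G a = itg a b (fun x => F x * g x) + itg a b (fun x => f x * G x)].
Proof.
move=> ab fi gi FE GE.
have bd (H h : R -> R) : itgbl a b h -> (forall x, a <= x <= b -> H x - H a = itg a x h) ->
   forall k, itgbl a b k -> itgbl a b (fun x => H x * k x).
  move=> hi HE k ki; have cH := prim_cont ab hi HE.
  have cn : {within `[a, b], continuous (fun x => `|H x|)}.
    by apply: (comp_within_continuous cH); exact: norm_continuous.
  have [c _ hc] := EVT_max ab cn.
  apply: (itgbl_mul ki _ (M := `|H c|)).
    exact: subspace_continuous_measurable_fun.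
  by move=> x xab; apply: hc; rewrite in_itv.
have i1 := bd _ _ fi FE _ gi.
have i2 := bd _ _ gi GE _ fi.
have i3 := bd _ _ fi FE _ fi.
have i4 := bd _ _ gi GE _ gi.
have i2' : itgbl a b (fun x => f x * G x).
  by apply: eq_itgbl i2 => x _; rewrite mulrC.
split => //.
have sub x : a <= x -> x <= b -> forall h, itgbl a b h -> itgbl a x h.
  by move=> ax xb h; apply: itgblS.
have h1 x : a <= x <= b -> F x + G x - (F a + G a) = itg a x (fun x => f x + g x).
  by move=> /[dup] xab /andP[ax xb]; rewrite (itgD (sub _ ax xb _ fi) (sub _ ax xb _ gi)) -FE// -GE//; ring.
have h2 x : a <= x <= b -> F x - G x - (F a - G a) = itg a x (fun x => f x - g x).
  by move=> /[dup] xab /andP[ax xb]; rewrite (itgB (sub _ ax xb _ fi) (sub _ ax xb _ gi)) -FE// -GE//; ring.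
have [_] := ac_chain_rule_sqr ab (itgblD fi gi) h1.
have [_] := ac_chain_rule_sqr ab (itgblB fi gi) h2.
rewrite (@eq_itg _ _ _ (fun x => 2 * ((F x * f x + G x * g x) - (F x * g x + f x * G x)))); last first.
  by move=> x _; ring.
rewrite [X in _ -> _ = X -> _](@eq_itg _ _ _ (fun x => 2 * ((F x * f x + G x * g x) + (F x * g x + f x * G x)))); last first.
  by move=> x _; ring.
rewrite (itgZ _ (itgblB (itgblD i3 i4) (itgblD i1 i2'))).
rewrite (itgB (itgblD i3 i4) (itgblD i1 i2')).
rewrite (itgZ _ (itgblD (itgblD i3 i4) (itgblD i1 i2'))).
rewrite (itgD (itgblD i3 i4) (itgblD i1 i2')) (itgD i1 i2').
lra.
Qed.

End Integrals.

(** * Steklov averages *)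

Section limn_einf_lemmas.
Context {R : realType}.

Lemma measurable_limn_einf d (T : measurableType d) (f : (T -> \bar R)^nat) :
  (forall n, measurable_fun setT (f n)) ->
  measurable_fun setT (fun x => limn_einf (f ^~ x)).
Proof.
move=> mf.
rewrite (_ : (fun x => _) = (fun x => - limn_esup (fun n => - f n x))%E); last first.
  by apply/funext => x; rewrite -limn_einfN; congr limn_einf;
     apply/funext => n /=; rewrite oppeK.
apply: measurableT_comp => //; apply: measurable_fun_limn_esup => n.
exact: measurableT_comp.
Qed.

Lemma limn_einf_ge0 (u : (\bar R)^nat) : (forall n, 0 <= u n)%E -> (0 <= limn_einf u)%E.
Proof.
move=> u0; rewrite limn_einf_lim; apply: lime_ge; first exact: is_cvg_einfs.
by apply: nearW => n; apply: le_ereal_inf_tmp => _ [m /= nm <-].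
Qed.

Lemma limn_einf_le (u : (\bar R)^nat) c m :
  (forall n, (m <= n)%N -> u n <= c)%E -> (limn_einf u <= c)%E.
Proof.
move=> uc; rewrite limn_einf_lim; apply: lime_le; first exact: is_cvg_einfs.
exists m => // n /= mn; apply: le_trans (uc n mn).
by apply: ereal_inf_lbound; exists n => /=.
Qed.

End limn_einf_lemmas.

Section Steklov.
Context {R : realType}.
Notation mu := (@lebesgue_measure R).
Notation mR := (measurableTypeR R).

(** The a.e. derivative of the primitive over ]-oo, t] is read along h = -1/(n+1). The windows end
    at t because convexity will test an increment with the function at the later time. *)
Lemma steklov_cvg (f : R -> R) : mu.-integrable setT (EFin \o f) ->
  {ae mu, forall t, n.+1%:R * itg (t - n.+1%:R^-1) t f @[n --> \oo] --> f t}.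
Proof.
move=> fi.
have fiy y : mu.-integrable `]-oo, y] (EFin \o f) by exact: integrableS fi.
have locf : locally_integrable setT f.
  exact: open_integrable_locally openT fi.
have := FTC1Ny fiy locf.
apply: filterS; first exact: (ae_filter_ringOfSetsType mu).
move=> t /= [dF F't].
set F := (fun x => \int[mu]_(t in `]-oo, x]) f t) in dF F't.
have Fdiff x y : x <= y -> itg x y f = F y - F x.
  move=> xy; rewrite /F Rintegral_itvB ?bnd_simp// /itg.
  rewrite Rintegral_itv_obnd_cbnd//.
  by apply: integrableS fi.
pose G h := h^-1 * (F (h + t) - F t).
have hG : G h @[h --> 0^'] --> f t.
  have := dF; rewrite /derivable -F't derive1E.
  apply: cvg_trans; apply: near_eq_cvg; apply: nearW => h /=.
  by rewrite /G [_ *: 1]mulr1.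
have := (cvgr_dnbhsP G 0 (f t)).1 hG (fun n => - n.+1%:R^-1) (conj _ _).
have h0 n : - n.+1%:R^-1 != 0 :> R by rewrite oppr_eq0 invr_eq0 pnatr_eq0.
have h1 : - n.+1%:R^-1 @[n --> \oo] --> (0 : R).
  by rewrite -[0]oppr0; apply: cvgN; exact: cvg_harmonic.
move=> /(_ h0 h1); apply: cvg_trans; apply: near_eq_cvg; apply: nearW => n /=.
rewrite /G Fdiff ?gerBl ?invr_ge0// invrN invrK [- _ + t]addrC; ring.
Qed.

Definition mfun2 (f : R -> R -> R) :=
  measurable_fun setT (fun z : mR * mR => f z.1 z.2 : mR).

(* N only makes the kernel nonnegative: it dominates |g x t * j x s|, so that
   Fatou's lemma applies as the window shrinks to s = t. *)
Definition steklov_kernel (g j N : R -> R -> R) (n : nat) (x t s : R) : R :=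
  if (t - n.+1%:R^-1 <= s) && (s <= t)
  then n.+1%:R * (g x t * j x s + N x t + N x s) else 0.

Definition steklov_energy g j N n (x t : R) : \bar R :=
  \int[mu]_s (steklov_kernel g j N n x t s)%:E.

Section fatou_steklov.
Variables (g j N : R -> R -> R).
Hypothesis (mg : mfun2 g) (mj : mfun2 j) (mN : mfun2 N).
Hypothesis (N0 : forall x t, 0 <= N x t).
Hypothesis (gjN : forall x t s, `|g x t * j x s| <= N x t + N x s).

Lemma steklov_kernel_ge0 n x t s : 0 <= steklov_kernel g j N n x t s.
Proof.
rewrite /steklov_kernel; case: ifP => // _; rewrite mulr_ge0//.
have := gjN x t s; rewrite ler_norml => /andP[+ _]; lra.
Qed.

Lemma steklov_energy_ge0 n x t : (0 <= steklov_energy g j N n x t)%E.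
Proof. by apply: integral_ge0 => s _; rewrite lee_fin steklov_kernel_ge0. Qed.

Lemma steklov_energyE n x t :
  itgbl (t - n.+1%:R^-1) t (fun s => g x t * j x s + N x t + N x s) ->
  steklov_energy g j N n x t = (n.+1%:R *
    itg (t - n.+1%:R^-1) t (fun s => g x t * j x s + N x t + N x s))%:E.
Proof.
move=> fi; rewrite -itgZ// /itg /Rintegral fineK; last first.
  by apply: integrable_fin_num => //; exact: itgblZ.
rewrite integral_mkcond; apply: eq_integral => s _.
rewrite patchE mem_setE /steklov_kernel in_itv/=.
by case: ifP.
Qed.

Let measurable_kernel n :
  measurable_fun setT (fun w : (mR * mR) * mR =>
    (steklov_kernel g j N n w.1.1 w.1.2 w.2)%:E).
Proof.
apply/measurable_EFinP.
have m1 : measurable_fun setT (fun w : (mR * mR) * mR => w.1 : mR * mR) by exact: measurable_fst.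
have m2 : measurable_fun setT (fun w : (mR * mR) * mR => w.2 : mR) by exact: measurable_snd.
have m12 : measurable_fun setT (fun w : (mR * mR) * mR => w.1.2 : mR).
  exact: measurableT_comp.
have m11 : measurable_fun setT (fun w : (mR * mR) * mR => w.1.1 : mR).
  exact: measurableT_comp.
have mx2 : measurable_fun setT (fun w : (mR * mR) * mR => (w.1.1, w.2) : mR * mR).
  exact: measurable_fun_pair.
have mg' := measurableT_comp mg m1.
have mj' := measurableT_comp mj mx2.
have mN' := measurableT_comp mN m1.
have mN'' := measurableT_comp mN mx2.
apply: measurable_fun_ifT => //=.
  apply: measurable_and; apply: measurable_fun_ler => //.
  exact: measurable_funB.
apply: measurable_funM => //; apply: measurable_funD => //.
by apply: measurable_funD => //; exact: measurable_funM.
Qed.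

Let kernel_ge0 n (w : (mR * mR) * mR) :
  (0 <= (steklov_kernel g j N n w.1.1 w.1.2 w.2)%:E)%E.
Proof. by rewrite lee_fin steklov_kernel_ge0. Qed.

Lemma measurable_steklov_energy n :
  measurable_fun setT (fun z : mR * mR => steklov_energy g j N n z.1 z.2).
Proof.
exact: (@measurable_fun_fubini_tonelli_F _ _ _ _ _ mu _ (measurable_kernel n) (kernel_ge0 n)).
Qed.

(** As the window shrinks, the energy tends a.e. to g j + 2 N >= 2 N. Fatou's lemma is used in t for
    almost every x and then in x; the right side is written in the other order because the energy
    estimates come at fixed t, and Tonelli's theorem exchanges the two. After cancellation of the
    finite integral of 2 N, the Steklov averages of g j are nonnegative in the limit. *)
Lemma fatou_steklov :
  (forall x t, 0 <= g x t * j x t) ->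
  (\int[mu]_x \int[mu]_t (N x t)%:E < +oo)%E ->
  (\int[mu]_x \int[mu]_t `|j x t|%:E < +oo)%E ->
  (\int[mu]_x \int[mu]_t (2 * N x t)%:E <=
   limn_einf (fun n => \int[mu]_t \int[mu]_x steklov_energy g j N n x t))%E.
Proof.
move=> gj0 Noo joo.
have mNE : measurable_fun setT (fun z : mR * mR => (N z.1 z.2)%:E) by exact/measurable_EFinP.
have mjE : measurable_fun setT (fun z : mR * mR => (j z.1 z.2)%:E) by exact/measurable_EFinP.
have Nx : {ae mu, forall x, mu.-integrable setT (fun t => (N x t)%:E)}.
  suff h : (mu \x mu)%E.-integrable setT (fun z : mR * mR => (N z.1 z.2)%:E).
    exact: (ae_integrable1 h).
  apply/integrable12ltyP; first exact: mNE.
  rewrite (_ : (\int[mu]_x _ = \int[mu]_x \int[mu]_t (N x t)%:E)%E); first exact: Noo.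
  by apply: eq_integral => x _; apply: eq_integral => t _; rewrite gee0_abs// lee_fin.
have jx : {ae mu, forall x, mu.-integrable setT (fun t => (j x t)%:E)}.
  suff h : (mu \x mu)%E.-integrable setT (fun z : mR * mR => (j z.1 z.2)%:E).
    exact: (ae_integrable1 h).
  exact/integrable12ltyP.
have mE n := measurable_steklov_energy n.
have E0 n x t := steklov_energy_ge0 n x t.
have swap n : (\int[mu]_t \int[mu]_x steklov_energy g j N n x t =
               \int[mu]_x \int[mu]_t steklov_energy g j N n x t)%E.
  symmetry; exact: (fubini_tonelli (fun z : mR * mR => steklov_energy g j N n z.1 z.2)
    (mE n) (fun z => E0 n z.1 z.2)).
under [X in limn_einf X]eq_fun do rewrite swap.
have mEt n : measurable_fun setT (fun x => \int[mu]_t steklov_energy g j N n x t)%E.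
  exact: (measurable_fun_fubini_tonelli_F (m2 := mu)
    (fun z : mR * mR => steklov_energy g j N n z.1 z.2) (mE n) (fun z => E0 n z.1 z.2)).
have Et0 n x : (0 <= \int[mu]_t steklov_energy g j N n x t)%E by exact: integral_ge0.
have mEx n x : measurable_fun setT (fun t => steklov_energy g j N n x t).
  exact: (measurableT_comp (mE n) (pair1_measurable x)).
have h := fatou mu measurableT mEt (fun n x _ => Et0 n x).
apply: le_trans h.
apply: ae_ge0_le_integral => //.
- by move=> x _; apply: integral_ge0 => t _; rewrite lee_fin mulr_ge0.
- apply: (measurable_fun_fubini_tonelli_F (m2 := mu) (fun z => (2 * N z.1 z.2)%:E)).
    by apply/measurable_EFinP; exact: measurable_funM.
  by move=> z; rewrite lee_fin mulr_ge0.
- by move=> x _; exact: limn_einf_ge0.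
- exact: measurable_limn_einf.
apply: filterS2 Nx jx; first exact: (ae_filter_ringOfSetsType mu).
move=> x Nx jx _.
have h := fatou mu measurableT (mEx ^~ x) (fun n t _ => E0 n x t).
apply: le_trans h.
apply: ae_ge0_le_integral => //.
- by move=> t _; rewrite lee_fin mulr_ge0.
- apply/measurable_EFinP; apply: measurable_funM => //.
  exact: (measurableT_comp mN (pair1_measurable x)).
- by move=> t _; exact: limn_einf_ge0.
- exact: (measurable_limn_einf (fun n => mEx n x)).
have := steklov_cvg Nx; have := steklov_cvg jx; apply: filterS2; first exact: (ae_filter_ringOfSetsType mu).
move=> t jt Nt _.
have : (steklov_energy g j N n x t @[n --> \oo] --> (g x t * j x t + N x t + N x t)%:E)%E.
  have jI a b : itgbl a b (j x) by apply: integrableS jx.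
  have NI a b : itgbl a b (N x) by apply: integrableS Nx.
  rewrite (_ : (fun n => _) = (fun n => (g x t * (n.+1%:R * itg (t - n.+1%:R^-1) t (j x)) + N x t
     + (n.+1%:R * itg (t - n.+1%:R^-1) t (N x)))%:E)); last first.
    apply/funext => n.
    have i1 := itgblZ (g x t) (jI (t - n.+1%:R^-1) t).
    have i2 := itgbl_cst (t - n.+1%:R^-1) t (N x t).
    rewrite steklov_energyE; last by apply: itgblD => //; exact: itgblD.
    rewrite (itgD (itgblD i1 i2) (NI _ _)) (itgD i1 i2) (itgZ _ (jI _ _)).
    rewrite itg_cst ?gerBl ?invr_ge0//.
    have m0 : n.+1%:R != 0 :> R by rewrite pnatr_eq0.
    by move: m0; set m := n.+1%:R => m0; congr EFin; field.
  apply: cvg_EFin; first by apply: nearW => n; rewrite fin_numE.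
  rewrite /comp /=; apply: cvgD => //; apply: cvgD; last exact: cvg_cst.
  by apply: cvgM => //; exact: cvg_cst.
move=> /cvg_limn_einf_sup[-> _]; rewrite lee_fin.
have := gj0 x t; lra.
Qed.

End fatou_steklov.
End Steklov.

(** * Integrals under reflection and translation *)

Section Reflection.
Context {R : realType}.
Notation mu := (@lebesgue_measure R).
Notation mR := (measurableTypeR R).

Lemma measurable_reflect (c : R) : measurable_fun setT (fun x : mR => c - x : mR).
Proof. exact: measurable_funB. Qed.

Lemma lebesgue_measure_reflect (c : R) (A : set R) : measurable A ->
  pushforward mu (fun x : mR => c - x : mR) A = mu A.
Proof.
move=> mA.
pose phi_mixin := isMeasurableFun.Build _ _ _ _ _ (measurable_reflect c).
pose phi : {mfun _ >-> _} := HB.pack (fun x : mR => c - x : mR) phi_mixin.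
apply/esym; apply: (@lebesgue_measure_unique R (pushforward mu phi)) => //= _ [[a b]] _ <-.
rewrite /pushforward.
rewrite (_ : _ @^-1` _ = `[c - b, c - a[%classic); last first.
  apply/seteqP; split => x /=; rewrite !in_itv/= => /andP[]; lra.
rewrite !lebesgue_measure_itv/= !lte_fin.
rewrite (_ : (c - b < c - a) = (a < b)); last by apply/idP/idP; lra.
by case: ifP => // _; congr EFin; lra.
Qed.

Lemma ae_reflect (c : R) (P : R -> Prop) :
  {ae mu, forall x, P x} -> {ae mu, forall x, P (c - x)}.
Proof.
case=> A [mA A0 PA]; exists ((fun x : mR => c - x : mR) @^-1` A); split.
- by rewrite -[X in measurable X]setTI; exact: measurable_reflect.
- by rewrite -[LHS]/(pushforward mu (fun x : mR => c - x : mR) A) lebesgue_measure_reflect.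
- by move=> x /= nP; apply: PA.
Qed.

Lemma ge0_integral_reflect (c : R) (f : R -> \bar R) : measurable_fun setT f ->
  (forall x, 0 <= f x)%E ->
  (\int[mu]_x f (c - x)%R = \int[mu]_x f x)%E.
Proof.
move=> mf f0.
have := @ge0_integral_pushforward _ _ _ _ R _ (measurable_reflect c) mu setT f measurableT mf.
rewrite preimage_setT => <-; last by move=> x _.
apply: eq_measure_integral => [|mphi A mA _]; first exact: measurable_reflect.
exact: lebesgue_measure_reflect.
Qed.

Lemma itgbl_reflect c a b (f : R -> R) :
  itgbl (c - b) (c - a) f -> itgbl a b (fun x => f (c - x)).
Proof.
move=> fi.
have := fi; rewrite /itgbl integrable_mkcond// => /integrableP[mf foo].
rewrite /itgbl integrable_mkcond//; apply/integrableP.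
have E : (EFin \o (fun x => f (c - x))) \_ `[a, b] =
         (fun x => ((EFin \o f) \_ `[c - b, c - a]) (c - x)).
  apply/funext => x; rewrite !patchE !mem_setE !in_itv/=.
  by rewrite (_ : (c - b <= c - x <= c - a) = (a <= x <= b))//; apply/idP/idP; lra.
rewrite E; split.
  exact: (measurableT_comp mf (measurable_reflect c)).
apply: le_lt_trans foo.
pose fr := (EFin \o f) \_ `[c - b, c - a].
rewrite -(ge0_integral_reflect c (f := fun x => `|fr x|%E))//.
by apply: (measurableT_comp _ mf).
Qed.

Lemma itg_reflect c a b (f : R -> R) : itgbl (c - b) (c - a) f ->
  itg a b (fun x => f (c - x)) = itg (c - b) (c - a) f.
Proof.
move=> fi; rewrite /itg /Rintegral; congr fine.
have := fi; rewrite /itgbl integrable_mkcond// => fi'.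
have fi'' := itgbl_reflect fi.
rewrite [LHS]integral_mkcond [RHS]integral_mkcond.
have E : (EFin \o (fun x => f (c - x))) \_ `[a, b] =
         (fun x => ((EFin \o f) \_ `[c - b, c - a]) (c - x)).
  apply/funext => x; rewrite !patchE !mem_setE !in_itv/=.
  by rewrite (_ : (c - b <= c - x <= c - a) = (a <= x <= b))//; apply/idP/idP; lra.
rewrite [X in integral _ _ X = _]E.
have mf : measurable_fun setT ((EFin \o f) \_ `[c - b, c - a]).
  by case/integrableP : fi'.
have i2 : mu.-integrable ((fun x : mR => c - x : mR) @^-1` setT)
    (((EFin \o f) \_ `[c - b, c - a]) \o (fun x : mR => c - x : mR)).
  rewrite preimage_setT; move: fi''; rewrite /itgbl integrable_mkcond//.
  by rewrite E.
have := integral_pushforward (measurable_reflect c) mf i2 measurableT.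
rewrite preimage_setT => <-.
apply: eq_measure_integral => [|mphi A mA _]; first exact: measurable_reflect.
exact: lebesgue_measure_reflect.
Qed.

Lemma itg_shift h a b (f : R -> R) : itgbl (a - h) (b - h) f ->
  itg a b (fun x => f (x - h)) = itg (a - h) (b - h) f.
Proof.
move=> fi.
have fN : itgbl (h - b) (h - a) (fun x => f (0 - x)).
  by apply: itgbl_reflect; rewrite !sub0r !opprB.
have -> : itg a b (fun x => f (x - h)) = itg a b (fun x => (fun y => f (0 - y)) (h - x)).
  by apply: eq_itg => x _; rewrite sub0r opprB.
rewrite (itg_reflect fN).
by rewrite (@itg_reflect 0 (h - b) (h - a) f) ?sub0r ?opprB.
Qed.

End Reflection.

(** * The energy inequality between two times *)

Section Slice.
Context {R : realType}.
Notation mu := (@lebesgue_measure R).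
Notation mR := (measurableTypeR R).

Definition cube_pos (s : R) : R := pos s ^+ 3 / 3.

Lemma cube_pos_ge0 s : 0 <= cube_pos s.
Proof. by rewrite divr_ge0// exprn_ge0// pos_ge0. Qed.

Lemma cube_pos_continuous : continuous cube_pos.
Proof.
move=> s; apply: cvgM; last exact: cvg_cst.
apply: (@continuous_comp _ _ _ (@pos R) (fun s : R => s ^+ 3)); first exact: pos_continuous.
exact: exprn_continuous.
Qed.

(** The tangent inequality for the convex function s_+^3 / 3. With X = x_+ and Y = y_+ it reduces to
    y <= Y and (X - Y)^2 (2 X + Y) >= 0. *)
Lemma cube_pos_convex (x y : R) : cube_pos x - cube_pos y <= pos x ^+ 2 * (x - y).
Proof.
have X0 := pos_ge0 x; have Y0 := pos_ge0 y.
have yY : y <= pos y by rewrite /pos le_max lexx.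
have xX : pos x ^+ 2 * x = pos x ^+ 3.
  have [x0|x0] := leP 0 x; first by rewrite (pos_gt0E x0); ring.
  by rewrite (pos_le0E (ltW x0)); ring.
rewrite /cube_pos mulrBr xX; move: (pos x) (pos y) X0 Y0 yY => X Y X0 Y0 yY.
have h1 : X ^+ 2 * y <= X ^+ 2 * Y by rewrite ler_wpM2l// sqr_ge0.
have h2 : 0 <= (X - Y) ^+ 2 * (2 * X + Y).
  by rewrite mulr_ge0 ?sqr_ge0// addr_ge0// mulr_ge0.
rewrite -subr_ge0; rewrite -subr_ge0 in h1.
have -> : X ^+ 3 - X ^+ 2 * y - (X ^+ 3 / 3 - Y ^+ 3 / 3) =
  (X ^+ 2 * Y - X ^+ 2 * y) + ((X - Y) ^+ 2 * (2 * X + Y)) / 3 by field.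
by rewrite addr_ge0// divr_ge0.
Qed.

(** Here [f] and [f0] stand for D at a later and an earlier time, [d] for D_x at the later one, and
    c + (integral of K) for the flux difference integrated over the time between. Convexity bounds
    the energy increment by the integral of f_+^2 K; integration by parts moves the derivative from
    the flux to f_+^2, and the boundary terms vanish as f <= 0 at both ends. *)
Lemma slice_energy a b c (f f0 d K : R -> R) : a <= b ->
  {within `[a, b], continuous f0} -> itgbl a b d -> itgbl a b K ->
  (forall x, a <= x <= b -> f x - f a = itg a x d) ->
  f a <= 0 -> f b <= 0 ->
  (forall x, a <= x <= b -> f x - f0 x <= K x) ->
  let q x := 2 * pos (f x) * d x * (c + itg a x K) in
  itgbl a b q /\
  itg a b (fun x => cube_pos (f x)) - itg a b (fun x => cube_pos (f0 x)) <= - itg a b q.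
Proof.
move=> ab cf0 di Ki fE fa fb fK q.
have cf := prim_cont ab di fE.
pose g x := 2 * pos (f x) * d x.
have [gi _] := ac_chain_rule_pos ab di fE.
have psiE x : a <= x <= b -> pos (f x) ^+ 2 - pos (f a) ^+ 2 = itg a x g.
  move=> /andP[ax xb].
  have fE' y : a <= y <= x -> f y - f a = itg a y d.
    by move=> /andP[ay yx]; apply: fE; rewrite ay (le_trans yx).
  by have [_ <-] := ac_chain_rule_pos ax (itgblS (lexx a) xb di) fE'.
have GE x : a <= x <= b -> c + itg a x K - (c + itg a a K) = itg a x K.
  by move=> _; rewrite itg1; ring.
have [psiK qi H] := ac_parts ab gi Ki psiE GE.
split => //.
rewrite (pos_le0E fa) (pos_le0E fb) expr0n/= !mul0r subrr in H.
have -> : - itg a b q = itg a b (fun x => pos (f x) ^+ 2 * K x).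
  by apply/eqP; rewrite eq_sym -subr_eq0 opprK; apply/eqP; rewrite [RHS]H.
have cP (h : R -> R) : {within `[a, b], continuous h} -> itgbl a b (fun x => cube_pos (h x)).
  move=> ch; have cc := comp_within_continuous ch cube_pos_continuous.
  exact: (itgbl_within cc).
rewrite -itgB; [|exact: cP|exact: cP].
apply: itg_le => //; first by apply: itgblB; exact: cP.
move=> x xab; apply: le_trans (cube_pos_convex _ _) _.
by rewrite ler_wpM2l ?sqr_ge0// fK.
Qed.

(** The integrals of E and E0 may be infinite, so nothing is subtracted: the negative part of q is
    added to E and the positive part to E0, and only the finite integral of the negative part is
    cancelled. *)
Lemma ge0_integral_shift (E E0 : R -> \bar R) (q : R -> R) :
  measurable_fun setT E -> measurable_fun setT E0 ->
  (forall x, 0 <= E x)%E -> (forall x, 0 <= E0 x)%E ->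
  mu.-integrable setT (EFin \o q) ->
  {ae mu, forall x, E x = E0 x + (q x)%:E}%E ->
  (\int[mu]_x E x = \int[mu]_x E0 x + \int[mu]_x (q x)%:E)%E.
Proof.
move=> mE mE0 E_ge0 E0_ge0 qi EE.
have mq : measurable_fun setT (EFin \o q) by case/integrableP : qi.
have mqp := measurable_funepos mq; have mqn := measurable_funeneg mq.
have h : (\int[mu]_x (E x + (EFin \o q)^\- x) = \int[mu]_x (E0 x + (EFin \o q)^\+ x))%E.
  apply: ae_eq_integral => //; [exact: emeasurable_funD|exact: emeasurable_funD|].
  apply: filterS EE; first exact: (ae_filter_ringOfSetsType mu).
  move=> x Ex _; rewrite Ex -addeA; congr (_ + _)%E.
  rewrite -[X in (X + _)%E]/((EFin \o q) x) {1}(funeposneg (EFin \o q)) subeK//.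
  by rewrite funenegE /= -EFin_max.
rewrite !ge0_integralD// in h.
have fn : (\int[mu]_x (EFin \o q)^\- x)%E \is a fin_num.
  exact: (integrable_neg_fin_num measurableT qi).
have fp : (\int[mu]_x (EFin \o q)^\+ x)%E \is a fin_num.
  exact: (integrable_pos_fin_num measurableT qi).
rewrite [X in (_ = _ + X)%E]integralE addeA -h addeK//.
Qed.
End Slice.

(** * Functions continuous in both variables *)

Section Tube.
Context {R : realType}.
Implicit Types f : R -> R -> R.

Definition cont2 f := continuous (fun z : R * R => f z.1 z.2).

Lemma cont2_x f t : cont2 f -> continuous (f ^~ t).
Proof.
move=> cf x; have h : continuous (fun z => f z.1 z.2) := cf.
by apply: (@continuous2_cvg _ _ _ _ _ _ id (fun=> t) f x t (cf (x, t)));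
  [exact: cvg_id|exact: cvg_cst].
Qed.

Lemma cont2_t f x : cont2 f -> continuous (f x).
Proof.
move=> cf t.
by apply: (@continuous2_cvg _ _ _ _ _ _ (fun=> x) id f x t (cf (x, t)));
  [exact: cvg_cst|exact: cvg_id].
Qed.

Lemma cont2_of_x (g : R -> R) : continuous g -> cont2 (fun x _ => g x).
Proof. by move=> cg z; apply: (@continuous_comp _ _ _ (fun z : R * R => z.1) g); [exact: cvg_fst|exact: cg]. Qed.

Lemma cont2_of_t (g : R -> R) : continuous g -> cont2 (fun _ t => g t).
Proof. by move=> cg z; apply: (@continuous_comp _ _ _ (fun z : R * R => z.2) g); [exact: cvg_snd|exact: cg]. Qed.

Lemma cont2_cst (k : R) : cont2 (fun _ _ => k).
Proof. by move=> z; exact: cvg_cst. Qed.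

Lemma cont2M f g : cont2 f -> cont2 g -> cont2 (fun x t => f x t * g x t).
Proof. by move=> cf cg z; apply: cvgM; [exact: cf|exact: cg]. Qed.

Lemma cont2_comp (g : R -> R) f : continuous g -> cont2 f -> cont2 (fun x t => g (f x t)).
Proof. by move=> cg cf z; apply: (@continuous_comp _ _ _ (fun z : R * R => f z.1 z.2) g); [exact: cf|exact: cg]. Qed.

Lemma cont2_reflect (c : R) f : cont2 f -> cont2 (fun x t => f (c - x) t).
Proof.
move=> cf z; apply: (@continuous_comp _ _ _ (fun z : R * R => (c - z.1, z.2)) (fun z => f z.1 z.2)); last exact: cf.
apply: (@cvg_pair _ _ _ _ (nbhs (c - z.1)) (nbhs z.2)); last exact: cvg_snd.
by apply: cvgB; [exact: cvg_cst|exact: cvg_fst].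
Qed.

(** Compactness of [a, b], as a near-covering property, makes the neighbourhood of t uniform in
    x. *)
Lemma cont2_tube f a b t e : cont2 f -> 0 < e ->
  \forall s \near t, forall x, a <= x <= b -> `|f x s - f x t| <= e.
Proof.
move=> cf e0.
have cov : near_covering `[a, b]%classic.
  exact/compact_near_coveringP/segment_compact.
have h := cov _ (nbhs t) (fun s x => `|f x s - f x t| <= e) (nbhs_filter t).
apply: filterS (h _); first by move=> s hs x xab; apply: hs; rewrite /= in_itv.
move=> x _.
have e2 : 0 < e / 2 by rewrite divr_gt0.
have /cvgrPdist_le /(_ _ e2)[[A B] /= [hA hB] hAB] := cf (x, t).
have /cvgrPdist_le /(_ _ e2) h2 := @cont2_x f t cf x.
exists (A `&` [set x' | `|f x t - f x' t| <= e / 2], B); first by split => //; exact: filterI.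
move=> [x' s] /= [[Ax' hx'] Bs].
have /= := hAB (x', s) (conj Ax' Bs).
rewrite distrC (_ : f x' s - f x' t = (f x' s - f x t) + (f x t - f x' t)); last by ring.
move=> h1; rewrite (le_trans (ler_normD _ _))//.
by rewrite [leRHS](splitr e) lerD.
Qed.

Lemma cont2_bound f a b t0 t1 : cont2 f ->
  exists M : R, 0 < M /\ forall x t, a <= x <= b -> t0 <= t <= t1 -> `|f x t| <= M.
Proof.
move=> cf.
have cK : compact (`[a, b]%classic `*` `[t0, t1]%classic).
  by apply: compact_setX; exact: segment_compact.
have := @continuous_compact _ _ (fun z : R * R => f z.1 z.2) _ _ cK.
move=> /(_ _)/compact_bounded h.
have [M [_ hM]] := h (continuous_subspaceT cf).
exists (Num.max M 0 + 1); split; first by rewrite ltr_wpDl// le_max lexx orbT.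
move=> x t xab tt; apply: (hM (Num.max M 0 + 1)); last first.
  by exists (x, t) => //; split; rewrite /= in_itv.
by rewrite ltr_pwDr// le_max lexx.
Qed.

Lemma cont_bound (g : R -> R) a b : continuous g ->
  exists M : R, 0 < M /\ forall x, a <= x <= b -> `|g x| <= M.
Proof.
move=> cg; have [M [M0 hM]] := @cont2_bound (fun x _ => g x) a b 0 0 (cont2_of_x cg).
by exists M; split => // x xab; apply: (hM x 0) => //; rewrite lexx.
Qed.

End Tube.

(** * Averages over windows and inequalities between integrals *)

Section Comparison_lemmas.
Context {R : realType}.
Notation mu := (@lebesgue_measure R).
Notation mR := (measurableTypeR R).

Lemma itg_cont2 (f : R -> R -> R) a b : a <= b -> cont2 f ->
  continuous (fun t => itg a b (f ^~ t)).
Proof.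
move=> ab cf t; apply/cvgrPdist_le => e e0.
have ba : 0 < b - a + 1 by rewrite ltr_wpDl// subr_ge0.
have e1 : 0 < e / (b - a + 1) by rewrite divr_gt0.
apply: filterS (@cont2_tube _ f a b t _ cf e1) => s hs.
have ci r : itgbl a b (f ^~ r) by apply: itgbl_cont; exact: cont2_x.
rewrite -itgB// (le_trans (itg_norm _))//; first exact: itgblB.
apply: (@le_trans _ _ (itg a b (fun=> e / (b - a + 1)))).
  apply: itg_le; [exact/itgbl_norm/itgblB|exact: itgbl_cst|].
  by move=> x /hs; rewrite distrC.
rewrite itg_cst// mulrAC ler_pdivrMr// ler_wpM2l ?(ltW e0)//.
by rewrite lerDl.
Qed.

Lemma itg_gt0 (f : R -> R) a b x : continuous f -> (forall y, 0 <= f y) ->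
  a < x -> x < b -> 0 < f x -> 0 < itg a b f.
Proof.
move=> cf f0 ax xb fx0.
have fx2 : 0 < f x / 2 by rewrite divr_gt0.
have /cvgrPdist_le /(_ _ fx2) := cf x.
move=> /nbhs_ballP[r /= r0 hr].
pose e := Num.min (r / 2) (Num.min (x - a) (b - x)).
have e0 : 0 < e by rewrite !lt_min divr_gt0// !subr_gt0 ax xb.
have er : e < r by rewrite gt_min gtr_pMr// invf_lt1// ltr1n.
have ea : e <= x - a by rewrite !ge_min lexx orbT.
have eb : e <= b - x by rewrite !ge_min lexx !orbT.
have fi y z : itgbl y z f by exact: itgbl_cont.
have axe : a <= x by exact: ltW.
have xe : x <= x + e by rewrite lerDl ltW.
have xeb : x + e <= b by rewrite -lerBrDl.
rewrite (itg_split (x := x) axe (ltW xb))// (itg_split (x := x + e) xe xeb)//.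
have h1 : 0 <= itg a x f by apply: itg_ge0.
have h2 : 0 <= itg (x + e) b f by apply: itg_ge0.
suff : 0 < itg x (x + e) f by lra.
apply: (@lt_le_trans _ _ (itg x (x + e) (fun=> f x / 2))).
  by rewrite itg_cst// addrAC subrr add0r mulr_gt0.
apply: itg_le => //; first exact: itgbl_cst.
move=> y /andP[xy ye]; have := hr y.
rewrite /ball/= => /(_ _); rewrite ler_norml => /(_ _)/andP[]; last by lra.
by rewrite ltr_norml; apply/andP; split; lra.
Qed.

(** Each term contributes one integral of w: s runs through a window of length 1/(n+1) before t, and
    after Tonelli's theorem t runs through one of the same length after s. *)
Lemma integral_window (w : R -> R) n : measurable_fun setT w -> (forall t, 0 <= w t) ->
  (\int[mu]_t \int[mu]_s (if (t - n.+1%:R^-1 <= s) && (s <= t)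
      then n.+1%:R * (w t + w s) else 0)%:E = \int[mu]_t (2 * w t)%:E)%E.
Proof.
move=> mw w0; set h : R := n.+1%:R^-1.
have h0 : 0 <= h by rewrite invr_ge0.
pose k1 (z : mR * mR) : R := if (z.1 - h <= z.2) && (z.2 <= z.1) then n.+1%:R * w z.1 else 0.
pose k2 (z : mR * mR) : R := if (z.1 - h <= z.2) && (z.2 <= z.1) then n.+1%:R * w z.2 else 0.
have mb : measurable_fun setT (fun z : mR * mR => (z.1 - h <= z.2) && (z.2 <= z.1)).
  apply: measurable_and; apply: measurable_fun_ler => //.
  exact: measurable_funB.
have mk1 : measurable_fun setT (EFin \o k1).
  apply/measurable_EFinP; apply: measurable_fun_ifT => //.
  by apply: measurable_funM => //; exact: measurableT_comp.
have mk2 : measurable_fun setT (EFin \o k2).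
  apply/measurable_EFinP; apply: measurable_fun_ifT => //.
  by apply: measurable_funM => //; exact: measurableT_comp.
have k10 z : (0 <= (EFin \o k1) z)%E by rewrite lee_fin /k1; case: ifP => // _; rewrite mulr_ge0.
have k20 z : (0 <= (EFin \o k2) z)%E by rewrite lee_fin /k2; case: ifP => // _; rewrite mulr_ge0.
have win (u v c : R) : u <= v -> 0 <= c ->
    (\int[mu]_s (if ((u <= s) && (s <= v))%R then c else 0)%:E = (c * (v - u))%:E)%E.
  move=> uv c0; rewrite -itg_cst// /itg /Rintegral fineK; last first.
    by apply: integrable_fin_num => //; exact: (itgbl_cst u v c).
  rewrite [RHS]integral_mkcond; apply: eq_integral => s _.
  by rewrite patchE mem_setE in_itv/=; case: ifP.
have i1 t : (\int[mu]_s (k1 (t, s))%:E = (w t)%:E)%E.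
  rewrite /k1 /= win ?mulr_ge0 ?gerBl//; congr EFin.
  by rewrite opprB addrC subrK mulrAC mulfV ?mul1r// pnatr_eq0.
have i2 s : (\int[mu]_t (k2 (t, s))%:E = (w s)%:E)%E.
  rewrite (_ : (fun t => _) = (fun t => (if (s <= t) && (t <= s + h) then n.+1%:R * w s else 0)%:E)).
    rewrite win ?mulr_ge0 ?lerDl//; congr EFin.
    by rewrite addrAC subrr add0r mulrAC mulfV ?mul1r// pnatr_eq0.
  apply/funext => t; rewrite /k2/=; congr EFin.
  by rewrite andbC lerBlDr.
have mwE : measurable_fun setT (fun t => (w t)%:E) by exact/measurable_EFinP.
transitivity (\int[mu]_t (\int[mu]_s (k1 (t, s))%:E + \int[mu]_s (k2 (t, s))%:E))%E.
  apply: eq_integral => t _; rewrite -ge0_integralD//.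
  - apply: eq_integral => s _; rewrite /k1 /k2/= -EFinD; congr EFin.
    by case: ifP => _; rewrite ?addr0// mulrDr.
  - by move=> s _; exact: (k10 (t, s)).
  - exact: (measurableT_comp mk1 (pair1_measurable t)).
  - by move=> s _; exact: (k20 (t, s)).
  - exact: (measurableT_comp mk2 (pair1_measurable t)).
rewrite ge0_integralD//; first last.
- exact: (measurable_fun_fubini_tonelli_F (m2 := mu) (EFin \o k2) mk2 k20).
- by move=> t _; apply: integral_ge0 => s _; exact: (k20 (t, s)).
- exact: (measurable_fun_fubini_tonelli_F (m2 := mu) (EFin \o k1) mk1 k10).
- by move=> t _; apply: integral_ge0 => s _; exact: (k10 (t, s)).
have := fubini_tonelli (m1 := mu) (m2 := mu) (EFin \o k2) mk2 k20 => /= ->.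
under eq_integral do rewrite i1.
under [X in (_ + X)%E]eq_integral do rewrite i2.
rewrite -ge0_integralD//; last first.
- by move=> t _; rewrite lee_fin.
- by move=> t _; rewrite lee_fin.
by apply: eq_integral => t _; rewrite -EFinD -mulr2n mulr_natl.
Qed.

Lemma ae_le_integralD (f f0 : R -> \bar R) (y y0 : R -> R) :
  measurable_fun setT f -> measurable_fun setT f0 ->
  measurable_fun setT (EFin \o y) -> measurable_fun setT (EFin \o y0) ->
  (forall t, 0 <= f t)%E -> (forall t, 0 <= f0 t)%E ->
  (forall t, 0 <= y t) -> (forall t, 0 <= y0 t) ->
  {ae mu, forall t, f t + (y t)%:E <= f0 t + (y0 t)%:E}%E ->
  (\int[mu]_t f t + \int[mu]_t (y t)%:E <= \int[mu]_t f0 t + \int[mu]_t (y0 t)%:E)%E.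
Proof.
move=> mf mf0 my my0 f_ge0 f0_ge0 y_ge0 y0_ge0 le_ff0.
have yE t : (0 <= (y t)%:E)%E by rewrite lee_fin.
have y0E t : (0 <= (y0 t)%:E)%E by rewrite lee_fin.
rewrite -ge0_integralD// -ge0_integralD//.
apply: ae_ge0_le_integral => //.
- by move=> t _; exact: adde_ge0.
- exact: emeasurable_funD.
- by move=> t _; exact: adde_ge0.
- exact: emeasurable_funD.
move: le_ff0; apply: filterS; first exact: (ae_filter_ringOfSetsType mu).
by move=> t h _.
Qed.

End Comparison_lemmas.

(** * Comparison principle *)

Lemma ae_neq_set1 (R : realType) (r : R) : {ae (@lebesgue_measure R), forall t : R, t <> r}.
Proof.
exists [set r]; split => //; first exact: lebesgue_measure_set1.
by move=> t /= h; apply: contrapT => n; apply: h.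
Qed.

Lemma lee_cancel_fin (R : realType) (A B A0 Y Z : \bar R) (y z w : R) :
  (A + Y <= B + Z)%E -> B = A0 -> Y = y%:E -> Z = z%:E -> y = z + w ->
  (A + w%:E <= A0)%E.
Proof.
move=> h <- Yy Zz yzw; move: h; rewrite Yy Zz yzw EFinD [(z%:E + _)%E]addeC addeA.
by rewrite leeD2rE.
Qed.

Section Comparison.
Context {R : realType}.
Notation mu := (@lebesgue_measure R).
Notation mR := (measurableTypeR R).
Variables (a b t0 t1 : R).
Implicit Types f : R -> R -> R.

(** Extension by 0 lets Fubini, Tonelli and Fatou run over the whole plane, and lets Steklov windows
    that start before t0 meet only zeros there. *)
Definition cutoff (f : R -> R -> R) x t :=
  if (a <= x <= b) && (t0 <= t <= t1) then f x t else 0.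

Lemma mfun2_cutoff f : mfun2 f -> mfun2 (cutoff f).
Proof.
move=> mf; apply: measurable_fun_ifT => //.
by apply: measurable_and; apply: measurable_and; apply: measurable_fun_ler.
Qed.

Lemma measurable_integral_t f : mfun2 f -> (forall x t, 0 <= f x t) ->
  measurable_fun setT (fun x => \int[mu]_t (f x t)%:E)%E.
Proof.
move=> mf f0.
apply: (measurable_fun_fubini_tonelli_F (m2 := mu) (fun z : mR * mR => (f z.1 z.2)%:E)).
  exact/measurable_EFinP.
by move=> z; rewrite lee_fin.
Qed.

Lemma integral_t_ge0 f x : (forall x t, 0 <= f x t) -> (0 <= \int[mu]_t (f x t)%:E)%E.
Proof. by move=> f0; apply: integral_ge0 => t _; rewrite lee_fin. Qed.

Lemma mfun2_t f x : mfun2 f -> measurable_fun setT (fun t => (f x t)%:E).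
Proof. by move=> mf; apply/measurable_EFinP; exact: (measurableT_comp mf (pair1_measurable x)). Qed.

Variables (D d j N : R -> R -> R).
Hypothesis ab : a <= b.
Hypothesis t01 : t0 < t1.
Hypothesis cD : cont2 D.
Hypotheses (mD : mfun2 D) (md : mfun2 d) (mj : mfun2 j) (mN : mfun2 N).
Hypothesis acD : {ae mu, forall t, t0 < t < t1 -> itgbl a b (d ^~ t) /\
  forall x, a <= x <= b -> D x t - D a t = itg a x (d ^~ t)}.
Hypothesis N0 : forall x t, 0 <= N x t.
Hypothesis Noo : (\int[mu]_x \int[mu]_t (cutoff N x t)%:E < +oo)%E.
(** The two factors sit at different times, so the majorant is a sum over both times; for flows it
    comes from Young's inequality. *)
Hypothesis djN : forall x t s, a <= x <= b -> t0 <= t <= t1 -> t0 <= s <= t1 ->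
  `|d x t * j x s| <= N x t + N x s.
Hypothesis jN : forall x t, a <= x <= b -> t0 <= t <= t1 -> `|j x t| <= 1 + N x t.
Hypothesis dj0 : forall x t, a <= x <= b -> t0 <= t <= t1 -> 0 <= d x t * j x t.
(** The inequality D_t <= j_x integrated over [s, t]: K dominates the increment of D and is the
    space derivative of the time integral of j. *)
Hypothesis flux : forall s t, t0 <= s -> s < t -> t <= t1 -> exists K c,
  [/\ itgbl a b K, forall x, a <= x <= b -> D x t - D x s <= K x &
      {ae mu, forall x, a <= x <= b -> itg s t (j x) = c + itg a x K}].
Hypothesis Da : forall t, t0 <= t <= t1 -> D a t <= 0.
Hypothesis Db : forall t, t0 <= t <= t1 -> D b t <= 0.
Hypothesis D0 : forall x, a <= x <= b -> D x t0 <= 0.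

Let Y t := itg a b (fun x => cube_pos (D x t)).

Let cPD : cont2 (fun x t => cube_pos (D x t)).
Proof.
apply: (@cont2_comp _ (@cube_pos R) D); last exact: cD.
exact: cube_pos_continuous.
Qed.

Let cY : continuous Y. Proof. exact: itg_cont2. Qed.

Let Y_ge0 t : 0 <= Y t.
Proof. by apply: itg_ge0 => x _; exact: cube_pos_ge0. Qed.

Let Yt0 : Y t0 = 0.
Proof.
rewrite /Y (@eq_itg _ _ _ _ (fun=> 0)) ?itg_cst ?mul0r// => x /D0 Dx.
by rewrite /cube_pos pos_le0E// expr0n/= mul0r.
Qed.

Section with_bound.
Variable C : R.
Hypothesis C0 : 0 < C.
Hypothesis CD : forall x t, a <= x <= b -> t0 <= t <= t1 -> 2 * pos (D x t) <= C.

Let g := cutoff (fun x t => 2 * pos (D x t) * d x t).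
Let j' := cutoff j.
Let N' := cutoff (fun x t => C * N x t).

Let mg : mfun2 g.
Proof.
apply: mfun2_cutoff; apply: measurable_funM => //.
apply: measurable_funM => //.
by apply: (measurableT_comp (f := @pos R)) => //; apply: continuous_measurable_fun; exact: pos_continuous.
Qed.
Let mj' : mfun2 j'. Proof. exact: mfun2_cutoff. Qed.
Let mN' : mfun2 N'. Proof. by apply: mfun2_cutoff; exact: measurable_funM. Qed.
Let m0 : mfun2 (fun _ _ : R => 0 : R). Proof. exact: measurable_cst. Qed.
Let N'0 x t : 0 <= N' x t.
Proof. by rewrite /N' /cutoff; case: ifP => // _; rewrite mulr_ge0// ltW. Qed.
Let gjN' x t s : `|g x t * j' x s| <= N' x t + N' x s.
Proof.
rewrite /g /j' /N' /cutoff.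
case: ifP => [/andP[xab tt]|_]; last first.
  by rewrite mul0r normr0 add0r; case: ifP => // _; rewrite mulr_ge0// ltW.
case: ifP => [/andP[_ ss]|_]; last by rewrite mulr0 normr0 addr0 mulr_ge0// ltW.
rewrite -mulrA normrM ger0_norm ?mulr_ge0 ?pos_ge0// -mulrDr.
by rewrite ler_pM ?mulr_ge0 ?pos_ge0 ?CD ?djN.
Qed.
Let zjN' x t s : `|(fun _ _ : R => 0 : R) x t * j' x s| <= N' x t + N' x s.
Proof. by rewrite mul0r normr0 addr_ge0. Qed.
Let gj0 x t : 0 <= g x t * j' x t.
Proof.
rewrite /g /j' /cutoff; case: ifP => [/andP[xab tt]|_]; last by rewrite mul0r.
by rewrite -mulrA mulr_ge0 ?dj0// mulr_ge0// pos_ge0.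
Qed.

Let cutN0 x t : 0 <= cutoff N x t. Proof. by rewrite /cutoff; case: ifP. Qed.

Let N'E : (\int[mu]_x \int[mu]_t (N' x t)%:E = C%:E * \int[mu]_x \int[mu]_t (cutoff N x t)%:E)%E.
Proof.
have m1 := measurable_integral_t (mfun2_cutoff mN) cutN0.
rewrite -ge0_integralZl//; [|by move=> x _; exact: integral_t_ge0|by rewrite lee_fin ltW].
apply: eq_integral => x _.
have m2 := mfun2_t x (mfun2_cutoff mN).
rewrite -ge0_integralZl//; [|by move=> t _; rewrite lee_fin|by rewrite lee_fin ltW].
by apply: eq_integral => t _; rewrite -EFinM /N' /cutoff; case: ifP => //; rewrite mulr0.
Qed.

Let N'oo : (\int[mu]_x \int[mu]_t (N' x t)%:E < +oo)%E.
Proof.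
rewrite N'E lte_mul_pinfty//; first by rewrite lee_fin ltW.
Qed.

Let j'oo : (\int[mu]_x \int[mu]_t `|j' x t|%:E < +oo)%E.
Proof.
pose one := cutoff (fun _ _ => 1).
have one0 x t : 0 <= one x t by rewrite /one /cutoff; case: ifP.
have mone : mfun2 one by apply: mfun2_cutoff; exact: measurable_cst.
apply: (@le_lt_trans _ _ (\int[mu]_x (\int[mu]_t (one x t)%:E + \int[mu]_t (cutoff N x t)%:E))%E).
  have m1 := measurable_integral_t (mfun2_cutoff mN) cutN0.
  have m2 := measurable_integral_t mone one0.
  have mabs : mfun2 (fun x t => `|j' x t|) by exact: measurableT_comp.
  apply: ge0_le_integral => //.
  - by move=> x _; apply: (@integral_t_ge0 (fun x t => `|j' x t|)).
  - exact: (measurable_integral_t mabs).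
  - exact: emeasurable_funD.
  move=> x _.
  have m3 := mfun2_t x (mfun2_cutoff mN).
  have m4 := mfun2_t x mone.
  have m5 := mfun2_t x mabs.
  rewrite -ge0_integralD//; [|by move=> t _; rewrite lee_fin|by move=> t _; rewrite lee_fin].
  apply: ge0_le_integral => //.
  - exact: emeasurable_funD.
  move=> t _; rewrite -EFinD lee_fin /j' /one /cutoff; case: ifP => [/andP[xab tt]|_].
    exact: jN.
  by rewrite normr0 addr0.
have m1 := measurable_integral_t (mfun2_cutoff mN) cutN0.
have m2 := measurable_integral_t mone one0.
rewrite ge0_integralD//; [|by move=> x _; exact: integral_t_ge0|by move=> x _; exact: integral_t_ge0].
apply: lte_add_pinfty; last exact: Noo.
have oneE x : (\int[mu]_t (one x t)%:E = ((t1 - t0) * (if (a <= x <= b)%R then 1 else 0))%:E)%E.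
  rewrite /one /cutoff; case: (a <= x <= b) => /=; last by rewrite mulr0 integral0.
  rewrite mulr1 -[t1 - t0]mul1r -(itg_cst _ (ltW t01)) /itg /Rintegral fineK; last first.
    by apply: integrable_fin_num => //; exact: (itgbl_cst t0 t1 1).
  rewrite [RHS]integral_mkcond; apply: eq_integral => s _.
  by rewrite patchE mem_setE in_itv/=; case: ifP.
under eq_integral do rewrite oneE.
rewrite (_ : (\int[mu]_x _ = (itg a b (fun=> (t1 - t0)))%:E)%E) ?ltry//.
rewrite /itg /Rintegral fineK; last first.
  by apply: integrable_fin_num => //; exact: (itgbl_cst a b).
rewrite [RHS]integral_mkcond; apply: eq_integral => s _.
by rewrite patchE mem_setE in_itv/=; case: ifP; rewrite ?mulr1 ?mulr0.
Qed.

Let E n x t := steklov_energy g j' N' n x t.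
Let E0 n x t := steklov_energy (fun _ _ => 0) j' N' n x t.

Let mE n := measurable_steklov_energy mg mj' mN' gjN' n.
Let mE0 n := measurable_steklov_energy m0 mj' mN' zjN' n.
Let E_ge0 n x t : (0 <= E n x t)%E. Proof. exact: steklov_energy_ge0. Qed.
Let E0_ge0 n x t : (0 <= E0 n x t)%E. Proof. exact: steklov_energy_ge0. Qed.

Let E0_total n : (\int[mu]_t \int[mu]_x E0 n x t = \int[mu]_x \int[mu]_t (2 * N' x t)%:E)%E.
Proof.
have := fubini_tonelli (m1 := mu) (m2 := mu) (fun z : mR * mR => E0 n z.1 z.2) (mE0 n)
  (fun z => E0_ge0 n z.1 z.2) => /= <-.
apply: eq_integral => x _.
rewrite -(integral_window n (measurableT_comp mN' (pair1_measurable x)) (N'0 x)).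
apply: eq_integral => t _; apply: eq_integral => s _; congr EFin.
by rewrite /steklov_kernel mul0r add0r.
Qed.

(** Windows are truncated at t0 because [j'] vanishes before it. The energy increment is then taken
    from t0, where Y = 0. *)
Let window h x t : 0 < h -> t0 <= t <= t1 -> a <= x <= b ->
  itg (t - h) t (j' x) = itg (Num.max (t - h) t0) t (j x).
Proof.
move=> h0 /andP[tt0 tt1] xab; rewrite /itg Rintegral_mkcond [RHS]Rintegral_mkcond.
congr Rintegral; apply/funext => s; rewrite !patchE !mem_setE !in_itv/=.
rewrite /j' /cutoff xab ge_max/=.
case: (leP (t - h) s) => //= _; case: (leP s t) => st; last by rewrite andbF.
by rewrite (le_trans st tt1) !andbT.
Qed.

Let j'int x : mu.-integrable setT (fun t => (j' x t)%:E) ->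
  forall u v, itgbl u v (j' x).
Proof. by move=> h u v; apply: integrableS h. Qed.

(** The difference E - E0 is n + 1 times the integrand q of [slice_energy], since N enters both
    kernels alike. Its integral is at most -(n + 1) times the increment of Y. The terms are arranged
    as sums because the integrals of E and E0 are extended reals. *)
Let slice_bound n : {ae mu, forall t, t0 < t < t1 ->
  (\int[mu]_x E n x t + (n.+1%:R * Y t)%:E <=
   \int[mu]_x E0 n x t + (n.+1%:R * Y (Num.max (t - n.+1%:R^-1) t0))%:E)%E}.
Proof.
have mNE : measurable_fun setT (fun z : mR * mR => (N' z.1 z.2)%:E) by exact/measurable_EFinP.
have mjE : measurable_fun setT (fun z : mR * mR => (j' z.1 z.2)%:E) by exact/measurable_EFinP.
have Nx : {ae mu, forall x, mu.-integrable setT (fun t => (N' x t)%:E)}.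
  suff h : (mu \x mu)%E.-integrable setT (fun z : mR * mR => (N' z.1 z.2)%:E).
    exact: (ae_integrable1 h).
  apply/integrable12ltyP; first exact: mNE.
  rewrite (_ : (\int[mu]_x _ = \int[mu]_x \int[mu]_t (N' x t)%:E)%E); first exact: N'oo.
  by apply: eq_integral => x _; apply: eq_integral => t _; rewrite gee0_abs// lee_fin.
have jx : {ae mu, forall x, mu.-integrable setT (fun t => (j' x t)%:E)}.
  suff h : (mu \x mu)%E.-integrable setT (fun z : mR * mR => (j' z.1 z.2)%:E).
    exact: (ae_integrable1 h).
  apply/integrable12ltyP; [exact: mjE|exact: j'oo].
move: acD; apply: filterS; first exact: (ae_filter_ringOfSetsType mu).
move=> t + tt => /(_ tt)[di DE]; have /andP[t0t tt1] := tt.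
have tt' : t0 <= t <= t1 by rewrite !ltW.
set h : R := n.+1%:R^-1; have h0 : 0 < h by rewrite invr_gt0.
set s := Num.max (t - h) t0.
have st : s < t by rewrite /s gt_max t0t gtrBl h0.
have t0s : t0 <= s by rewrite le_max lexx orbT.
have [K [c [Ki DK jK]]] := flux t0s st (ltW tt1).
have cDs : {within `[a, b], continuous (D ^~ s)}.
  by apply: continuous_subspaceT; exact: cont2_x.
have [qi qle] := @slice_energy _ _ _ c _ _ _ _ ab cDs di Ki DE (Da tt') (Db tt') DK.
set q := (fun x => _) in qi qle.
pose Q x := if a <= x <= b then n.+1%:R * q x else 0.
have QE : EFin \o Q = (EFin \o (fun x => n.+1%:R * q x)) \_ `[a, b].
  apply/funext => x; rewrite patchE mem_setE in_itv/= /Q.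
  by case: ifP.
have Qi : mu.-integrable setT (EFin \o Q).
  rewrite QE -integrable_mkcond//; exact: (itgblZ _ qi).
have QI : (\int[mu]_x (Q x)%:E = (n.+1%:R * itg a b q)%:E)%E.
  rewrite -itgZ// /itg /Rintegral fineK; last first.
    by apply: integrable_fin_num => //; exact: (itgblZ _ qi).
  by rewrite [RHS]integral_mkcond -QE.
have EE : {ae mu, forall x, E n x t = E0 n x t + (Q x)%:E}%E.
  move: Nx jx jK; apply: filterS3; first exact: (ae_filter_ringOfSetsType mu).
  move=> x Nx jx jK.
  have [xab|xab] := boolP (a <= x <= b); last first.
    rewrite /Q (negbTE xab) adde0; apply: eq_integral => r _.
    by rewrite /steklov_kernel /g /cutoff (negbTE xab)/=.
  have Ji := j'int jx.
  have Ni u v : itgbl u v (N' x) by apply: integrableS Nx.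
  have i1 := itgblZ (g x t) (Ji (t - h) t).
  have i2 := itgbl_cst (t - h) t (N' x t).
  have i3 := itgblZ 0 (Ji (t - h) t).
  rewrite /E steklov_energyE; last first.
    exact: (itgblD (itgblD i1 i2) (Ni _ _)).
  rewrite /E0 steklov_energyE; last first.
    exact: (itgblD (itgblD i3 i2) (Ni _ _)).
  rewrite (itgD (itgblD i1 i2) (Ni _ _)) (itgD i1 i2).
  rewrite (itgD (itgblD i3 i2) (Ni _ _)) (itgD i3 i2).
  rewrite (itgZ _ (Ji _ _)) (itgZ _ (Ji _ _)).
  rewrite (window h0 tt' xab) -/s (jK xab) -EFinD; congr EFin.
  by rewrite /Q xab /q /g /cutoff xab tt'/=; ring.
have mEt := measurableT_comp (mE n) (pair2_measurable t).
have mE0t := measurableT_comp (mE0 n) (pair2_measurable t).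
rewrite (ge0_integral_shift mEt mE0t (E_ge0 n ^~ t) (E0_ge0 n ^~ t) Qi EE) QI.
rewrite -addeA leeD2l// -EFinD lee_fin -mulrDr ler_wpM2l//.
by rewrite /Y; lra.
Qed.

(** Integrating [slice_bound] in t telescopes: Y and its delayed copy differ in integral only on the
    last window [t1 - h, t1], because the delayed copy equals Y t0 = 0 on the first one. *)
Let total_bound n : n.+1%:R^-1 < t1 - t0 ->
  (\int[mu]_t \int[mu]_x E n x t + (n.+1%:R * itg (t1 - n.+1%:R^-1) t1 Y)%:E <=
   \int[mu]_x \int[mu]_t (2 * N' x t)%:E)%E.
Proof.
set h : R := n.+1%:R^-1 => ht; have h0 : 0 < h by rewrite invr_gt0.
pose y1 t := if t0 <= t <= t1 then n.+1%:R * Y t else 0.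
pose Z t := Y (Num.max (t - h) t0).
pose y2 t := if t0 <= t <= t1 then n.+1%:R * Z t else 0.
have cZ : continuous Z.
  move=> t; apply: (@continuous_comp _ _ _ (fun t => Num.max (t - h) t0) Y); last exact: cY.
  apply: continuous_max; last exact: cvg_cst.
  by apply: cvgB; [exact: cvg_id|exact: cvg_cst].
have Yi u v : itgbl u v Y by exact: itgbl_cont.
have Zi u v : itgbl u v Z by exact: itgbl_cont.
have intE (f : R -> R) : continuous f ->
    (\int[mu]_t (if (t0 <= t <= t1)%R then n.+1%:R * f t else 0)%:E = (n.+1%:R * itg t0 t1 f)%:E)%E.
  move=> cf; have fi := itgblZ n.+1%:R (@itgbl_cont _ t0 t1 _ cf).
  rewrite -itgZ; last exact: itgbl_cont.
  rewrite /itg /Rintegral fineK; last by apply: integrable_fin_num.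
  rewrite [RHS]integral_mkcond; apply: eq_integral => s _.
  by rewrite patchE mem_setE in_itv/=; case: ifP.
have my (f : R -> R) : continuous f ->
    measurable_fun setT (fun t => (if t0 <= t <= t1 then n.+1%:R * f t else 0)%:E).
  move=> cf; apply/measurable_EFinP; apply: measurable_fun_ifT => //.
    by apply: measurable_and; apply: measurable_fun_ler.
  by apply: measurable_funM => //; exact: continuous_measurable_fun.
have y10 t : 0 <= y1 t by rewrite /y1; case: ifP => // _; rewrite mulr_ge0.
have y20 t : 0 <= y2 t by rewrite /y2; case: ifP => // _; apply: mulr_ge0 => //; exact: Y_ge0.
have mEt : measurable_fun setT (fun t => \int[mu]_x E n x t)%E.
  exact: (measurable_fun_fubini_tonelli_G (m1 := mu) (fun z : mR * mR => E n z.1 z.2) (mE n)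
    (fun z => E_ge0 n z.1 z.2)).
have mE0t : measurable_fun setT (fun t => \int[mu]_x E0 n x t)%E.
  exact: (measurable_fun_fubini_tonelli_G (m1 := mu) (fun z : mR * mR => E0 n z.1 z.2) (mE0 n)
    (fun z => E0_ge0 n z.1 z.2)).
have Et0 t : (0 <= \int[mu]_x E n x t)%E by exact: integral_ge0.
have E0t0 t : (0 <= \int[mu]_x E0 n x t)%E by exact: integral_ge0.
have my1 : measurable_fun setT (EFin \o y1) := my _ cY.
have my2 : measurable_fun setT (EFin \o y2) := my _ cZ.
have := ae_le_integralD mEt mE0t my1 my2 Et0 E0t0 y10 y20 => /(_ _) step.
have {}step := step _.
have ae_step : {ae mu, forall t, \int[mu]_x E n x t + (y1 t)%:E <=
                                 \int[mu]_x E0 n x t + (y2 t)%:E}%E.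
  have n1 : {ae mu, forall t, t <> t0} by exact: (@ae_neq_set1 _ t0).
  have n2 : {ae mu, forall t, t <> t1} by exact: (@ae_neq_set1 _ t1).
  move: n1 n2 (slice_bound n); apply: filterS3; first exact: (ae_filter_ringOfSetsType mu).
  move=> t /eqP tt0 /eqP tt1 +.
  have [tt|tt] := boolP (t0 < t < t1).
    move=> /(_ isT) h1; have /andP[/ltW l1 /ltW l2] := tt.
    by rewrite /y1 /y2 l1 l2; exact: h1.
  move=> _; have tt' : t0 <= t <= t1 = false.
    by apply/negbTE; move: tt; rewrite !lt_neqAle (eq_sym t0) tt0 tt1.
  have -> : (\int[mu]_x E n x t = \int[mu]_x E0 n x t)%E.
    apply: eq_integral => x _; apply: eq_integral => r _.
    by rewrite /steklov_kernel /g /cutoff tt' andbF.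
  by rewrite /y1 /y2 tt'; exact: lexx.
have ZE : itg t0 t1 Z = itg t0 (t1 - h) Y.
  have l1 : t0 <= t0 + h by rewrite lerDl ltW.
  have l2 : t0 + h <= t1 by rewrite -lerBrDl ltW.
  rewrite (itg_split l1 l2 (Zi _ _)).
  rewrite (@eq_itg _ t0 (t0 + h) _ (fun=> 0)); last first.
    by move=> t /andP[_ th]; rewrite /Z max_r// lerBlDr.
  rewrite itg_cst// mul0r add0r.
  rewrite (@eq_itg _ (t0 + h) t1 _ (fun t => Y (t - h))); last first.
    by move=> t /andP[th _]; rewrite /Z max_l// lerBrDr.
  by rewrite itg_shift// addrK.
have l1 : t0 <= t1 - h by rewrite lerBrDr -lerBrDl ltW.
have l2 : t1 - h <= t1 by rewrite gerBl ltW.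
apply: (lee_cancel_fin (step ae_step) (E0_total n) (intE _ cY) (intE _ cZ)).
by rewrite ZE (itg_split l1 l2 (Yi _ _)) mulrDr.
Qed.

(** By continuity the average of Y over the last window is at least Y(t1) / 2 for large n. Then
    [total_bound] keeps the total energies below the integral of 2 N' by that fixed amount, against
    the lower bound of [fatou_steklov]. *)
Let Y_pos_absurd : 0 < Y t1 -> False.
Proof.
move=> Y1; pose eta := Y t1 / 2; have eta0 : 0 < eta by rewrite divr_gt0.
have /cvgrPdist_le /(_ _ eta0) := @cY t1.
move=> /nbhs_ballP[r /= r0 hr].
have r1 : 0 < Num.min r (t1 - t0) by rewrite lt_min r0 subr_gt0.
have := @cvg_harmonic R; move=> /cvgrPdist_lt /(_ _ r1)[m _ hm].
have I2 : (\int[mu]_x \int[mu]_t (2 * N' x t)%:E = 2%:E * \int[mu]_x \int[mu]_t (N' x t)%:E)%E.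
  have m1 := measurable_integral_t mN' N'0.
  rewrite -ge0_integralZl//; last by move=> x _; exact: integral_t_ge0.
  apply: eq_integral => x _.
  have m2 := mfun2_t x mN'.
  by rewrite -ge0_integralZl// => t _; rewrite lee_fin.
have fin : (\int[mu]_x \int[mu]_t (2 * N' x t)%:E)%E \is a fin_num.
  have N'fin : (\int[mu]_x \int[mu]_t (N' x t)%:E)%E \is a fin_num.
    rewrite ge0_fin_numE; first exact: N'oo.
    by apply: integral_ge0 => x _; exact: integral_t_ge0.
  by rewrite I2 fin_numM.
have fat := fatou_steklov mg mj' mN' N'0 gjN' gj0 N'oo j'oo.
have := @limn_einf_le R (fun n => \int[mu]_t \int[mu]_x E n x t)%E
  (\int[mu]_x \int[mu]_t (2 * N' x t)%:E - eta%:E)%E m.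
have bnd n : (m <= n)%N -> (\int[mu]_t \int[mu]_x E n x t <=
   \int[mu]_x \int[mu]_t (2 * N' x t)%:E - eta%:E)%E.
  move=> mn; have := hm n mn.
  rewrite sub0r normrN gtr0_norm ?invr_gt0// lt_min => /andP[hr' ht].
  rewrite leeBrDr//; apply: le_trans (total_bound ht).
  rewrite leeD2l// lee_fin.
  have h0 : 0 < n.+1%:R^-1 :> R by rewrite invr_gt0.
  have {}hr' : n.+1%:R^-1 < r := hr'.
  have Yi u v : itgbl u v Y by exact: itgbl_cont.
  apply: (@le_trans _ _ (n.+1%:R * itg (t1 - n.+1%:R^-1) t1 (fun=> eta))).
    rewrite itg_cst; last by rewrite gerBl ltW.
    rewrite (_ : t1 - (t1 - _) = n.+1%:R^-1); last by ring.
    have n0 : n.+1%:R != 0 :> R by rewrite pnatr_eq0.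
    by rewrite mulrCA (mulfV n0) mulr1.
  rewrite ler_wpM2l//; apply: itg_le => //; first exact: itgbl_cst.
  move=> t /andP[th tt1].
  have hb : ball t1 r t.
    rewrite /ball/= ltr_norml; move: hr' th h0.
    by set h := n.+1%:R^-1 => hr' th h0; apply/andP; split; lra.
  by have := hr t hb; rewrite /= ler_norml => /andP[_]; rewrite /eta; lra.
move=> /(_ bnd) => h.
have := le_trans fat h.
rewrite leeBrDr// -[X in (_ <= X)%E -> _]adde0 leeD2lE// lee_fin.
by rewrite leNgt eta0.
Qed.

Lemma comparison_with_bound x : a <= x <= b -> D x t1 <= 0.
Proof.
move=> /andP[]; rewrite le_eqVlt => /predU1P[<- _|ax].
  by apply: Da; rewrite lexx ltW.
rewrite le_eqVlt => /predU1P[->|xb].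
  by apply: Db; rewrite lexx ltW.
rewrite leNgt; apply/negP => Dx; apply: Y_pos_absurd.
apply: (itg_gt0 (x := x)) => //.
- exact: (cont2_x (t := t1) cPD).
- by move=> y; exact: cube_pos_ge0.
- by rewrite /cube_pos pos_gt0E ?ltW// divr_gt0// exprn_gt0.
Qed.

End with_bound.

(* D is the difference of two solutions, d its space derivative and j the
   difference of their fluxes. D has no time derivative: [slice_energy] bounds
   the increment of the integral of D_+^3 / 3 over a window of length 1 / n by
   the Steklov average of 2 D_+ d j, which is nonnegative in the limit. *)
Theorem comparison_abstract x : a <= x <= b -> D x t1 <= 0.
Proof.
have [M [M0 hM]] := cont2_bound a b t0 t1 cD.
apply: (@comparison_with_bound (2 * M)); first by rewrite mulr_gt0.
move=> y t yab tt; rewrite ler_wpM2l// /pos ge_max (ltW M0) andbT.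
by rewrite (le_trans (ler_norm _))// hM.
Qed.

End Comparison.

(** * Test functions *)

Section Derivatives.
Context {R : realType}.
Implicit Types (f g : R -> R) (x k m : R).

Lemma is_derive1M f g x (df dg : R) : is_derive x 1 f df -> is_derive x 1 g dg ->
  is_derive x 1 (fun y => f y * g y) (df * g x + f x * dg).
Proof.
move=> hf hg; have h := is_deriveM hf hg; apply: is_derive_eq h _.
by rewrite /GRing.scale/= addrC mulrC.
Qed.

Lemma is_derive1D f g x (df dg : R) : is_derive x 1 f df -> is_derive x 1 g dg ->
  is_derive x 1 (fun y => f y + g y) (df + dg).
Proof. by move=> hf hg; have h := is_deriveD hf hg; apply: is_derive_eq h _. Qed.

Lemma is_derive1Z f k x (df : R) : is_derive x 1 f df ->
  is_derive x 1 (fun y => k * f y) (k * df).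
Proof.
move=> hf; have h := is_derive1M (is_derive_cst k x 1) hf.
by apply: is_derive_eq h _; rewrite mul0r add0r.
Qed.

Lemma is_derive1B f g x (df dg : R) : is_derive x 1 f df -> is_derive x 1 g dg ->
  is_derive x 1 (fun y => f y - g y) (df - dg).
Proof. by move=> hf hg; have h := is_deriveB hf hg; apply: is_derive_eq h _. Qed.

Lemma is_derive1_affine f k m x (df : R) : is_derive (k * x + m) 1 f df ->
  is_derive x 1 (fun y => f (k * y + m)) (k * df).
Proof.
move=> hf.
have hg : is_derive x 1 (fun y : R => k * y + m) k.
  have h := is_derive1D (is_derive1Z k (is_derive_id x 1)) (is_derive_cst m x 1).
  by apply: is_derive_eq h _; rewrite mulr1 addr0.
have h := @is_derive1_comp R f (fun y => k * y + m) x df k hf hg.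
by apply: is_derive_eq h _; rewrite mulrC.
Qed.

Lemma is_derive1_continuous f x (df : R) : is_derive x 1 f df -> {for x, continuous f}.
Proof. by move=> [hf _]; apply: differentiable_continuous; apply/derivable1_diffP. Qed.

Lemma itg_FTC a b f g : a <= b -> (forall x, is_derive x 1 f (g x)) -> continuous g ->
  itg a b g = f b - f a.
Proof.
rewrite le_eqVlt => /predU1P[<-|ab] fg cg; first by rewrite itg1 subrr.
have cf : continuous f by move=> x; exact: is_derive1_continuous (fg x).
rewrite /itg /Rintegral (@continuous_FTC2 _ _ f)//.
- exact: continuous_subspaceT.
- split.
  + by move=> x _; case: (fg x).
  + by apply: cvg_at_right_filter; exact: cf.
  + by apply: cvg_at_left_filter; exact: cf.
- by move=> x _; rewrite derive1E; case: (fg x).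
Qed.

(** The index is off by one: [Ck n] gives n + 1 successive derivatives, the last of them with no
    continuity claimed. *)
Fixpoint Ck n f : Prop := exists f', (forall x, is_derive x 1 f (f' x)) /\
  match n with 0%N => True | m.+1 => Ck m f' end.

Lemma CkW n f : Ck n.+1 f -> Ck n f.
Proof.
elim: n f => [|n IH] f [f' [hf]]; first by exists f'.
by move=> /IH h; exists f'.
Qed.

Lemma CkD n f g : Ck n f -> Ck n g -> Ck n (fun x => f x + g x).
Proof.
elim: n f g => [|n IH] f g [f' [hf cf]] [g' [hg cg]]; exists (fun x => f' x + g' x);
  split => //; do ?[by move=> x; exact: is_derive1D]; exact: IH.
Qed.

Lemma CkM n f g : Ck n f -> Ck n g -> Ck n (fun x => f x * g x).
Proof.
elim: n f g => [|n IH] f g.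
  move=> [f' [hf _]] [g' [hg _]]; exists (fun x => f' x * g x + f x * g' x).
  by split => // x; exact: is_derive1M.
move=> cf cg; have cf1 := CkW cf; have cg1 := CkW cg.
case: cf => f' [hf cf]; case: cg => g' [hg cg].
exists (fun x => f' x * g x + f x * g' x); split; first by move=> x; exact: is_derive1M.
by apply: CkD; exact: IH.
Qed.

Lemma CkZ n f k : Ck n f -> Ck n (fun x => k * f x).
Proof.
elim: n f => [|n IH] f [f' [hf cf]]; exists (fun x => k * f' x);
  split => //; do ?[by move=> x; exact: is_derive1Z]; exact: IH.
Qed.

Lemma Ck_affine n f k m : Ck n f -> Ck n (fun x => f (k * x + m)).
Proof.
elim: n f => [|n IH] f [f' [hf cf]]; exists (fun x => k * f' (k * x + m)).
  by split => // x; exact: is_derive1_affine.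
by split; [move=> x; exact: is_derive1_affine|apply: CkZ; exact: IH].
Qed.

Lemma Ck_derive1n f : (forall n, Ck n f) -> forall n x, derivable (derive1n n f) x 1.
Proof.
move=> h n; move: {h}(h n); elim: n f => [|n IH] f [f' [hf cf]] x; first by case: (hf x).
rewrite derive1Sn; suff -> : derive1 f = f' by exact: IH.
by apply/funext => y; rewrite derive1E; case: (hf y).
Qed.

(** The polynomial parameter makes the family stable under differentiation, so that smoothness of
    exp(-1/x) extended by 0 is an induction over all P at once. *)
Definition flat (P : {poly R}) (x : R) : R :=
  if 0 < x then P.[x^-1] * expR (- x^-1) else 0.

Lemma poly_expR_bound (P : {poly R}) : exists C, forall y, 0 <= y -> `|P.[y]| <= C * expR y.
Proof.
exists (\sum_(i < size P) `|P`_i| * i`!%:R) => y y0.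
rewrite horner_coef (le_trans (ler_norm_sum _ _ _))// mulr_suml.
apply: ler_sum => i _; rewrite normrM -mulrA ler_wpM2l//.
rewrite ger0_norm ?exprn_ge0//.
have f0 : 0 < i`!%:R :> R by rewrite ltr0n fact_gt0.
rewrite mulrC -ler_pdivrMr//.
case: (nat_of_ord i) f0 => [|k] f0.
  by rewrite expr0 fact0 divr1; have := expR_ge1Dx y; lra.
by apply: le_trans (expR_ge1Dxn k y0); lra.
Qed.

Lemma is_derive_flat P x : is_derive x 1 (flat P) (flat ('X^2 * (P - P^`())) x).
Proof.
have [x0|x0|<-] := ltgtP 0 x.
- apply: (@near_eq_is_derive R R R (fun y : R => P.[y^-1] * expR (- y^-1))).
    near=> y; rewrite /flat ifT//; near: y; exact: lt_nbhsr.
  have hinv : is_derive x 1 (fun y : R => y^-1) (- x ^- 2).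
    have h := @is_deriveV R id x 1 1 (lt0r_neq0 x0) (is_derive_id x 1).
    by apply: is_derive_eq h _; rewrite /GRing.scale/= mulr1.
  have hP : is_derive (x^-1) 1 (horner P) (P^`()).[x^-1].
    by apply: DeriveDef; [exact: derivable_horner|rewrite -derive1E -derivE].
  have h1 := @is_derive1_comp R (horner P) (fun y => y^-1) x _ _ hP hinv.
  have hN : is_derive x 1 (fun y : R => - y^-1) (x ^- 2).
    have h := is_derive1Z (-1) hinv.
    rewrite (_ : (fun y : R => - y^-1) = (fun y => -1 * y^-1)); last by apply/funext => y; rewrite mulN1r.
    by apply: is_derive_eq h _; rewrite mulN1r opprK.
  have h2 := @is_derive1_comp R expR (fun y => - y^-1) x _ _ (is_derive_expR _) hN.
  apply: is_derive_eq (is_derive1M h1 h2) _.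
  rewrite /flat x0 hornerM hornerXn hornerD hornerN /= exprVn; ring.
- apply: (@near_eq_is_derive R R R (fun y : R => 0)).
    near=> y; rewrite /flat ifF//; apply/negbTE; rewrite -leNgt ltW//; near: y; exact: lt_nbhsl.
  by rewrite /flat ltNge (ltW x0)/=; exact: is_derive_cst.
(* The bound is taken for y^2 P(y) with y = 1/h: one factor y pays for the difference quotient, the
   other leaves a factor h that tends to 0. *)
- have [C hC] := poly_expR_bound ('X^2 * P).
  have C0 : 0 <= C by have := hC 0 (lexx _); rewrite expR0 mulr1; exact: le_trans.
  have lim : h^-1 * (flat P h) @[h --> 0^'] --> (0 : R).
    apply/cvgrPdist_le => e e0; near=> h; rewrite sub0r normrN.
    have hn : h != 0 by near: h; exact: nbhs_dnbhs_neq.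
    rewrite /flat; case: ifPn => h0; last by rewrite mulr0 normr0 ltW.
    have := hC h^-1; rewrite invr_ge0 (ltW h0) hornerM hornerXn => /(_ isT).
    rewrite normrM (ger0_norm (exprn_ge0 _ _)) ?invr_ge0 ?(ltW h0)// => hb.
    have hi : 0 <= h^-1 by rewrite invr_ge0 ltW.
    rewrite !normrM (ger0_norm hi) (ger0_norm (expR_ge0 _)).
    have -> : h^-1 * (`|P.[h^-1]| * expR (- h^-1)) = h * (h^-1 ^+ 2 * `|P.[h^-1]| * expR (- h^-1)).
      by field.
    apply: (@le_trans _ _ (h * C)).
      rewrite ler_wpM2l ?(ltW h0)//; apply: le_trans (ler_wpM2r (expR_ge0 _) hb) _.
      by rewrite -mulrA expRxMexpNx_1 mulr1.
    have hs : h <= e / (C + 1).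
      apply: le_trans (ler_norm h) _; near: h; apply: dnbhs0_le; apply: divr_gt0 => //; lra.
    apply: (@le_trans _ _ (h * (C + 1))); first by rewrite ler_wpM2l ?(ltW h0)//; lra.
    by rewrite -ler_pdivlMr//; lra.
  have flat0 Q : flat Q 0 = 0 by rewrite /flat ltxx.
  apply: DeriveDef.
    rewrite /derivable; apply/cvg_ex; exists 0.
    apply: cvg_trans lim; apply: near_eq_cvg; apply: nearW => h /=.
    by rewrite addr0 [_ *: 1]mulr1 flat0 subr0.
  rewrite /derive !flat0; apply/cvg_lim => //.
  apply: cvg_trans lim; apply: near_eq_cvg; apply: nearW => h /=.
  by rewrite addr0 [_ *: 1]mulr1 subr0.
Unshelve. all: by end_near. Qed.

Lemma Ck_flat P n : Ck n (flat P).
Proof.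
elim: n P => [|n IH] P; exists (flat ('X^2 * (P - P^`()))); split => // x;
  exact: is_derive_flat.
Qed.

End Derivatives.

(** * Bumps, plateaus and approximation at Lebesgue points *)

Section Bump.
Context {R : realType}.
Notation mu := (@lebesgue_measure R).
Implicit Types (x y e s : R).

Definition bumpR x : R := flat 1 x * flat 1 (-1 * x + 1).

Lemma flat1_ge0 x : 0 <= flat 1 x.
Proof. by rewrite /flat; case: ifP => // _; rewrite hornerC mul1r expR_ge0. Qed.

Lemma flat1_le1 x : flat 1 x <= 1.
Proof.
rewrite /flat; case: ifP => // x0; rewrite hornerC mul1r -expR0 ler_expR.
by rewrite oppr_le0 invr_ge0 ltW.
Qed.

Lemma Ck_bump n : Ck n bumpR.
Proof. by apply: CkM; [exact: Ck_flat|apply: Ck_affine; exact: Ck_flat]. Qed.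

Lemma bump_continuous : continuous bumpR.
Proof.
by move=> x; have [f' [hf _]] := Ck_bump 0; exact: is_derive1_continuous (hf x).
Qed.

Lemma bump_ge0 x : 0 <= bumpR x.
Proof. by rewrite mulr_ge0 ?flat1_ge0. Qed.

Lemma bump_le1 x : bumpR x <= 1.
Proof. by rewrite mulr_ile1 ?flat1_ge0 ?flat1_le1. Qed.

Lemma bump_le0E x : x <= 0 -> bumpR x = 0.
Proof. by move=> x0; rewrite /bumpR /flat ltNge x0 mul0r. Qed.

Lemma bump_ge1E x : 1 <= x -> bumpR x = 0.
Proof.
move=> x1; rewrite /bumpR [X in _ * X]/flat ifF ?mulr0//.
by apply/negbTE; rewrite -leNgt; lra.
Qed.

Lemma bump_half_gt0 : 0 < bumpR (1 / 2).
Proof. by rewrite /bumpR /flat !ifT ?mulr_gt0 ?hornerC ?expR_gt0//; lra. Qed.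

Lemma bump_integrable : mu.-integrable setT (EFin \o bumpR).
Proof.
rewrite (_ : EFin \o bumpR = (EFin \o bumpR) \_ `[0, 1]).
  by rewrite -integrable_mkcond//; exact: (itgbl_cont 0 1 bump_continuous).
apply/funext => x; rewrite patchE mem_setE in_itv/=; case: ifPn => //.
rewrite negb_and -!ltNge => /orP[/ltW/bump_le0E|/ltW/bump_ge1E] /= -> //.
Qed.

(** A smooth step from 0 to the positive constant [step 1], left unnormalised; the constant cancels
    in the du Bois-Reymond lemma. *)
Definition step x : R := \int[mu]_(t in `]-oo, x]) bumpR t.

Lemma is_derive_step x : is_derive x 1 step (bumpR x).
Proof.
have xx : x < x + 1 by rewrite ltrDl.
have bi : mu.-integrable `]-oo, (x + 1)] (EFin \o bumpR) by apply: integrableS bump_integrable.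
have [|d1 <-] := @continuous_FTC1 R bumpR -oo%O x (x + 1) xx bi _ (@bump_continuous x).
  by rewrite ltNyr.
apply: DeriveDef; first exact: d1.
by rewrite derive1E.
Qed.

Lemma step_diff x y : x <= y -> step y - step x = itg x y bumpR.
Proof.
by move=> xy; rewrite (itg_FTC xy is_derive_step bump_continuous).
Qed.

Lemma step_le0E x : x <= 0 -> step x = 0.
Proof.
move=> x0; rewrite /step (@eq_Rintegral _ _ _ _ _ (fun=> 0)).
  by rewrite /Rintegral integral0.
move=> t; rewrite inE/= in_itv/= => tx; apply: bump_le0E; exact: le_trans x0.
Qed.

Lemma step_ge1E x : 1 <= x -> step x = step 1.
Proof.
move=> x1; apply/eqP; rewrite -subr_eq0 (step_diff x1).
rewrite (@eq_itg _ _ _ _ (fun=> 0)) ?itg_cst ?mul0r//.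
by move=> t /andP[t1 _]; exact: bump_ge1E.
Qed.

Lemma step1_gt0 : 0 < step 1.
Proof.
have -> : step 1 = itg 0 1 bumpR by rewrite -step_diff// [step 0]step_le0E ?subr0.
apply: (itg_gt0 (x := 1 / 2)); [exact: bump_continuous|exact: bump_ge0|lra|lra|].
exact: bump_half_gt0.
Qed.

(** A smooth approximation of [step 1] times the indicator of [x, y], with ramps on [x, x + e] and
    [y, y + e]. Its derivative is a difference of two approximate point masses, at x and at y. *)
Definition plateau e x y s : R :=
  step (e^-1 * s + - (e^-1 * x)) - step (e^-1 * s + - (e^-1 * y)).
Definition dplateau e x y s : R :=
  e^-1 * bumpR (e^-1 * s + - (e^-1 * x)) - e^-1 * bumpR (e^-1 * s + - (e^-1 * y)).

Lemma is_derive_plateau e x y s : is_derive s 1 (plateau e x y) (dplateau e x y s).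
Proof. by apply: is_derive1B; apply: is_derive1_affine; exact: is_derive_step. Qed.

Lemma Ck_step n : Ck n step.
Proof. by case: n => [|n]; exists bumpR; split => //; [exact: is_derive_step|exact: is_derive_step|exact: Ck_bump]. Qed.

Lemma Ck_plateau n e x y : Ck n (plateau e x y).
Proof.
rewrite (_ : plateau e x y = fun s => step (e^-1 * s + - (e^-1 * x)) + -1 * step (e^-1 * s + - (e^-1 * y))).
  by apply: CkD; [|apply: CkZ]; apply: Ck_affine; exact: Ck_step.
by apply/funext => s; rewrite mulN1r.
Qed.

Lemma scaled_le0 e x s : 0 < e -> s <= x -> e^-1 * s + - (e^-1 * x) <= 0.
Proof. by move=> e0 sx; rewrite -mulrBr mulr_ge0_le0 ?invr_ge0 ?subr_le0 ?(ltW e0). Qed.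

Lemma scaled_ge1 e x s : 0 < e -> x + e <= s -> 1 <= e^-1 * s + - (e^-1 * x).
Proof. by move=> e0 sx; rewrite -mulrBr mulrC ler_pdivlMr// mul1r; lra. Qed.

Lemma plateau_left e x y s : 0 < e -> x <= y -> s <= x -> plateau e x y s = 0.
Proof.
move=> e0 xy sx; rewrite /plateau !step_le0E ?subrr// scaled_le0//.
exact: le_trans xy.
Qed.

Lemma plateau_right e x y s : 0 < e -> x <= y -> y + e <= s -> plateau e x y s = 0.
Proof.
move=> e0 xy ys; rewrite /plateau !step_ge1E ?subrr// scaled_ge1//.
by rewrite (le_trans _ ys)// lerD2r.
Qed.

Lemma plateau_test e x y : 0 < e -> x <= y -> test_function (plateau e x y).
Proof.
move=> e0 xy; split; first by apply: Ck_derive1n => n; exact: Ck_plateau.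
exists (`|x| + `|y| + e) => s hs.
have [sx|xs] := leP s x; first exact: plateau_left.
apply: plateau_right => //.
have hx := ler_norm x; have hx' := ler_norm (- x); rewrite normrN in hx'.
have hy := ler_norm y; have hx0 := normr_ge0 x; have hy0 := normr_ge0 y.
have [s0|s0] := leP 0 s.
  by rewrite (ger0_norm s0) in hs; lra.
by rewrite (ltr0_norm s0) in hs; lra.
Qed.

(** The open ball of radius 2 e contains the closed interval [x, x + e] and has measure 4 e, the
    factor on the right. *)
Lemma ball_integral_le (P : R -> R) x e : 0 < e -> locally_integrable setT P ->
  (\int[mu]_(s in `[x, (x + e)%R]) `|(P s - P x)%R|%:E <= (4 * e)%:E * davg P x (2 * e)%R)%E.
Proof.
move=> e0 [mP _ _].
have e2 : 0 < 2 * e by rewrite mulr_gt0.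
rewrite /davg /iavg (lebesgue_measure_ball x (ltW e2)) inver gt_eqF ?mulrn_wgt0//.
rewrite muleA -EFinM (_ : 4 * e * (2 * e *+ 2)^-1 = 1); last first.
  by rewrite -mulr_natr; field; rewrite gt_eqF.
rewrite mul1e -[leRHS]/(\int[mu]_(s in ball x (2 * e)%R) `|(P s - P x)%R|%:E)%E.
apply: ge0_subset_integral => //=.
- exact: measurable_ball.
- apply/measurable_EFinP; apply: measurableT_comp => //; apply: measurable_funB => //.
  exact: measurable_funS mP.
- move=> s /=; rewrite in_itv/= => /andP[xs se]; rewrite /ball/= ltr_norml; lra.
Qed.

Lemma lebesgue_pt_bump (P : R -> R) x eta : locally_integrable setT P -> lebesgue_pt P x ->
  0 < eta -> \forall e \near 0^'+,
  `|itg x (x + e) (fun s => P s * (e^-1 * bumpR (e^-1 * s + - (e^-1 * x)))) - step 1 * P x| <= eta.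
Proof.
move=> lP hP eta0.
have e4 : 0 < eta / 4 by rewrite divr_gt0.
have near1 : \forall r \near 0^'+, (davg P x r <= (eta / 4)%:E)%E.
  move/fine_cvgP : hP => [fin /cvgrPdist_le /(_ _ e4)].
  move=> h; near=> r.
  have fr : davg P x r \is a fin_num by near: r.
  rewrite -(fineK fr) lee_fin.
  have : `|0 - fine (davg P x r)| <= eta / 4 by near: r.
  by rewrite sub0r normrN; apply: le_trans; exact: ler_norm.
have near2 : \forall e \near 0^'+, (davg P x (2 * e)%R <= (eta / 4)%:E)%E.
  move: near1 => [r /= r0 hr].
  exists (r / 2); first by rewrite /= divr_gt0.
  move=> e /=; rewrite sub0r normrN => he e0; apply: hr; rewrite /= ?mulr_gt0//.
  by rewrite sub0r normrN normrM ger0_norm// mulrC -ltr_pdivlMr.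
near=> e.
have e0 : 0 < e by near: e; exact: nbhs_right_gt.
have xe : x <= x + e by rewrite lerDl ltW.
pose k s := e^-1 * bumpR (e^-1 * s + - (e^-1 * x)).
have ck : continuous k.
  move=> s; apply: cvgM; first exact: cvg_cst.
  apply: (@continuous_comp _ _ _ (fun s => e^-1 * s + - (e^-1 * x)) bumpR); last exact: bump_continuous.
  by apply: cvgD; [exact: continuous_scale|exact: cvg_cst].
have kI : itg x (x + e) k = step 1.
  have dk s : is_derive s 1 (fun s => step (e^-1 * s + - (e^-1 * x))) (k s).
    by apply: is_derive1_affine; exact: is_derive_step.
  rewrite (itg_FTC xe dk ck) [X in _ - X]step_le0E ?subr0; last by rewrite subrr.
  by rewrite step_ge1E// scaled_ge1.
have Pi : itgbl x (x + e) P.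
  case: lP => mP _ lP; apply/integrableP; split.
    by apply/measurable_EFinP; exact: measurable_funS mP.
  by apply: lP => //; exact: segment_compact.
have mk : measurable_fun `[x, x + e] k.
  by apply: measurable_funTS; exact: continuous_measurable_fun.
have kb s : `|k s| <= e^-1.
  rewrite normrM (ger0_norm (bump_ge0 _)) gtr0_norm ?invr_gt0//.
  by rewrite ler_piMr ?bump_le1// invr_ge0 ltW.
have Pk : itgbl x (x + e) (fun s => P s * k s).
  apply: (eq_itgbl (f := fun s => k s * P s)); first by move=> s _; rewrite mulrC.
  exact: (itgbl_mul Pi mk (M := e^-1)).
have Pxk : itgbl x (x + e) (fun s => P x * k s) by apply: itgblZ; exact: itgbl_cont.
have -> : step 1 * P x = itg x (x + e) (fun s => P x * k s).
  by rewrite itgZ ?kI 1?mulrC//; exact: itgbl_cont.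
rewrite -(itgB Pk Pxk) (le_trans (itg_norm (itgblB Pk Pxk)))//.
have Pd : itgbl x (x + e) (fun s => `|P s - P x|).
  by apply: itgbl_norm; apply: itgblB => //; exact: itgbl_cst.
apply: (@le_trans _ _ (itg x (x + e) (fun s => e^-1 * `|P s - P x|))).
  apply: itg_le => //; [exact/itgbl_norm/itgblB|exact: itgblZ|].
  by move=> s _; rewrite -mulrBl normrM mulrC ler_wpM2r.
rewrite itgZ// mulrC ler_pdivrMr//.
rewrite -lee_fin /itg /Rintegral fineK; last by apply: integrable_fin_num.
apply: (le_trans (ball_integral_le x e0 lP)).
rewrite (_ : eta * e = 4 * e * (eta / 4)); last by field.
rewrite [leRHS]EFinM; apply: lee_wpmul2l; first by rewrite lee_fin mulr_ge0// ltW.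
by near: e.
Unshelve. all: by end_near. Qed.

End Bump.

(** * The du Bois-Reymond lemma *)

Section DuBoisReymond.
Context {R : realType}.
Notation mu := (@lebesgue_measure R).
Implicit Types (x y e s : R) (f g : R -> R).

Lemma ae_dense (Q : R -> Prop) u v : {ae mu, forall x, Q x} -> u < v ->
  exists z, [/\ u < z, z < v & Q z].
Proof.
move=> [N [mN N0 QN]] uv; apply: contrapT => h.
have sub : `]u, v[ `<=` N.
  move=> z /=; rewrite in_itv/= => /andP[uz zv]; apply: QN => /= Qz.
  by apply: h; exists z.
have : (mu `]u, v[ <= mu N)%E by apply: le_measure; rewrite ?inE.
have E : mu `]u, v[%classic = (v - u)%:E by rewrite lebesgue_measure_itv/= lte_fin uv.
by rewrite E N0 lee_fin subr_le0 leNgt uv.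
Qed.

Lemma within_dist a b f x eta : {within `[a, b], continuous f} -> a <= x <= b -> 0 < eta ->
  exists2 r, 0 < r & forall z, a <= z <= b -> `|x - z| < r -> `|f x - f z| < eta.
Proof.
move=> /subspace_continuousP cf xab eta0.
have xin : `[a, b]%classic x by rewrite /= in_itv.
have /cvgrPdist_lt /(_ _ eta0) := cf x xin.
rewrite near_withinE => /nbhs_ballP[r /= r0 hr]; exists r => // z zab zr.
by apply: hr => //; rewrite /= in_itv.
Qed.

Lemma ae_eq_within a b f c : a < b -> {within `[a, b], continuous f} ->
  {ae mu, forall x, a <= x <= b -> f x = c} -> forall x, a <= x <= b -> f x = c.
Proof.
move=> ab cf fc x xab; apply/eqP; rewrite -subr_eq0 -normr_eq0; apply/negPn/negP => n0.
have eta0 : 0 < `|f x - c| by rewrite lt0r n0 normr_ge0.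
have [r r0 hr] := within_dist cf xab eta0.
have /andP[ax xb] := xab.
have uv : Num.max a (x - r) < Num.min b (x + r).
  by rewrite gt_max !lt_min ab /=; apply/andP; split; lra.
have [z [uz zv zc]] := ae_dense fc uv.
move: uz zv; rewrite gt_max lt_min => /andP[az xz] /andP[zb zx].
have zab : a <= z <= b by rewrite !ltW.
have zr : `|x - z| < r by rewrite ltr_norml; apply/andP; split; lra.
by have := hr z zab zr; rewrite (zc zab) ltxx.
Qed.

Lemma bump_scaled_continuous e x :
  continuous (fun s => e^-1 * bumpR (e^-1 * s + - (e^-1 * x)) : R).
Proof.
move=> s; apply: cvgM; first exact: cvg_cst.
apply: (@continuous_comp _ _ _ (fun s => e^-1 * s + - (e^-1 * x)) bumpR); last exact: bump_continuous.
by apply: cvgD; [exact: continuous_scale|exact: cvg_cst].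
Qed.

Lemma itgbl_bump A B f e x : itgbl A B f ->
  itgbl A B (fun s => f s * (e^-1 * bumpR (e^-1 * s + - (e^-1 * x)))).
Proof.
move=> fi; set k := fun s => e^-1 * bumpR (e^-1 * s + - (e^-1 * x)).
apply: (eq_itgbl (f := fun s => k s * f s)); first by move=> s _; rewrite mulrC.
apply: (itgbl_mul fi _ (M := `|e^-1|)).
  by apply: measurable_funTS; apply: continuous_measurable_fun; exact: bump_scaled_continuous.
by move=> s _; rewrite normrM (ger0_norm (bump_ge0 _)) ler_piMr// bump_le1.
Qed.

Lemma itg_bump_localize A B f e x : 0 < e -> A <= x -> x + e <= B -> itgbl A B f ->
  itg A B (fun s => f s * (e^-1 * bumpR (e^-1 * s + - (e^-1 * x)))) =
  itg x (x + e) (fun s => f s * (e^-1 * bumpR (e^-1 * s + - (e^-1 * x)))).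
Proof.
move=> e0 Ax xB fi.
have xxe : x <= x + e by rewrite lerDl ltW.
have fk := itgbl_bump e x fi.
rewrite (itg_split Ax (le_trans xxe xB) fk).
rewrite (itg_split xxe xB (itgblS Ax (lexx B) fk)).
rewrite (@eq_itg _ A x _ (fun=> 0)) ?itg_cst// ?mul0r; last first.
  by move=> s /andP[_ sx]; rewrite bump_le0E ?mulr0// scaled_le0.
rewrite (@eq_itg _ (x + e) B _ (fun=> 0)) ?itg_cst// ?mul0r ?addr0 ?add0r//.
by move=> s /andP[sx _]; rewrite bump_ge1E ?mulr0// scaled_ge1.
Qed.

Section du_bois_reymond.
Variables (f g : R -> R) (A B : R).
Hypothesis AB : A < B.
Hypotheses (fi : itgbl A B f) (gi : itgbl A B g).
(** Plateaus are the only test functions required: as e tends to 0 they compare the values at two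
    points, which is all the argument uses. *)
Hypothesis weak : forall x y e, 0 < e -> A <= x -> x <= y -> y + e <= B ->
  itg A B (fun s => f s * dplateau e x y s) = - itg A B (fun s => g s * plateau e x y s).

Let G s := itg A s g.
Let P := (fun s => f s - G s) \_ `[A, B].

Let Gi : itgbl A B G.
Proof. by apply: itgbl_within; apply: itg_cont_within => //; exact: ltW. Qed.

Let Pi : itgbl A B P.
Proof.
apply: (eq_itgbl (f := fun s => f s - G s)); last exact: itgblB.
by move=> s sAB; rewrite /P patchE mem_setE in_itv/= sAB.
Qed.

Let locP : locally_integrable setT P.
Proof. by apply: integrable_locally => //; exact: (itgblB fi Gi). Qed.

Let dplateau_int h e x y : itgbl A B h -> itgbl A B (fun s => h s * dplateau e x y s).
Proof.
move=> hi; have := itgblB (itgbl_bump e x hi) (itgbl_bump e y hi).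
by apply: eq_itgbl => s _; rewrite /dplateau mulrBr.
Qed.

(** The primitive G has weak derivative g by integration by parts, hence P = f - G has weak
    derivative 0. *)
Let P_weak x y e : 0 < e -> A <= x -> x <= y -> y + e <= B ->
  itg A B (fun s => P s * dplateau e x y s) = 0.
Proof.
move=> e0 Ax xy yB.
rewrite (@eq_itg _ _ _ _ (fun s => f s * dplateau e x y s - G s * dplateau e x y s)); last first.
  by move=> s sAB; rewrite /P patchE mem_setE in_itv/= sAB mulrBl.
rewrite itgB; [|exact: dplateau_int|exact: dplateau_int].
rewrite weak//.
have cd : continuous (dplateau e x y).
  by move=> s; apply: cvgB; exact: bump_scaled_continuous.
have FE s : A <= s <= B -> plateau e x y s - plateau e x y A = itg A s (dplateau e x y).
  by move=> /andP[As _]; rewrite (itg_FTC As (is_derive_plateau e x y) cd).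
have GE s : A <= s <= B -> G s - G A = itg A s g by move=> _; rewrite /G itg1 subr0.
have [_ _] := ac_parts (ltW AB) (itgbl_cont A B cd) gi FE GE.
rewrite (plateau_right e0 xy yB) (plateau_left e0 xy Ax) !mul0r subrr.
rewrite (@eq_itg _ A B (fun s => plateau e x y s * g s) (fun s => g s * plateau e x y s)); last first.
  by move=> s _; rewrite mulrC.
rewrite (@eq_itg _ A B (fun s => dplateau e x y s * G s) (fun s => G s * dplateau e x y s)); last first.
  by move=> s _; rewrite mulrC.
by lra.
Qed.

(** At Lebesgue points the two bumps in [dplateau] pick out [step 1 * P x] and [step 1 * P y] as e
    tends to 0. *)
Let P_const x y : A < x -> x <= y -> y < B -> lebesgue_pt P x -> lebesgue_pt P y -> P x = P y.
Proof.
move=> Ax xy yB Lx Ly.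
have s0 := @step1_gt0 R.
suff : step 1 * P x = step 1 * P y by move/(mulfI (lt0r_neq0 s0)).
apply/eqP; rewrite -subr_eq0 -normr_eq0 eq_le normr_ge0 andbT.
apply/ler_addgt0Pl => eta eta0; rewrite addr0.
have e2 : 0 < eta / 2 by rewrite divr_gt0.
near (0 : R)^'+ => e.
have e0 : 0 < e by near: e; exact: nbhs_right_gt.
have eB : e <= B - y by near: e; apply: nbhs_right_le; rewrite subr_gt0.
have yB' : y + e <= B by lra.
have xB' : x + e <= B by lra.
have hx : `|itg x (x + e) (fun s => P s * (e^-1 * bumpR (e^-1 * s + - (e^-1 * x)))) - step 1 * P x| <= eta / 2.
  by near: e; exact: (lebesgue_pt_bump locP Lx e2).
have hy : `|itg y (y + e) (fun s => P s * (e^-1 * bumpR (e^-1 * s + - (e^-1 * y)))) - step 1 * P y| <= eta / 2.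
  by near: e; exact: (lebesgue_pt_bump locP Ly e2).
have Ay : A <= y by rewrite ltW// (lt_le_trans Ax).
have := P_weak e0 (ltW Ax) xy yB'.
rewrite (@eq_itg _ _ _ _ (fun s => P s * (e^-1 * bumpR (e^-1 * s + - (e^-1 * x))) -
   P s * (e^-1 * bumpR (e^-1 * s + - (e^-1 * y))))); last first.
  by move=> s _; rewrite /dplateau mulrBr.
rewrite itgB; [|exact: itgbl_bump|exact: itgbl_bump].
rewrite (itg_bump_localize e0 (ltW Ax) xB' Pi) (itg_bump_localize e0 Ay yB' Pi).
move: hx hy; set Ix := itg x _ _; set Iy := itg y _ _ => hx hy /eqP; rewrite subr_eq0 => /eqP Ixy.
have -> : step 1 * P x - step 1 * P y = (Iy - step 1 * P y) - (Ix - step 1 * P x) by rewrite Ixy; ring.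
by apply: le_trans (ler_normB _ _) _; rewrite [leRHS](splitr eta); exact: lerD.
Unshelve. all: by end_near. Qed.

Lemma du_bois_reymond : exists c, {ae mu, forall x, A <= x <= B -> f x = c + itg A x g}.
Proof.
have LP := lebesgue_differentiation locP.
have [y0 [Ay0 y0B Ly0]] := ae_dense LP AB.
exists (P y0).
have n1 := @ae_neq_set1 _ A; have n2 := @ae_neq_set1 _ B.
move: n1 n2 LP; apply: filterS3; first exact: (ae_filter_ringOfSetsType mu).
move=> x /eqP xA /eqP xB Lx xAB.
have /andP[Ax' xB'] := xAB.
have Ax : A < x by rewrite lt_neqAle eq_sym xA.
have xB1 : x < B by rewrite lt_neqAle xB.
have -> : P y0 = P x.
  by have [h|h] := leP x y0; [apply/esym|]; apply: P_const => //; exact: ltW.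
by rewrite /P patchE mem_setE in_itv/= xAB /G subrK.
Qed.

Lemma du_bois_reymond_continuous : {within `[A, B], continuous f} ->
  forall x, A <= x <= B -> f x - f A = itg A x g.
Proof.
move=> cf x xAB; have [c hc] := du_bois_reymond.
have cG : {within `[A, B], continuous G} by apply: itg_cont_within => //; exact: ltW.
have ch : {within `[A, B], continuous (fun x => f x - G x)}.
  by move=> z; apply: cvgB; [exact: cf|exact: cG].
have hE : {ae mu, forall x, A <= x <= B -> f x - G x = c}.
  move: hc; apply: filterS; first exact: (ae_filter_ringOfSetsType mu).
  by move=> z hz zAB; rewrite (hz zAB) /G addrK.
have h := ae_eq_within AB ch hE.
have hA : f A - G A = c by apply: h; rewrite lexx ltW.
by have := h x xAB; rewrite -hA /G itg1 subr0; lra.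
Qed.

End du_bois_reymond.
End DuBoisReymond.

(** * Joint measurability and Fubini's theorem on rectangles *)

Section Measurability.
Context {R : realType}.
Notation mu := (@lebesgue_measure R).
Notation mR := (measurableTypeR R).

(** The product sigma-algebra is generated by rectangles, so x is rounded down to a multiple of
    1/(n+1): preimages become countable unions of rectangles, and continuity gives the pointwise
    limit. *)
Lemma cont2_mfun2 (f : R -> R -> R) : cont2 f -> mfun2 f.
Proof.
move=> cf.
pose q n (x : R) : R := (Num.floor (n.+1%:R * x))%:~R / n.+1%:R.
have n0 n : 0 < n.+1%:R :> R by [].
have meas n : measurable_fun setT (fun z : mR * mR => f (q n z.1) z.2 : mR).
  move=> _ Y mY; rewrite setTI.
  rewrite (_ : _ @^-1` Y = \bigcup_(k in [set: int])
     (`[k%:~R / n.+1%:R, (k + 1)%:~R / n.+1%:R[%classic `*` (f (k%:~R / n.+1%:R) @^-1` Y))); last first.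
    apply/seteqP; split => [[x t] /= h|[x t] [k _ [/= + h]]].
      exists (Num.floor (n.+1%:R * x)) => //; split => //=.
      rewrite in_itv/= ler_pdivrMr// ltr_pdivlMr// ![x * _]mulrC.
      by rewrite floor_le floorD1_gt.
    rewrite in_itv/= ler_pdivrMr// ltr_pdivlMr// ![x * _]mulrC => /floor_def fl.
    by rewrite /q fl.
  apply: countable_bigcupT_measurable => // k.
  apply: measurableX => //; rewrite -[X in measurable X]setTI.
  by apply: (continuous_measurable_fun (cont2_t (x := _) cf)).
apply: (measurable_fun_cvg meas) => -[x t] _ /=.
have qx : q n x @[n --> \oo] --> x.
  apply/cvgrPdist_le => e e0.
  have := @cvg_harmonic R; move=> /cvgrPdist_le /(_ _ e0).
  apply: filterS => n /=; rewrite sub0r normrN gtr0_norm ?invr_gt0// => hn.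
  have h1 : q n x <= x by rewrite /q ler_pdivrMr// mulrC floor_le.
  have h2 : x < q n x + n.+1%:R^-1.
    rewrite /q -[X in _ + X]mul1r -mulrDl ltr_pdivlMr// mulrC.
    by have := floorD1_gt (n.+1%:R * x); rewrite intrD.
  have aux (y a z r : R) : y <= a -> a < y + z -> z <= r -> `|a - y| <= r.
    by move=> *; rewrite ger0_norm; lra.
  exact: aux h1 h2 hn.
have cft : {for x, continuous (f ^~ t)} by exact: (cont2_x (t := t) cf).
exact: (cvg_comp _ _ qx cft).
Qed.

(** Inner integrals in Fubini's theorem are finite only almost everywhere; [fine] sets the
    exceptional values to 0 without changing the outer integral. *)
Lemma integral_fine (H : R -> \bar R) : mu.-integrable setT H ->
  mu.-integrable setT (fun x => (fine (H x))%:E) /\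
  (\int[mu]_x (fine (H x))%:E = \int[mu]_x H x)%E.
Proof.
move=> iH; have mH : measurable_fun setT H by case/integrableP : iH.
have mfH : measurable_fun setT (fun x => (fine (H x))%:E).
  by apply/measurable_EFinP; apply: measurableT_comp.
split.
  apply: le_integrable iH => //.
  by move=> x _; case: (H x) => [r||]//=; rewrite ?leey// normr0.
apply: ae_eq_integral => //.
have := integrable_ae measurableT iH; apply: filterS.
by move=> x Hx _; rewrite fineK// Hx.
Qed.

Lemma cutoff_fubini lo hi s t (h : R -> R -> R) : mfun2 h ->
  (\int[mu]_x \int[mu]_r `|cutoff lo hi s t h x r|%:E < +oo)%E ->
  itgbl lo hi (fun x => itg s t (h x)) /\
  itg s t (fun r => itg lo hi (h ^~ r)) = itg lo hi (fun x => itg s t (h x)).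
Proof.
move=> mh hoo; pose c := cutoff lo hi s t h.
pose f (z : mR * mR) := (c z.1 z.2)%:E.
have mc : mfun2 c by exact: mfun2_cutoff.
have mf : measurable_fun setT f by exact/measurable_EFinP.
have imf : (mu \x mu)%E.-integrable setT f by apply/integrable12ltyP.
pose F x := (\int[mu]_r f (x, r))%E.
pose G r := (\int[mu]_x f (x, r))%E.
have iF : mu.-integrable setT F by exact: (integrable_fubini_F imf).
have iG : mu.-integrable setT G.
  apply/integrableP; split; first exact: (measurable_fubini_G imf).
  apply: (@le_lt_trans _ _ (\int[mu]_r \int[mu]_x `|f (x, r)|)%E); last exact: ((integrable21ltyP mu mu mf).1 imf).
  apply: ge0_le_integral => //.
  - by apply: measurableT_comp => //; exact: (measurable_fubini_G imf).
  - have maf : measurable_fun setT (fun z : mR * mR => `|f z|%E) by exact: measurableT_comp mf.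
    have meas := measurable_fun_fubini_tonelli_G (m1 := mu) (fun z : mR * mR => `|f z|%E) maf.
    by apply: meas => z; exact: abse_ge0.
  - move=> r _; apply: le_abse_integral => //.
    by apply: (measurableT_comp mf); exact: pair2_measurable.
have FG : (\int[mu]_x F x = \int[mu]_r G r)%E.
  by rewrite (integral12_prod_meas1 imf) (integral21_prod_meas1 imf).
have [iF' FE] := integral_fine iF; have [iG' GE] := integral_fine iG.
have Fphi : (EFin \o (fun x => itg s t (h x))) \_ `[lo, hi] = (fun x => (fine (F x))%:E).
  apply/funext => x; rewrite patchE mem_setE in_itv/= /F /f /c /cutoff /=.
  case: ifP => xab; last by rewrite integral0.
  rewrite /itg /Rintegral integral_mkcond; congr (fine _)%:E.
  by apply: eq_integral => r _; rewrite patchE mem_setE in_itv/=; case: ifP.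
have Gphi : (EFin \o (fun r => itg lo hi (h ^~ r))) \_ `[s, t] = (fun r => (fine (G r))%:E).
  apply/funext => r; rewrite patchE mem_setE in_itv/= /G /f /c /cutoff /=.
  case: ifP => xab; last by under eq_integral do rewrite andbF; rewrite integral0.
  rewrite /itg /Rintegral integral_mkcond; congr (fine _)%:E.
  by apply: eq_integral => x _; rewrite patchE mem_setE in_itv/= andbT; case: ifP.
split; first by rewrite /itgbl integrable_mkcond// Fphi.
have itgE a b (g : R -> R) : itg a b g = fine (\int[mu]_x ((EFin \o g) \_ `[a, b]) x)%E.
  by rewrite /itg /Rintegral integral_mkcond.
by rewrite (itgE s t) (itgE lo hi) Gphi Fphi FE GE FG.
Qed.

End Measurability.

(** * Flows *)

Section Flux.
Context {R : realType}.
Notation mu := (@lebesgue_measure R).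
Notation mR := (measurableTypeR R).
Variable p : R.
Hypothesis p2 : 2 < p.

Definition Fp (s : R) : R := `|s| `^ (p - 2) * s.

Lemma FpN s : Fp (- s) = - Fp s.
Proof. by rewrite /Fp normrN mulrN. Qed.

Lemma normFp s : `|Fp s| = `|s| `^ (p - 1).
Proof.
have hp := p2.
rewrite /Fp normrM (ger0_norm (powR_ge0 _ _)).
have p1 : 0 < p - 1 by lra.
have [->|s0] := eqVneq s 0; first by rewrite normr0 mulr0 powR0// lt0r_neq0.
rewrite -{2}[`|s|]powRr1// -powRD; first by congr powR; ring.
by rewrite normr_eq0 s0 implybT.
Qed.

Lemma Fp_ge0 s : 0 <= s -> Fp s = s `^ (p - 1).
Proof. by move=> s0; rewrite -[RHS]ger0_norm ?powR_ge0// -{2}(ger0_norm s0) -normFp [RHS]normr_id ger0_norm// /Fp mulr_ge0// powR_ge0. Qed.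

Lemma Fp_le s r : s <= r -> Fp s <= Fp r.
Proof.
have hp := p2.
have mono x y : 0 <= x -> x <= y -> x `^ (p - 1) <= y `^ (p - 1).
  by move=> x0 xy; apply: ge0_ler_powR; rewrite ?nnegrE//; [lra|exact: le_trans xy].
have [s0|s0] := leP 0 s => sr.
  by rewrite !Fp_ge0//; [exact: mono|exact: le_trans sr].
have [r0|r0] := leP 0 r.
  have h : Fp s = - (- s) `^ (p - 1) by rewrite -[s in LHS]opprK FpN Fp_ge0//; lra.
  rewrite h (Fp_ge0 r0); have h1 := powR_ge0 (- s) (p - 1).
  by have h2 := powR_ge0 r (p - 1); lra.
rewrite -[s]opprK -[r]opprK FpN [leRHS]FpN lerN2.
by rewrite !Fp_ge0; [apply: mono|..]; lra.
Qed.

Lemma Fp_mono s r : 0 <= (s - r) * (Fp s - Fp r).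
Proof.
have [h|h] := leP s r.
  by rewrite mulr_le0// subr_le0//; exact: Fp_le.
by rewrite mulr_ge0// subr_ge0 ?(ltW h)//; apply: Fp_le; exact: ltW.
Qed.

Lemma measurable_Fp : measurable_fun setT (Fp : mR -> mR).
Proof.
apply: measurable_funM => //.
by apply: (@measurableT_comp _ _ _ _ _ _ (fun x : R => x `^ (p - 2))).
Qed.

Lemma FpM k s : 0 <= k -> Fp (k * s) = k `^ (p - 1) * Fp s.
Proof.
have hp := p2.
move=> k0; rewrite {1}/Fp normrM (ger0_norm k0) powRM//.
have p1 : 0 < p - 1 by lra.
have [->|kn] := eqVneq k 0; first by rewrite !mul0r mulr0 powR0 ?mul0r// lt0r_neq0//.
have -> : k `^ (p - 1) = k `^ (p - 2) * k.
  by rewrite -{3}[k]powRr1// -powRD ?kn ?implybT//; congr powR; ring.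
by rewrite /Fp; ring.
Qed.

Lemma young m n : 0 <= m -> 0 <= n -> m * n `^ (p - 1) <= m `^ p + n `^ p.
Proof.
have hp := p2.
have e x : 0 <= x -> x `^ p = x * x `^ (p - 1).
  move=> x0; have p0 : 0 < p by lra.
  have [->|xn] := eqVneq x 0; first by rewrite powR0 ?mul0r// lt0r_neq0//.
  rewrite -{2}[x]powRr1// -powRD ?xn ?implybT//; congr powR; ring.
move=> m0 n0; have hm := powR_ge0 m p; have hn := powR_ge0 n p.
have [mn|nm] := leP m n.
  apply: (@le_trans _ _ (n `^ p)); last by lra.
  by rewrite (e n)// ler_wpM2r// powR_ge0.
apply: (@le_trans _ _ (m `^ p)); last by lra.
rewrite (e m)// ler_wpM2l//; apply: ge0_ler_powR; rewrite ?nnegrE ?(ltW nm)//; lra.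
Qed.

Lemma powR_pred_le m : 0 <= m -> m `^ (p - 1) <= m `^ p + 1.
Proof.
have hp := p2.
move=> m0; have [m1|m1] := leP m 1.
  apply: (@le_trans _ _ (1 `^ (p - 1))).
    by apply: ge0_ler_powR; rewrite ?nnegrE//; lra.
  by rewrite powR1 lerDr powR_ge0.
apply: (@le_trans _ _ (m `^ p)); last by rewrite lerDl.
by apply: ler_powR; [exact: ltW|lra].
Qed.

Lemma powR_add_le m n : 0 <= m -> 0 <= n -> (m + n) `^ p <= 2 `^ p * (m `^ p + n `^ p).
Proof.
have hp := p2.
move=> m0 n0; have hm := powR_ge0 m p; have hn := powR_ge0 n p.
have mono x y : 0 <= x -> x <= y -> x `^ p <= y `^ p.
  by move=> x0 xy; apply: ge0_ler_powR; rewrite ?nnegrE//; [lra|exact: le_trans xy].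
have [mn|nm] := leP m n.
  apply: (@le_trans _ _ ((2 * n) `^ p)); first by apply: mono; lra.
  by rewrite powRM// ler_wpM2l ?powR_ge0//; lra.
apply: (@le_trans _ _ ((2 * m) `^ p)); first by apply: mono; lra.
by rewrite powRM// ler_wpM2l ?powR_ge0//; lra.
Qed.

End Flux.

Section RectIntegrable.
Context {R : realType}.
Notation mu := (@lebesgue_measure R).
Notation mR := (measurableTypeR R).
Variables lo hi t0 t1 : R.
Implicit Types f g : R -> R -> R.

Definition rect_itgbl f : Prop := (mu \x mu)%E.-integrable setT
  (fun z : mR * mR => (cutoff lo hi t0 t1 f z.1 z.2)%:E).

Lemma rect_itgblP f : mfun2 f ->
  rect_itgbl f <-> (\int[mu]_x \int[mu]_t `|cutoff lo hi t0 t1 f x t|%:E < +oo)%E.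
Proof.
move=> mf; apply: integrable12ltyP; apply/measurable_EFinP; exact: mfun2_cutoff.
Qed.

Lemma rect_itgblP2 f : mfun2 f ->
  rect_itgbl f <-> (\int[mu]_t \int[mu]_x `|cutoff lo hi t0 t1 f x t|%:E < +oo)%E.
Proof.
move=> mf; apply: integrable21ltyP; apply/measurable_EFinP; exact: mfun2_cutoff.
Qed.

Lemma rect_itgblD f g : rect_itgbl f -> rect_itgbl g -> rect_itgbl (fun x t => f x t + g x t).
Proof.
move=> fi gi; have := integrableD measurableT fi gi; apply: eq_integrable => //.
by move=> z _; rewrite -EFinD /cutoff; case: ifP => // _; rewrite addr0.
Qed.

Lemma rect_itgblZ k f : rect_itgbl f -> rect_itgbl (fun x t => k * f x t).
Proof.
move=> fi; have := integrableZl measurableT k fi; apply: eq_integrable => //.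
by move=> z _; rewrite -EFinM /cutoff; case: ifP => // _; rewrite mulr0.
Qed.

Lemma le_rect_itgbl f g : mfun2 g -> rect_itgbl f ->
  (forall x t, lo <= x <= hi -> t0 <= t <= t1 -> `|g x t| <= f x t) -> rect_itgbl g.
Proof.
move=> mg fi gf; apply: le_integrable fi => //.
  apply/measurable_EFinP; exact: mfun2_cutoff.
move=> [x t] _; rewrite /= lee_fin /cutoff; case: ifP => [/andP[xl tt]|_]; last by rewrite normr0.
exact: le_trans (gf _ _ xl tt) (ler_norm _).
Qed.

Lemma integral_indic_lty a b : (\int[mu]_x (if a <= x <= b then 1 else 0)%:E < +oo)%E.
Proof.
case: (leP a b) => ab; last first.
  rewrite (_ : (fun _ => _) = cst 0%:E) ?integral0 ?ltry//.
  by apply/funext => x; case: ifP => // /andP[ax xb]; move: (le_trans ax xb); rewrite leNgt ab.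
have := itgbl_cst a b (1 : R); rewrite /itgbl integrable_mkcond// => /integrableP[_].
apply: le_lt_trans; rewrite le_eqVlt; apply/orP; left; apply/eqP.
by apply: eq_integral => x _; rewrite patchE mem_setE in_itv/=; case: ifP; rewrite ?abse0 ?abse1.
Qed.

Lemma rect_itgbl_cst k : rect_itgbl (fun _ _ => k).
Proof.
suff h : rect_itgbl (fun _ _ => 1).
  by have := rect_itgblZ k h; rewrite mulr1.
apply/rect_itgblP; first exact: measurable_cst.
have E x : (\int[mu]_t `|cutoff lo hi t0 t1 (fun _ _ => 1) x t|%:E =
   (if lo <= x <= hi then 1 else 0)%:E * \int[mu]_t (if t0 <= t <= t1 then 1 else 0)%:E)%E.
  rewrite /cutoff; case: (lo <= x <= hi) => /=; last by rewrite mul0e normr0 integral0.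
  by rewrite mul1e; apply: eq_integral => t _; case: ifP; rewrite ?normr1 ?normr0.
under eq_integral do rewrite E.
have [c0 coo] : (0 <= \int[mu]_t (if t0 <= t <= t1 then 1 else 0)%:E)%E /\
  (\int[mu]_t (if t0 <= t <= t1 then 1 else 0)%:E < +oo)%E.
  split; last exact: integral_indic_lty.
  by apply: integral_ge0 => t _; rewrite lee_fin; case: ifP.
have x0 : (0 <= \int[mu]_x (if lo <= x <= hi then 1 else 0)%:E)%E.
  by apply: integral_ge0 => x _; rewrite lee_fin; case: ifP.
have xoo := integral_indic_lty lo hi.
rewrite ge0_integralZr//; last first.
- by move=> x _; rewrite lee_fin; case: ifP.
- apply/measurable_EFinP; apply: measurable_fun_ifT => //.
  by apply: measurable_and; apply: measurable_fun_ler.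
- by apply: lte_mul_pinfty => //; rewrite ge0_fin_numE.
Qed.

Lemma rect_itgbl_t f : rect_itgbl f ->
  {ae mu, forall x, lo <= x <= hi -> itgbl t0 t1 (f x)}.
Proof.
move=> /ae_integrable1; apply: filterS => x /= h xl.
rewrite /itgbl integrable_mkcond//; apply: eq_integrable h => //.
by move=> t _; rewrite patchE mem_setE in_itv/= /cutoff xl/=; case: ifP.
Qed.

End RectIntegrable.

Section Flow.
Context {R : realType}.
Notation mu := (@lebesgue_measure R).
Notation mR := (measurableTypeR R).
Variables (p b : R).
Implicit Types (v d : R -> R -> R) (K : R -> R -> R -> R).

Definition wt (t : R) : R := expR (- (b * (p - 2) * t)).

Lemma wt_continuous : continuous wt.
Proof.
move=> t; apply: (@continuous_comp _ _ _ (fun t => - (b * (p - 2) * t)) expR); last exact: continuous_expR.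
by apply: cvgN; exact: continuous_scale.
Qed.

Lemma wt_gt0 t : 0 < wt t. Proof. exact: expR_gt0. Qed.

Lemma wt_bound t0 t1 : exists W : R, 0 < W /\ forall t, t0 <= t <= t1 -> wt t <= W.
Proof.
have [W [W0 hW]] := cont_bound t0 t1 wt_continuous.
by exists W; split => // t tt; exact: le_trans (ler_norm _) (hW t tt).
Qed.

Lemma measurable_wt : measurable_fun setT (wt : mR -> mR).
Proof. by apply: continuous_measurable_fun; exact: wt_continuous. Qed.

(* v_x = d and v_t = (wt * Fp d)_x in integrated form on [lo, hi] x [t0, t1],
   with [K s t] in the role of v(., t) - v(., s). A subflow (superflow) has
   v(., t) - v(., s) at most (at least) [K s t]. The weight comes from the
   substitution v = exp(b t) u, which removes the term b u. *)
Record flow (lo hi t0 t1 : R) v d K : Prop := Flow {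
  flow_cont : cont2 v;
  flow_meas : mfun2 d;
  flow_Lp : rect_itgbl lo hi t0 t1 (fun x t => `|d x t| `^ p);
  flow_ac : {ae mu, forall t, t0 < t < t1 -> itgbl lo hi (d ^~ t) /\
    forall x, lo <= x <= hi -> v x t - v lo t = itg lo x (d ^~ t)};
  flow_flux : forall s t, t0 <= s -> s < t -> t <= t1 -> itgbl lo hi (K s t) /\
    exists c, {ae mu, forall x, lo <= x <= hi ->
      itg s t (fun r => wt r * Fp p (d x r)) = c + itg lo x (K s t)} }.

Definition subflow lo hi t0 t1 v d := exists2 K, flow lo hi t0 t1 v d K &
  forall s t x, t0 <= s -> s < t -> t <= t1 -> lo <= x <= hi -> v x t - v x s <= K s t x.

Definition superflow lo hi t0 t1 v d := exists2 K, flow lo hi t0 t1 v d K &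
  forall s t x, t0 <= s -> s < t -> t <= t1 -> lo <= x <= hi -> K s t x <= v x t - v x s.

Hypothesis p2 : 2 < p.

Lemma mfun2_flux d : mfun2 d -> mfun2 (fun x t => wt t * Fp p (d x t)).
Proof.
move=> md; apply: measurable_funM.
  exact: (measurableT_comp measurable_wt).
exact: (measurableT_comp (measurable_Fp p)).
Qed.

Lemma rect_itgbl_flux lo hi t0 t1 d : mfun2 d ->
  rect_itgbl lo hi t0 t1 (fun x t => `|d x t| `^ p) ->
  rect_itgbl lo hi t0 t1 (fun x t => wt t * Fp p (d x t)).
Proof.
move=> md dp; have [W [W0 hW]] := wt_bound t0 t1.
apply: (le_rect_itgbl (mfun2_flux md) (rect_itgblZ W (rect_itgblD dp (rect_itgbl_cst _ _ _ _ 1)))).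
move=> x t _ tt; rewrite normrM (ger0_norm (ltW (wt_gt0 t))) normFp//.
by rewrite ler_pM ?(ltW (wt_gt0 t)) ?powR_ge0 ?hW ?powR_pred_le.
Qed.

(** The abstract principle applies to D = v1 - v2 - k, with d j >= 0 by monotonicity of F. The slack
    k allows for initial data that are ordered only approximately. *)
Lemma flow_comparison lo hi t0 t1 v1 d1 v2 d2 k : lo <= hi -> t0 < t1 ->
  subflow lo hi t0 t1 v1 d1 -> superflow lo hi t0 t1 v2 d2 ->
  (forall t, t0 <= t <= t1 -> v1 lo t <= v2 lo t + k) ->
  (forall t, t0 <= t <= t1 -> v1 hi t <= v2 hi t + k) ->
  (forall x, lo <= x <= hi -> v1 x t0 <= v2 x t0 + k) ->
  forall x, lo <= x <= hi -> v1 x t1 <= v2 x t1 + k.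
Proof.
move=> lh t01 [K1 F1 h1] [K2 F2 h2] blo bhi b0 x xlh.
have [W [W0 hW]] := wt_bound t0 t1.
(* With m = |d1| + |d2| one has |j| <= 2 W m^(p-1). Young's inequality turns the product with |d| <=
   m into 2 W times a sum of p-th powers of m, and m^p <= 2^p (|d1|^p + |d2|^p). The added constant
   2 W in N serves the bound on |j| alone, through m^(p-1) <= m^p + 1. *)
pose M := 2 * W * 2 `^ p.
have M0 : 0 <= M by rewrite mulr_ge0 ?powR_ge0// mulr_ge0// ltW.
pose N x t := M * (`|d1 x t| `^ p + `|d2 x t| `^ p) + 2 * W.
pose D x t := v1 x t - v2 x t - k.
pose d x t := d1 x t - d2 x t.
pose j x t := wt t * Fp p (d1 x t) - wt t * Fp p (d2 x t).
have [c1 m1 L1 ac1 fl1] := F1; have [c2 m2 L2 ac2 fl2] := F2.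
have cD : cont2 D by move=> z; apply: cvgB; [apply: cvgB; [exact: c1|exact: c2]|exact: cvg_cst].
have md : mfun2 d by exact: measurable_funB.
have mj : mfun2 j by apply: measurable_funB; exact: mfun2_flux.
have mN : mfun2 N.
  apply: measurable_funD => //; apply: measurable_funM => //.
  by apply: measurable_funD; apply: (@measurableT_comp _ _ _ _ _ _ (fun x : R => x `^ p)) => //;
    apply: measurableT_comp.
have N0 y t : 0 <= N y t.
  by rewrite addr_ge0 ?mulr_ge0 ?addr_ge0 ?powR_ge0//; exact: ltW.
have iN : rect_itgbl lo hi t0 t1 N.
  by apply: rect_itgblD (rect_itgbl_cst _ _ _ _ _); apply: rect_itgblZ; exact: rect_itgblD.
have Noo : (\int[mu]_x \int[mu]_t (cutoff lo hi t0 t1 N x t)%:E < +oo)%E.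
  have := (rect_itgblP lo hi t0 t1 mN).1 iN; apply: le_lt_trans; rewrite le_eqVlt.
  apply/orP; left; apply/eqP; apply: eq_integral => y _; apply: eq_integral => t _.
  by rewrite /cutoff; case: ifP; rewrite ?normr0// ger0_norm.
pose m y t := `|d1 y t| + `|d2 y t|.
have m0 y t : 0 <= m y t by rewrite addr_ge0.
have mp y t : m y t `^ p <= 2 `^ p * (`|d1 y t| `^ p + `|d2 y t| `^ p).
  exact: powR_add_le.
have jm y t : t0 <= t <= t1 -> `|j y t| <= 2 * W * m y t `^ (p - 1).
  move=> tt; rewrite /j; apply: le_trans (ler_normB _ _) _; rewrite !(normrM (wt t)) (ger0_norm (ltW (wt_gt0 t))) !normFp//.
  have mono x' y' : 0 <= x' -> x' <= y' -> x' `^ (p - 1) <= y' `^ (p - 1).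
    move=> x0 xy; have hp := p2.
    by apply: ge0_ler_powR; rewrite ?nnegrE//; [lra|exact: le_trans xy].
  have e1 : `|d1 y t| `^ (p - 1) <= m y t `^ (p - 1) by apply: mono => //; rewrite lerDl.
  have e2 : `|d2 y t| `^ (p - 1) <= m y t `^ (p - 1) by apply: mono => //; rewrite lerDr.
  rewrite -mulrDr -mulrA mulrCA ler_pM ?(ltW (wt_gt0 t)) ?addr_ge0 ?powR_ge0 ?hW//.
  by lra.
have WW : 0 <= 2 * W by rewrite mulr_ge0// ltW.
suff : D x t1 <= 0 by rewrite /D; lra.
refine (@comparison_abstract R lo hi t0 t1 D d j N lh t01 cD (cont2_mfun2 cD) md mj mN _ N0 Noo _ _ _ _ _ _ _ x xlh).
- move: ac1 ac2; apply: filterS2; first exact: (ae_filter_ringOfSetsType mu).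
  move=> t a1 a2 tt; have [i1 e1] := a1 tt; have [i2 e2] := a2 tt; split; first exact: itgblB.
  move=> y ylh; have /andP[_ yh] := ylh.
  rewrite (itgB (itgblS (lexx _) yh i1) (itgblS (lexx _) yh i2)) -e1// -e2// /D; ring.
- move=> y t s ylh tt ss; rewrite normrM.
  have dm : `|d y t| <= m y t by apply: ler_normB.
  apply: (@le_trans _ _ (m y t * (2 * W * m y s `^ (p - 1)))).
    by rewrite ler_pM// jm.
  apply: (@le_trans _ _ (2 * W * (m y t `^ p + m y s `^ p))).
    by rewrite mulrCA ler_wpM2l// young.
  apply: (@le_trans _ _ (2 * W * (2 `^ p * (`|d1 y t| `^ p + `|d2 y t| `^ p) + 2 `^ p * (`|d1 y s| `^ p + `|d2 y s| `^ p)))).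
    by rewrite ler_wpM2l// lerD.
  rewrite /N /M mulrDr !mulrA; lra.
- move=> y t ylh tt; apply: le_trans (jm y t tt) _.
  apply: (@le_trans _ _ (2 * W * (m y t `^ p + 1))).
    by rewrite ler_wpM2l// powR_pred_le.
  apply: (@le_trans _ _ (2 * W * (2 `^ p * (`|d1 y t| `^ p + `|d2 y t| `^ p) + 1))).
    by rewrite ler_wpM2l// lerD2r.
  by rewrite /N /M mulrDr !mulrA mulr1; lra.
- move=> y t _ _; rewrite /j -mulrBr mulrCA mulr_ge0 ?(ltW (wt_gt0 t))//.
  exact: Fp_mono.
- move=> s t t0s st tt1.
  have [iK1 [e1 a1]] := fl1 s t t0s st tt1; have [iK2 [e2 a2]] := fl2 s t t0s st tt1.
  exists (fun y => K1 s t y - K2 s t y), (e1 - e2); split.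
  + exact: itgblB.
  + move=> y ylh; have := h1 s t y t0s st tt1 ylh; have := h2 s t y t0s st tt1 ylh.
    by rewrite /D; lra.
  + have q1 := rect_itgbl_t (rect_itgbl_flux m1 L1); have q2 := rect_itgbl_t (rect_itgbl_flux m2 L2).
    have a12 : {ae mu, forall y, lo <= y <= hi ->
        itg s t (fun r => wt r * Fp p (d1 y r)) - itg s t (fun r => wt r * Fp p (d2 y r)) =
        e1 - e2 + (itg lo y (K1 s t) - itg lo y (K2 s t))}.
      move: a1 a2; apply: filterS2; first exact: (ae_filter_ringOfSetsType mu).
      by move=> y a1 a2 ylh; rewrite a1// a2//; ring.
    move: q1 q2 a12; apply: filterS3; first exact: (ae_filter_ringOfSetsType mu).
    move=> y q1 q2 a12 ylh; have /andP[_ yh] := ylh.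
    rewrite (itgB (itgblS t0s tt1 (q1 ylh)) (itgblS t0s tt1 (q2 ylh))) a12//.
    by rewrite (itgB (itgblS (lexx _) yh iK1) (itgblS (lexx _) yh iK2)).
- by move=> t tt; have := blo t tt; rewrite /D; lra.
- by move=> t tt; have := bhi t tt; rewrite /D; lra.
- by move=> y ylh; have := b0 y ylh; rewrite /D; lra.
Qed.

(** Both v_x and the flux change sign under reflection, so the divergence of the flux, and with it
    K, does not. *)
Lemma flow_reflect c lo hi t0 t1 v d K : lo <= hi -> flow lo hi t0 t1 v d K ->
  flow (c - hi) (c - lo) t0 t1 (fun x t => v (c - x) t) (fun x t => - d (c - x) t)
    (fun s t x => K s t (c - x)).
Proof.
move=> lh [cv md Ld ac fl].
have mr : measurable_fun setT (fun z : mR * mR => (c - z.1, z.2) : mR * mR).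
  by apply/measurable_fun_pairP; split; [exact: measurable_funB|exact: measurable_snd].
have md' : mfun2 (fun x t => d (c - x) t) := measurableT_comp md mr.
have mN' : mfun2 (fun x t => - d (c - x) t) by exact: measurableT_comp.
have inlh x : c - hi <= x <= c - lo -> lo <= c - x <= hi by lra.
have refl y z (f : R -> R) : lo <= y -> z <= hi -> itgbl lo hi f ->
    itgbl (c - z) (c - y) (fun x => f (c - x)) /\
    itg (c - z) (c - y) (fun x => f (c - x)) = itg y z f.
  move=> ly zh fi; have fi' := itgblS ly zh fi.
  have e1 : c - (c - y) = y by ring.
  have e2 : c - (c - z) = z by ring.
  by split; [apply: itgbl_reflect; rewrite e1 e2|rewrite itg_reflect ?e1 ?e2].
split => //.
- exact: cont2_reflect.
- have mabs (f : R -> R -> R) : mfun2 f -> mfun2 (fun x t => `|f x t| `^ p).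
    move=> mf; apply: (@measurableT_comp _ _ _ _ _ _ (fun x : R => x `^ p)) => //.
    exact: measurableT_comp.
  apply/rect_itgblP; first exact: mabs.
  move/(rect_itgblP lo hi t0 t1 (mabs _ md)) : Ld; apply: le_lt_trans.
  pose G x := (\int[mu]_t `|cutoff lo hi t0 t1 (fun x t => `|d x t| `^ p) x t|%:E)%E.
  have mG : measurable_fun setT G.
    have mc : mfun2 (fun x t => `|cutoff lo hi t0 t1 (fun x t => `|d x t| `^ p) x t|).
      by apply: measurableT_comp => //; apply: mfun2_cutoff; exact: mabs.
    exact: (measurable_integral_t mc).
  have G0 x : (0 <= G x)%E by apply: integral_ge0 => t _; rewrite lee_fin.
  rewrite -[leRHS](ge0_integral_reflect c mG G0) le_eqVlt; apply/orP; left; apply/eqP.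
  apply: eq_integral => x _; apply: eq_integral => t _; rewrite /cutoff normrN.
  by rewrite (_ : (c - hi <= x <= c - lo) = (lo <= c - x <= hi))//; apply/idP/idP; lra.
- move: ac; apply: filterS; first exact: (ae_filter_ringOfSetsType mu).
  move=> t + tt => /(_ tt)[di dE].
  have [ri _] := refl lo hi _ (lexx _) (lexx _) di.
  split; first by have := itgblZ (-1) ri; apply: eq_itgbl => x _; rewrite mulN1r.
  move=> x xlh; have := inlh x xlh => /andP[l1 l2].
  have [ri' rE] := refl (c - x) hi _ l1 (lexx _) di.
  rewrite subKr in ri' rE.
  have -> : itg (c - hi) x (fun x => - d (c - x) t) = -1 * itg (c - hi) x (fun x => d (c - x) t).
    by rewrite -(itgZ (-1) ri'); apply: eq_itg => y _; rewrite mulN1r.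
  rewrite rE (_ : c - (c - hi) = hi); last by ring.
  by rewrite -(itg_prim_diff di dE l1 l2 (lexx _)); ring.
- move=> s t t0s st tt1; have [Ki [e aeK]] := fl s t t0s st tt1.
  split; first by have [] := refl lo hi _ (lexx _) (lexx _) Ki.
  (* The primitive of K is now based at the image of [hi], so the constant is minus the time
     integral of the flux at [hi]. *)
  exists (- (e + itg lo hi (K s t))).
  have q := rect_itgbl_t (rect_itgbl_flux md Ld).
  move: (ae_reflect c aeK) (ae_reflect c q); apply: filterS2.
    exact: (ae_filter_ringOfSetsType mu).
  move=> x a1 a2 xlh; have xl := inlh x xlh; have /andP[l1 l2] := xl.
  have ii := itgblS t0s tt1 (a2 xl).
  have -> : itg s t (fun r => wt r * Fp p (- d (c - x) r)) =
      -1 * itg s t (fun r => wt r * Fp p (d (c - x) r)).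
    by rewrite -(itgZ (-1) ii); apply: eq_itg => y _; rewrite FpN; ring.
  rewrite (a1 xl).
  have [ri' rE] := refl (c - x) hi _ l1 (lexx _) Ki.
  rewrite subKr in ri' rE.
  by rewrite rE (itg_split l1 l2 Ki); ring.
Qed.

End Flow.

(** * Weak solutions as flows *)

Section WeakFlow.
Context {R : realType}.
Notation mu := (@lebesgue_measure R).
Notation mR := (measurableTypeR R).

Lemma continuous_within_comp (S T U : topologicalType) (A : set T) (f : T -> U) (g : S -> T) :
  {within A, continuous f} -> continuous g -> (forall s, A (g s)) -> continuous (f \o g).
Proof.
move=> /subspace_continuousP cf cg gA s.
move=> B /(cf (g s) (gA s)) /=; rewrite /within/= => hB.
have h : \forall z \near s, A (g z) -> B (f (g z)) := cg s _ hB.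
suff : \forall z \near s, B (f (g z)) by [].
by apply: filterS h => z; apply.
Qed.

Lemma eq_itg_ae a b (f g : R -> R) : itgbl a b f -> itgbl a b g ->
  {ae mu, forall x, a <= x <= b -> f x = g x} -> itg a b f = itg a b g.
Proof.
move=> fi gi fg; rewrite /itg /Rintegral; congr fine.
apply: ae_eq_integral => //.
- by case/integrableP : fi.
- by case/integrableP : gi.
move: fg; apply: filterS; first exact: (ae_filter_ringOfSetsType mu).
move=> x h /=; rewrite in_itv/= => xab.
by rewrite h.
Qed.

Lemma integral_itg (a b : R) (f : R -> R) (D : set mR) :
  measurable D -> `[a, b]%classic `<=` D ->
  (forall x, D x -> ~ `[a, b]%classic x -> f x = 0) ->
  \int[mu]_(x in D) f x = itg a b f.
Proof.
move=> mD abD f0; rewrite /itg /Rintegral; congr fine.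
rewrite [LHS]integral_mkcond [RHS]integral_mkcond; apply: eq_integral => x _.
rewrite !patchE; case: ifPn => [|xD].
  rewrite inE => xD; case: ifPn => // nab; rewrite /= f0//.
  by move=> h; move: nab; rewrite notin_setE; apply.
case: ifPn => //; rewrite inE => /abD xD'.
by move: xD; rewrite notin_setE.
Qed.

Lemma dplateau_left (e x y s : R) : 0 < e -> x <= y -> s <= x -> dplateau e x y s = 0.
Proof.
move=> e0 xy sx; rewrite /dplateau !bump_le0E ?mulr0 ?subrr// scaled_le0//.
exact: le_trans xy.
Qed.

Lemma dplateau_right (e x y s : R) : 0 < e -> x <= y -> y + e <= s -> dplateau e x y s = 0.
Proof.
move=> e0 xy ys; rewrite /dplateau !bump_ge1E ?mulr0 ?subrr// scaled_ge1//.
by rewrite (le_trans _ ys)// lerD2r.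
Qed.

Lemma dplateau_continuous (e x y : R) : continuous (dplateau e x y).
Proof. by move=> s; apply: cvgB; exact: bump_scaled_continuous. Qed.

Lemma plateau_continuous (e x y : R) : continuous (plateau e x y).
Proof. by move=> s; exact: is_derive1_continuous (is_derive_plateau e x y s). Qed.

Lemma itgbl_mul_cont a b (f g : R -> R) : itgbl a b f -> continuous g ->
  itgbl a b (fun x => f x * g x).
Proof.
move=> fi cg.
have [M [M0 hM]] := cont_bound a b cg.
have h := @itgbl_mul R a b f g M fi.
apply: (eq_itgbl (f := fun x => g x * f x)); first by move=> x _; rewrite mulrC.
by apply: h hM; apply: measurable_funTS; apply: continuous_measurable_fun.
Qed.

Lemma rect_itgblS lo hi t0 t1 s t (f : R -> R -> R) : t0 <= s -> t <= t1 -> mfun2 f ->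
  rect_itgbl lo hi t0 t1 f -> rect_itgbl lo hi s t f.
Proof.
move=> t0s tt1 mf fi; apply: le_integrable fi => //.
  by apply/measurable_EFinP; exact: mfun2_cutoff.
move=> [x r] _ /=; rewrite lee_fin /cutoff; case: ifP => [/andP[xlh /andP[sr rt]]|_]; last by rewrite normr0.
by rewrite xlh (le_trans t0s sr) (le_trans rt tt1).
Qed.

Lemma rect_itgbl_mul_cont lo hi t0 t1 (f : R -> R -> R) (g : R -> R) : mfun2 f ->
  rect_itgbl lo hi t0 t1 f -> continuous g -> rect_itgbl lo hi t0 t1 (fun x t => f x t * g x).
Proof.
move=> mf fi cg.
have [M [M0 hM]] := cont_bound lo hi cg.
apply: le_integrable (rect_itgblZ M fi) => //.
  apply/measurable_EFinP; apply: mfun2_cutoff; apply: measurable_funM => //.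
  by apply: (@cont2_mfun2 R (fun x _ => g x)); exact: cont2_of_x.
move=> [x r] _ /=; rewrite lee_fin /cutoff; case: ifP => [/andP[xlh _]|_]; last by rewrite normr0.
by rewrite !normrM mulrC ler_pM// (le_trans (hM x xlh))// ler_norm.
Qed.

(* exp(b t) u, frozen outside [0, t1] so as to be continuous on the whole plane *)
Definition clamp (t1 t : R) : R := Num.max 0 (Num.min t t1).

Lemma clamp_id t1 t : 0 <= t <= t1 -> clamp t1 t = t.
Proof. by case/andP => t0 tt; rewrite /clamp min_l// max_r. Qed.

Definition reduced b t1 (u : R -> R -> R) x t : R := expR (b * clamp t1 t) * u x (clamp t1 t).

Lemma reduced_id b t1 u x t : 0 <= t <= t1 -> reduced b t1 u x t = expR (b * t) * u x t.
Proof. by move=> tt; rewrite /reduced clamp_id. Qed.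

Variables (p b : R) (T : \bar R) (u0 : R -> R) (u : R -> R -> R).
Hypothesis p2 : 2 < p.
Hypothesis hu : cauchy_solution p b 1 T u0 u.

Lemma reduced_cont2 t1 : 0 < t1 -> (t1%:E < T)%E -> cont2 (reduced b t1 u).
Proof.
move=> t10 t1T; have [_ cu _] := hu.
have cc : continuous (fun t => Num.max 0 (Num.min t t1)).
  move=> t; apply: (@continuous_max R R (fun=> 0) (fun t => Num.min t t1) t); first exact: cvg_cst.
  by apply: (@continuous_min R R id (fun=> t1) t); [exact: cvg_id|exact: cvg_cst].
move=> z; apply: cvgM.
  apply: (@cont2_of_t _ (fun t => expR (b * clamp t1 t))) => t.
  apply: (@continuous_comp _ _ _ (fun t => b * clamp t1 t) expR); last exact: continuous_expR.
  by apply: cvgM; [exact: cvg_cst|exact: cc].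
apply: (@continuous_within_comp _ _ _ _ (fun z => u z.1 z.2) (fun z : R * R => (z.1, clamp t1 z.2)) cu).
  move=> y; apply: (@cvg_pair _ _ _ _ (nbhs y.1) (nbhs (clamp t1 y.2))); first exact: cvg_fst.
  exact: (cont2_of_t cc).
move=> y /=; rewrite /clamp le_max lexx; split => //.
by apply: le_lt_trans t1T; rewrite lee_fin ge_max (ltW t10) ge_min lexx orbT.
Qed.

Section rectangle.
Variables lo hi t0 t1 : R.
Hypotheses (lohi : lo < hi) (t0_gt0 : 0 < t0) (t01 : t0 < t1) (t1T : (t1%:E < T)%E).
Variable ux : R -> R -> R.
Hypothesis W1p : Lp_loc_W1p_loc p T u ux.
Hypothesis ident : integral_identity p b 1 T u ux.

Let v := reduced b t1 u.
Let band : set (mR * mR) := [set z | t0 <= z.2 <= t1].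
(** Set to 0 off [t0, t1], since [ux] is measurable only on the strip while a flow asks for
    measurability on the whole plane. *)
Let d (x t : R) : R := if t0 <= t <= t1 then expR (b * t) * ux x t else 0.
Let j x t := wt p b t * Fp p (d x t).

Let mband : measurable band.
Proof.
rewrite (_ : band = setT `*` `[t0, t1]%classic).
  by apply: measurableX.
by apply/seteqP; split => -[x t] /=; rewrite in_itv/=; [split|case].
Qed.

Let mfun2_restrict (f : R -> R -> R) : measurable_strip T f ->
  mfun2 (fun x t => if t0 <= t <= t1 then f x t else 0).
Proof.
move=> mf.
have mf' : measurable_fun band (fun z => f z.1 z.2 : mR).
  apply: measurable_funS mf; last first.
    move=> [x t] /= /andP[a1 a2]; split; first exact: lt_le_trans a1.
    by apply: le_lt_trans t1T; rewrite lee_fin.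
  rewrite (_ : [set z | _] = setT `*` [set t : R | 0 < t /\ (t%:E < T)%E]).
    apply: measurableX => //.
    case: (T) => [r||].
    - rewrite (_ : [set t : R | _] = `]0, r[%classic); first exact: measurable_itv.
      by apply/seteqP; split => t /=; rewrite in_itv/= lte_fin; [case=> -> ->|move=> /andP].
    - rewrite (_ : [set t : R | _] = `]0, +oo[%classic); first exact: measurable_itv.
      by apply/seteqP; split => t /=; rewrite in_itv/= ltry andbT; [case|move=> ?; split].
    - rewrite (_ : [set t : R | _] = set0)//.
      by apply/seteqP; split => t //=; case.
  by apply/seteqP; split => -[x t] /= => [|[]].
have := (measurable_restrictT _ mband).1 mf'; congr measurable_fun.
by apply/funext => z; rewrite patchE; case: ifPn; rewrite ?inE ?notin_setE => h; [rewrite ifT|rewrite ifF//; apply/negP].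
Qed.

Let expR_mfun2 k : mfun2 (fun _ t : R => expR (k * t)).
Proof.
by apply: cont2_mfun2; apply: (@cont2_of_t R (fun t => expR (k * t))); exact: continuous_expR_scale.
Qed.

Let md : mfun2 d.
Proof.
have [mux _ _] := W1p.
have h : mfun2 (fun x t => expR (b * t) * (if t0 <= t <= t1 then ux x t else 0)).
  by apply: measurable_funM; [exact: expR_mfun2|exact: mfun2_restrict].
congr measurable_fun: h; apply/funext => z; rewrite /d; case: ifP => // _; exact: mulr0.
Qed.

Let Ld : rect_itgbl lo hi t0 t1 (fun x t => `|d x t| `^ p).
Proof.
have [mux _ Lux] := W1p; have [[mu' _ _ _ _] _ _] := hu.
have mp (f : R -> R -> R) : mfun2 f -> mfun2 (fun x t => `|f x t| `^ p).
  move=> mf; apply: (@measurableT_comp _ _ _ _ _ _ (fun x : R => x `^ p)) => //.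
  exact: measurableT_comp.
pose g (f : R -> R -> R) x t := if t0 <= t <= t1 then f x t else 0.
pose E x t := `|g u x t| `^ p + `|g ux x t| `^ p.
have mE : mfun2 E by apply: measurable_funD; apply: mp; exact: mfun2_restrict.
have E0 x t : 0 <= E x t by rewrite addr_ge0 ?powR_ge0.
have rE : rect_itgbl lo hi t0 t1 E.
  apply/rect_itgblP2 => //.
  have := Lux lo hi t0 t1 t0_gt0 t1T; apply: le_lt_trans; rewrite le_eqVlt.
  apply/orP; left; apply/eqP; rewrite [RHS]integral_mkcond; apply: eq_integral => t _.
  rewrite patchE mem_setE in_itv/= /cutoff.
  case: ifPn => tt; last first.
    by rewrite -[RHS](integral0 mu setT); apply: eq_integral => x _; rewrite andbF normr0.
  rewrite [RHS]integral_mkcond; apply: eq_integral => x _.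
  rewrite patchE mem_setE in_itv/= andbT; case: ifP => _; last by rewrite normr0.
  by rewrite ger0_norm// /E /g tt.
have [M [M0 hM']] := cont_bound t0 t1 (@continuous_expR_scale R b).
have hM t : t0 <= t <= t1 -> expR (b * t) <= M by move=> /hM'; exact: le_trans (ler_norm _).
apply: (le_rect_itgbl (mp _ md) (rect_itgblZ (M `^ p) rE)) => x t _ tt.
rewrite ger0_norm ?powR_ge0// /d tt normrM (ger0_norm (expR_ge0 _)) powRM ?expR_ge0//.
apply: ler_pM; rewrite ?powR_ge0//.
  have hp := p2; apply: ge0_ler_powR; rewrite ?nnegrE ?expR_ge0 ?(ltW M0) ?hM//; lra.
by rewrite /E /g tt lerDr powR_ge0.
Qed.

Let within_t t : t0 <= t <= t1 -> 0 < t /\ (t%:E < T)%E.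
Proof.
case/andP => a1 a2; split; first exact: lt_le_trans a1.
by apply: le_lt_trans t1T; rewrite lee_fin.
Qed.

Let v_id x t : t0 <= t <= t1 -> v x t = expR (b * t) * u x t.
Proof.
move=> /andP[a1 a2]; apply: reduced_id; rewrite a2 andbT; exact: le_trans (ltW t0_gt0) a1.
Qed.

Let t1_gt0 : 0 < t1. Proof. exact: lt_trans t01. Qed.

Let cv : cont2 v. Proof. exact: reduced_cont2. Qed.

(** For almost every t the distributional derivative, tested on plateaus, gives a primitive by the
    du Bois-Reymond lemma; continuity of v makes the identity hold at every x. *)
Let ac : {ae mu, forall t, t0 < t < t1 -> itgbl lo hi (d ^~ t) /\
    forall x, lo <= x <= hi -> v x t - v lo t = itg lo x (d ^~ t)}.
Proof.
have [_ wd _] := W1p; move: wd; apply: filterS; first exact: (ae_filter_ringOfSetsType mu).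
move=> t wd /andP[tt0 tt1].
have tt : t0 <= t <= t1 by rewrite !ltW.
have [tg0 tT] := within_t tt.
have [lu lux weak] := wd tg0 tT.
have iux : itgbl lo hi (ux ^~ t).
  have [mux _ hux] := lux; apply/integrableP; split.
    by apply/measurable_EFinP; exact: measurable_funTS.
  by apply: hux => //; exact: segment_compact.
have iu : itgbl lo hi (u ^~ t).
  have [mux _ hux] := lu; apply/integrableP; split.
    by apply/measurable_EFinP; exact: measurable_funTS.
  by apply: hux => //; exact: segment_compact.
have di : itgbl lo hi (d ^~ t).
  by have := itgblZ (expR (b * t)) iux; apply: eq_itgbl => x _; rewrite /d tt.
have vi : itgbl lo hi (v ^~ t) by apply: itgbl_cont; exact: cont2_x cv.
split => // x xlh.
apply: (@du_bois_reymond_continuous R (v ^~ t) (d ^~ t) lo hi) => //; last first.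
  by apply: continuous_subspaceT; exact: cont2_x cv.
move=> y z e e0 ly yz zh.
have := weak _ (plateau_test e0 yz).
have D1 : derive1 (plateau e y z) = dplateau e y z.
  by apply/funext => s; rewrite derive1E; have [_ ->] := is_derive_plateau e y z s.
have out s : ~ `[lo, hi]%classic s -> s <= y \/ z + e <= s.
  rewrite /= in_itv/= => /negP; rewrite negb_and -!ltNge => /orP[h|h]; [left|right]; apply: ltW.
    exact: lt_le_trans h ly.
  exact: le_lt_trans zh h.
rewrite D1 (integral_itg (a := lo) (b := hi))//; last first.
  by move=> s _ /out[h|h]; rewrite ?(dplateau_left e0 yz h) ?(dplateau_right e0 yz h) mulr0.
rewrite (integral_itg (a := lo) (b := hi))//; last first.
  by move=> s _ /out[h|h]; rewrite ?(plateau_left e0 yz h) ?(plateau_right e0 yz h) mulr0.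
move=> wE.
have -> : itg lo hi (fun s => v s t * dplateau e y z s) =
   expR (b * t) * itg lo hi (fun s => u s t * dplateau e y z s).
  rewrite -itgZ; last by apply: itgbl_mul_cont => //; exact: dplateau_continuous.
  by apply: eq_itg => s _; rewrite v_id// mulrA.
have -> : itg lo hi (fun s => d s t * plateau e y z s) =
   expR (b * t) * itg lo hi (fun s => ux s t * plateau e y z s).
  rewrite -itgZ; last by apply: itgbl_mul_cont => //; exact: plateau_continuous.
  by apply: eq_itg => s _; rewrite /d tt mulrA.
by rewrite wE mulrN.
Qed.

(** The integral identity is tested with exp(b t) psi(x), psi a plateau. Fubini's theorem turns it
    into the statement that the time integral of the flux has weak derivative v(., t) - v(., s), and
    the du Bois-Reymond lemma concludes. *)
Let flux s t : t0 <= s -> s < t -> t <= t1 -> itgbl lo hi (fun x => v x t - v x s) /\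
  exists c, {ae mu, forall x, lo <= x <= hi ->
    itg s t (j x) = c + itg lo x (fun x => v x t - v x s)}.
Proof.
move=> t0s st tt1; pose K x := v x t - v x s.
have cK : continuous K by move=> x; apply: cvgB; [exact: (@cont2_x R v t cv x)|exact: (@cont2_x R v s cv x)].
have iK : itgbl lo hi K by exact: itgbl_cont.
split => //.
have ss : t0 <= s <= t1 by rewrite t0s (le_trans (ltW st) tt1).
have ts : t0 <= t <= t1 by rewrite tt1 (le_trans t0s (ltW st)).
have mj : mfun2 j by exact: mfun2_flux.
have rj : rect_itgbl lo hi s t j.
  by apply: (rect_itgblS t0s tt1 mj); exact: rect_itgbl_flux.
have fub (h : R -> R -> R) : mfun2 h -> rect_itgbl lo hi s t h ->
    itgbl lo hi (fun x => itg s t (h x)) /\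
    itg s t (fun r => itg lo hi (h ^~ r)) = itg lo hi (fun x => itg s t (h x)).
  by move=> mh /(rect_itgblP _ _ _ _ mh); exact: cutoff_fubini.
have [fi _] := fub _ mj rj.
apply: (@du_bois_reymond R (fun x => itg s t (j x)) K lo hi) => //.
move=> y z e e0 ly yz zh.
pose psi := plateau e y z; pose dpsi := dplateau e y z.
have cpsi : continuous psi by exact: plateau_continuous.
have cdpsi : continuous dpsi by exact: dplateau_continuous.
have mh : mfun2 (fun x r => j x r * dpsi x).
  apply: measurable_funM => //; by apply: (@cont2_mfun2 R (fun x _ => dpsi x)); exact: cont2_of_x.
have rh : rect_itgbl lo hi s t (fun x r => j x r * dpsi x) by exact: rect_itgbl_mul_cont.
have [hi1 hE] := fub _ mh rh.
have fE : itg lo hi (fun x => itg s t (j x) * dpsi x) =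
    itg lo hi (fun x => itg s t (fun r => j x r * dpsi x)).
  refine (eq_itg_ae (itgbl_mul_cont fi cdpsi) hi1 _).
  have := rect_itgbl_t rj; apply: filterS; first exact: (ae_filter_ringOfSetsType mu).
  move=> x jx xlh; rewrite mulrC -(itgZ _ (jx xlh)).
  by apply: eq_itg => r _; rewrite mulrC.
rewrite fE -hE.
have [ddpsi hdd cdd] : exists2 ddpsi : R -> R, (forall x : R, is_derive x 1 dpsi (ddpsi x)) &
    continuous ddpsi.
  (* A third derivative is extracted only to have the second one continuous, as [C21_closure]
     demands. *)
  have [f1 [h1 [f2 [h2 [f3 [h3 _]]]]]] := Ck_plateau 2 e y z.
  have f1E : f1 = dpsi.
    apply/funext => x; have [_ <-] := h1 x; have [_ e2] := is_derive_plateau e y z x.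
    exact: e2.
  exists f2; first by move=> x; rewrite -f1E.
  by move=> x; exact: is_derive1_continuous (h3 x).
(* Its time derivative is b phi, so the terms in u cancel pointwise. *)
pose phi x r := expR (b * r) * psi x.
pose phix x r := expR (b * r) * dpsi x.
pose phixx x r := expR (b * r) * ddpsi x.
pose phit x r := b * (expR (b * r) * psi x).
have cprod (g : R -> R) : continuous g -> continuous (fun w : R * R => expR (b * w.2) * g w.1).
  move=> cg; apply: (@cont2M R (fun _ r => expR (b * r)) (fun x _ => g x)); last exact: cont2_of_x.
  by apply: (@cont2_of_t R (fun r => expR (b * r))); exact: continuous_expR_scale.
have C1cst k : C1_on s t (fun=> k : R).
  split; first by apply: continuous_subspaceT => x; exact: cvg_cst.
  exists (fun=> 0); split; first by apply: continuous_subspaceT => x; exact: cvg_cst.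
  by move=> r _; exact: is_derive_cst.
have C21 : C21_closure (curved_domain s t (fun=> lo) (fun=> hi)) phi phix phixx phit.
  split; do ?[by apply: continuous_subspaceT; exact: cprod].
    apply: continuous_subspaceT => w; apply: cvgM; first exact: cvg_cst.
    exact: (cprod _ cpsi).
  move=> x r _; split.
  - exact: is_derive1Z (is_derive_plateau e y z x).
  - exact: is_derive1Z (hdd x).
  - have he : is_derive r 1 (fun r => expR (b * r)) (b * expR (b * r)).
      have hb : is_derive r 1 (fun r : R => b * r) b.
        by apply: is_derive_eq (is_derive1Z b (is_derive_id r 1)) _; rewrite mulr1.
      have := @is_derive1_comp R expR (fun r => b * r) r _ _ (is_derive_expR _) hb.
      by move=> h; apply: is_derive_eq h _; rewrite mulrC.
    have h := is_derive1M he (is_derive_cst (psi x) r 1).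
    by apply: is_derive_eq h _; rewrite mulr0 addr0 /phit mulrA.
have phi0 r : s <= r <= t -> phi lo r = 0 /\ phi hi r = 0.
  have pl : psi lo = 0 := plateau_left e0 yz ly.
  have pr : psi hi = 0 := plateau_right e0 yz zh.
  move=> _; rewrite /phi pl pr mulr0; split; exact: erefl.
have s0 : 0 < s by exact: lt_le_trans t0s.
have tT : (t%:E <= T)%E by apply: le_trans (ltW t1T); rewrite lee_fin.
have := ident s0 st tT (C1cst lo) (C1cst hi) (fun _ _ => lohi) C21 phi0.
have -> : \int[mu]_(x in `[lo, hi]) (u x t * phi x t) = itg lo hi (fun x => v x t * psi x).
  by apply: eq_itg => x _; rewrite (v_id _ ts) /phi mulrA [u x t * _]mulrC.
have -> : \int[mu]_(x in `[lo, hi]) (u x s * phi x s) = itg lo hi (fun x => v x s * psi x).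
  by apply: eq_itg => x _; rewrite (v_id _ ss) /phi mulrA [u x s * _]mulrC.
have -> : \int[mu]_(r in `[s, t]) \int[mu]_(x in `[lo, hi]) (- (u x r * phit x r) +
     `|ux x r| `^ (p - 2) * ux x r * phix x r + b * u x r `^ 1 * phi x r) =
   itg s t (fun r => itg lo hi (fun x => j x r * dpsi x)).
  apply: eq_itg => r /andP[sr rt]; apply: eq_itg => x _.
  have rr : t0 <= r <= t1 by rewrite (le_trans t0s sr) (le_trans rt tt1).
  have [r0 rT] := within_t rr.
  have [[_ up _ _ _] _ _] := hu.
  (* The exponent beta = 1 is a real power, which is the identity only on nonnegative reals. *)
  have -> : u x r `^ 1 = u x r by exact: powRr1 (up x r r0 rT).
  rewrite /phit /phix /phi /j /d rr (FpM p2 _ (expR_ge0 (b * r))) /wt.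
  have -> : Fp p (ux x r) = `|ux x r| `^ (p - 2) * ux x r by [].
  move: (psi x) (dpsi x) (`|ux x r| `^ (p - 2) * ux x r) (u x r) => P Q F U.
  (* F is homogeneous of degree p - 1, so F(d) carries exp(b (p-1) t); the weight reduces it to the
     factor exp(b t) of the test function. *)
  have -> : expR (b * r) `^ (p - 1) = expR (b * (p - 2) * r) * expR (b * r).
    by rewrite -expRM -expRD; congr expR; ring.
  have -> : expR (- (b * (p - 2) * r)) * (expR (b * (p - 2) * r) * expR (b * r) * F) =
       expR (b * r) * F.
    by rewrite !mulrA -expRD addNr expR0 mul1r.
  ring.
have -> : itg lo hi (fun x => K x * psi x) =
    itg lo hi (fun x => v x t * psi x) - itg lo hi (fun x => v x s * psi x).
  rewrite -itgB; [|by apply: itgbl_cont => x; apply: cvgM; [exact: (@cont2_x R v t cv x)|exact: cpsi]|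
    by apply: itgbl_cont => x; apply: cvgM; [exact: (@cont2_x R v s cv x)|exact: cpsi]].
  by apply: eq_itg => x _; rewrite /K mulrBl.
by move=> h; apply/eqP; rewrite -addr_eq0 addrC; apply/eqP; exact: h.
Qed.

(** K is the exact increment, so a weak solution is a subflow and a superflow at once. *)
Lemma weak_flow_rect : flow p b lo hi t0 t1 v d (fun s t x => v x t - v x s).
Proof. by split. Qed.

End rectangle.

Lemma weak_flow lo hi t0 t1 : lo < hi -> 0 < t0 -> t0 < t1 -> (t1%:E < T)%E ->
  exists d, flow p b lo hi t0 t1 (reduced b t1 u) d
    (fun s t x => reduced b t1 u x t - reduced b t1 u x s).
Proof.
move=> lohi t00 t01 t1T; have [[_ _ _ _ [ux [W1p ident]]] _ _] := hu.
by eexists; exact: (weak_flow_rect lohi t00 t01 t1T W1p ident).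
Qed.
End WeakFlow.

(** * Barriers *)

Section PosPower.
Context {R : realType}.
Implicit Types (q x : R).

(** The one-sided power x_+^q. For q = 0 it is 1 everywhere, since 0^0 = 1 for [powR]; hence the
    conditions q != 0 and 0 < q below. *)
Definition pw q x : R := pos x `^ q.

Lemma pw_ge0 q x : 0 <= pw q x. Proof. exact: powR_ge0. Qed.
Lemma pw_le0E q x : q != 0 -> x <= 0 -> pw q x = 0.
Proof. by move=> q0 x0; rewrite /pw pos_le0E// powR0. Qed.
Lemma pw_ge0E q x : 0 <= x -> pw q x = x `^ q.
Proof. by move=> x0; rewrite /pw pos_gt0E. Qed.

Lemma pw_small q e : 0 < q -> 0 < e -> \forall x \near (0 : R), pw q x <= e.
Proof.
move=> q0 e0; have r0 : 0 < e `^ q^-1 by rewrite powR_gt0.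
near=> x.
have xr : x <= e `^ q^-1.
  by apply: le_trans (ler_norm _) _; near: x; exact: (@nbhs0_le R R _ r0).
have [x0|x0] := leP 0 x; last by rewrite pw_le0E ?(ltW e0)// ?(ltW x0)// gt_eqF.
rewrite pw_ge0E//; apply: (@le_trans _ _ ((e `^ q^-1) `^ q)).
  by apply: ge0_ler_powR; rewrite ?nnegrE ?(ltW q0) ?(ltW r0).
by rewrite -powRrM mulVf ?gt_eqF// powRr1// ltW.
Unshelve. all: by end_near. Qed.

Lemma is_derive_pw q x : 1 < q -> is_derive x 1 (pw q) (q * pw (q - 1) x).
Proof.
move=> q1; have q0 : 0 < q by exact: lt_trans q1.
have q10 : 0 < q - 1 by rewrite subr_gt0.
have [x0|x0|x0] := ltgtP 0 x.
- rewrite pw_ge0E ?(ltW x0)//.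
  apply: (@near_eq_is_derive R _ _ (fun y : R => y `^ q) (pw q) x 1); last exact: is_derive1_powR.
  by near=> y; rewrite pw_ge0E// ltW//; near: y; exact: lt_nbhsr.
- rewrite pw_le0E ?(ltW x0) ?gt_eqF// mulr0.
  apply: (@near_eq_is_derive R _ _ (fun _ : R => 0 : R) (pw q) x 1).
  by near=> y; rewrite pw_le0E ?gt_eqF// ltW//; near: y; exact: lt_nbhsl.
- rewrite -x0 pw_le0E// ?gt_eqF// mulr0.
  have pw00 : pw q 0 = 0 by rewrite pw_le0E// gt_eqF.
  have lim : h^-1 * pw q h @[h --> 0^'] --> (0 : R).
    apply/cvgrPdist_le => e e0; near=> h; rewrite sub0r normrN.
    have hn : h != 0 by near: h; exact: nbhs_dnbhs_neq.
    have he : pw (q - 1) h <= e by near: h; apply: nbhs_dnbhs; exact: pw_small.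
    have [h0|h0] := leP h 0; first by rewrite pw_le0E ?gt_eqF// mulr0 normr0 ltW.
    apply: le_trans he; rewrite !pw_ge0E ?(ltW h0)//.
    rewrite ger0_norm ?mulr_ge0 ?powR_ge0 ?invr_ge0 ?(ltW h0)//.
    by rewrite powRB ?hn ?implybT// powRr1 ?(ltW h0)// mulrC.
  apply: DeriveDef.
    rewrite /derivable; apply/cvg_ex; exists 0.
    apply: cvg_trans lim; apply: near_eq_cvg; apply: nearW => h /=.
    by rewrite addr0 [_ *: 1]mulr1 pw00 subr0.
  rewrite /derive !pw00; apply/cvg_lim => //.
  apply: cvg_trans lim; apply: near_eq_cvg; apply: nearW => h /=.
  by rewrite addr0 [_ *: 1]mulr1 subr0.
Unshelve. all: by end_near. Qed.

Lemma pw_continuous q : 0 < q -> continuous (pw q).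
Proof.
move=> q0 x; have [x0|x0|x0] := ltgtP 0 x.
- have c : {for x, continuous (fun y : R => y `^ q)} := is_derive1_continuous (is_derive1_powR q x0).
  rewrite /prop_for/continuous_at pw_ge0E ?(ltW x0)//.
  apply: cvg_trans c; apply: near_eq_cvg.
  by near=> y; rewrite pw_ge0E// ltW//; near: y; exact: lt_nbhsr.
- have c : {for x, continuous (fun _ : R => 0 : R)} by exact: cvg_cst.
  rewrite /prop_for/continuous_at pw_le0E ?(ltW x0) ?gt_eqF//.
  apply: cvg_trans c; apply: near_eq_cvg.
  by near=> y; rewrite pw_le0E ?gt_eqF// ltW//; near: y; exact: lt_nbhsl.
- rewrite -x0 /prop_for/continuous_at pw_le0E// ?gt_eqF//.
  apply/cvgrPdist_le => e e0; near=> y; rewrite sub0r normrN ger0_norm ?pw_ge0//.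
  by near: y; exact: pw_small.
Unshelve. all: by end_near. Qed.

Lemma is_derive_pwN q x : 1 < q ->
  is_derive x 1 (fun y => pw q (- y)) (- (q * pw (q - 1) (- x))).
Proof.
move=> q1; have hN : is_derive x 1 (fun y : R => - y) (- 1).
  exact: is_deriveN (is_derive_id x 1).
have h := @is_derive1_comp R (pw q) (fun y => - y) x _ _ (is_derive_pw (- x) q1) hN.
by apply: is_derive_eq h _; rewrite mulrN1.
Qed.

Lemma pwN_continuous q : 0 < q -> continuous (fun x => pw q (- x)).
Proof.
move=> q0 x; apply: (@continuous_comp _ _ _ (fun x : R => - x) (pw q)); last exact: pw_continuous.
by apply: cvgN; exact: cvg_id.
Qed.

(* F, split into one-sided powers: F(A x_+^s - B x_-^s) for A, B >= 0 *)
Lemma Fp_pw p s x A B : 2 < p -> 0 < s -> 0 <= A -> 0 <= B ->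
  Fp p (A * pw s x - B * pw s (- x)) =
  A `^ (p - 1) * pw (s * (p - 1)) x - B `^ (p - 1) * pw (s * (p - 1)) (- x).
Proof.
move=> p2 s0 A0 B0; have p1 : 0 < p - 1 by lra.
have sn : s != 0 by rewrite gt_eqF.
have spn : s * (p - 1) != 0 by rewrite gt_eqF// mulr_gt0.
have pwE y : pw s y `^ (p - 1) = pw (s * (p - 1)) y by rewrite /pw -powRrM.
have half C y : 0 <= C -> Fp p (C * pw s y) = C `^ (p - 1) * pw (s * (p - 1)) y.
  by move=> C0; rewrite Fp_ge0// ?mulr_ge0 ?pw_ge0// powRM ?pw_ge0// pwE.
have [x0|x0] := leP 0 x.
  have xn : - x <= 0 by lra.
  by rewrite !(pw_le0E _ xn)// !mulr0 !subr0 half.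
by rewrite !(pw_le0E _ (ltW x0))// !mulr0 !sub0r FpN half.
Qed.

Lemma Fp_continuous p : 2 < p -> continuous (Fp p : R -> R).
Proof.
move=> p2; have p1 : 0 < p - 1 by lra.
have E : Fp p = fun s => pw (p - 1) s - pw (p - 1) (- s) :> R.
  apply/funext => s; have := @Fp_pw p 1 s 1 1 p2 ltr01 ler01 ler01.
  rewrite powR1 !mul1r => <-; congr (Fp p); rewrite /pw !powRr1 ?pos_ge0//.
  have [s0|s0] := leP 0 s; first by rewrite (pos_gt0E s0) (@pos_le0E _ (- s)); lra.
  by rewrite (pos_le0E (ltW s0)) (@pos_gt0E _ (- s)); lra.
rewrite E => s; apply: cvgB; first exact: pw_continuous.
exact: pwN_continuous.
Qed.

End PosPower.

(** * Classical functions as flows *)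

Section ClassicalFlow.
Context {R : realType}.
Notation mu := (@lebesgue_measure R).
Notation mR := (measurableTypeR R).

Lemma itg_FTC_oo (a b : R) (f g : R -> R) : a <= b -> continuous f -> continuous g ->
  (forall x, a < x < b -> is_derive x 1 f (g x)) -> itg a b g = f b - f a.
Proof.
rewrite le_eqVlt => /predU1P[<-|ab] cf cg fg; first by rewrite itg1 subrr.
rewrite /itg /Rintegral (@continuous_FTC2 _ _ f)//.
- exact: continuous_subspaceT.
- split.
  + by move=> x; rewrite in_itv/= => /fg; case.
  + by apply: cvg_at_right_filter; exact: cf.
  + by apply: cvg_at_left_filter; exact: cf.
- by move=> x; rewrite in_itv/= => /fg[_ E]; rewrite derive1E.
Qed.

Lemma rect_itgbl_cont2 lo hi t0 t1 (f : R -> R -> R) : cont2 f -> rect_itgbl lo hi t0 t1 f.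
Proof.
move=> cf; have [M [M0 hM]] := cont2_bound lo hi t0 t1 cf.
exact: (le_rect_itgbl (cont2_mfun2 cf) (rect_itgbl_cst _ _ _ _ M)).
Qed.

Variables (p b : R).
Hypothesis p2 : 2 < p.

(** K is the time integral of the flux divergence, so the space structure alone makes a flow. The
    time derivative of H enters only when K is compared with its increments. *)
Lemma classical_flow lo hi t0 t1 (H d jx : R -> R -> R) : lo <= hi ->
  cont2 H -> cont2 d -> cont2 jx ->
  (forall x t : R, is_derive x 1 (H ^~ t) (d x t)) ->
  (forall x t : R, is_derive x 1 (fun y => wt p b t * Fp p (d y t)) (jx x t)) ->
  flow p b lo hi t0 t1 H d (fun s t x => itg s t (jx x)).
Proof.
move=> lh cH cd cj Hd dj.
have md := cont2_mfun2 cd.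
have fub x s t : itgbl lo x (fun y => itg s t (jx y)) /\
    itg s t (fun r => itg lo x (jx ^~ r)) = itg lo x (fun y => itg s t (jx y)).
  apply: cutoff_fubini; first exact: cont2_mfun2.
  exact: (rect_itgblP _ _ _ _ (cont2_mfun2 cj)).1 (rect_itgbl_cont2 _ _ _ _ cj).
split => //.
- have [M [M0 hM]] := cont2_bound lo hi t0 t1 cd.
  apply: (le_rect_itgbl _ (rect_itgbl_cst _ _ _ _ (M `^ p))).
    apply: (@measurableT_comp _ _ _ _ _ _ (fun x : R => x `^ p)) => //.
    exact: measurableT_comp.
  move=> x t xlh tt; rewrite ger0_norm ?powR_ge0//.
  have hp := p2; apply: ge0_ler_powR; rewrite ?nnegrE ?(ltW M0)//; [lra|exact: hM].
- apply: aeW => t _; have cdt : continuous (d ^~ t) by exact: (cont2_x (t := t) cd).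
  split; first exact: itgbl_cont.
  by move=> x /andP[lx _]; rewrite (itg_FTC lx (fun y => Hd y t) cdt).
- move=> s t _ _ _; split; first by have [] := fub hi s t.
  exists (itg s t (fun r => wt p b r * Fp p (d lo r))).
  apply: aeW => x /andP[lx _].
  have [_ <-] := fub x s t.
  have cj' y : continuous (fun r => wt p b r * Fp p (d y r)).
    move=> r; apply: cvgM; first exact: wt_continuous.
    apply: (@continuous_comp _ _ _ (d y) (Fp p)); last exact: Fp_continuous.
    exact: (@cont2_t R d y cd r).
  have E r : itg lo x (jx ^~ r) = wt p b r * Fp p (d x r) - wt p b r * Fp p (d lo r).
    by apply: (itg_FTC lx (fun y => dj y r)); exact: (cont2_x (t := r) cj).
  rewrite (eq_itg (fun r _ => E r)).
  rewrite (itgB (itgbl_cont _ _ (cj' x)) (itgbl_cont _ _ (cj' lo))); ring.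
Qed.

End ClassicalFlow.

(** * Separable and stationary barriers *)

Section Separable.
Context {R : realType}.
Notation mu := (@lebesgue_measure R).
Variables (p b : R).
Hypotheses (p2 : 2 < p) (b0 : b != 0).

Definition age (t : R) : R := (b * (p - 2))^-1 * (1 - expR (- (b * (p - 2) * t))).

Lemma age0 : age 0 = 0. Proof. by rewrite /age mulr0 oppr0 expR0 subrr mulr0. Qed.

Lemma is_derive_age (t : R) : is_derive t 1 age (wt p b t).
Proof.
have hp := p2; have p20 : p - 2 != 0 by rewrite gt_eqF// subr_gt0.
have bp : b * (p - 2) != 0 by rewrite mulf_neq0.
have hl : is_derive t 1 (fun t : R => - (b * (p - 2)) * t) (- (b * (p - 2))).
  by apply: is_derive_eq (is_derive1Z _ (is_derive_id t 1)) _; rewrite mulr1.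
have he := @is_derive1_comp R expR (fun t => - (b * (p - 2)) * t) t _ _ (is_derive_expR _) hl.
have h := is_derive1Z (b * (p - 2))^-1 (is_derive1B (is_derive_cst (1 : R) t 1) he).
have E : age = (fun t : R => (b * (p - 2))^-1 * (1 - expR (- (b * (p - 2)) * t))).
  by apply/funext => s; rewrite /age mulNr.
by rewrite E; apply: is_derive_eq h _; rewrite /wt mulNr; field; rewrite p20 b0.
Qed.

Lemma age_continuous : continuous age.
Proof. by move=> t; exact: is_derive1_continuous (is_derive_age t). Qed.

Lemma age_le s t : s <= t -> age s <= age t.
Proof.
move=> st; rewrite -subr_ge0 -(itg_FTC st is_derive_age (@wt_continuous R p b)).
by apply: itg_ge0 => r _; exact: ltW (wt_gt0 p b r).
Qed.

Lemma age_ge0 t : 0 <= t -> 0 <= age t.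
Proof. by move=> t0; rewrite -age0; exact: age_le. Qed.

(* The truncation at 1/2 keeps the powers of [clock] continuous for all t; it is
   inactive wherever a barrier is used. *)
Definition clock (k c t : R) : R := Num.max (1 + k * (age t - c)) (1 / 2).

Lemma clock_gt0 k c t : 0 < clock k c t.
Proof. by rewrite /clock lt_max; apply/orP; right; lra. Qed.

Lemma clock_continuous k c : continuous (clock k c).
Proof.
move=> t; apply: (@continuous_max R R (fun t => 1 + k * (age t - c)) (fun=> 1 / 2) t); last exact: cvg_cst.
apply: cvgD; first exact: cvg_cst.
apply: cvgM; first exact: cvg_cst.
by apply: cvgB; [exact: age_continuous|exact: cvg_cst].
Qed.

Lemma clock_powR_continuous k c a : continuous (fun t => clock k c t `^ a).
Proof.
move=> t; apply: (@continuous_comp _ _ _ (clock k c) (fun y : R => y `^ a)).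
  exact: clock_continuous.
exact: is_derive1_continuous (is_derive1_powR a (clock_gt0 k c t)).
Qed.

Lemma is_derive_clock_powR (k c a t : R) : 1 / 2 < 1 + k * (age t - c) ->
  is_derive t 1 (fun t => clock k c t `^ a) (a * k * wt p b t * clock k c t `^ (a - 1)).
Proof.
move=> ht; have hl : is_derive t 1 (fun t => 1 + k * (age t - c)) (k * wt p b t).
  have h := is_derive1D (is_derive_cst (1 : R) t 1)
    (is_derive1Z k (is_derive1B (is_derive_age t) (is_derive_cst c t 1))).
  by apply: is_derive_eq h _; rewrite add0r subr0.
have cl : {for t, continuous (fun t => 1 + k * (age t - c))} by exact: is_derive1_continuous hl.
have l0 : 0 < 1 + k * (age t - c) by apply: lt_trans ht; lra.
have h := @is_derive1_comp R (fun y : R => y `^ a) (fun t => 1 + k * (age t - c)) t _ _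
  (is_derive1_powR a l0) hl.
have ct : clock k c t = 1 + k * (age t - c) by rewrite /clock max_l// ltW.
rewrite ct.
apply: (@near_eq_is_derive R _ _ (fun t => (1 + k * (age t - c)) `^ a) _ t 1).
  near=> s; rewrite /clock max_l//.
  near: s; apply: (cvgr_ge (1 + k * (age t - c))) => //.
by apply: is_derive_eq h _; ring.
Unshelve. all: by end_near. Qed.

Section profile.
Variables (q A B x0 : R).
Hypotheses (q1 : p / (p - 2) <= q) (A0 : 0 <= A) (B0 : 0 <= B).
Let m := (q - 1) * (p - 1).

(** Separate amplitudes on the two sides of x0: A = B gives the centred barriers that force
    vanishing, A = 0 the one-sided profile left of the interface. *)
Definition cusp (x : R) : R := A * pw q (x - x0) + B * pw q (- (x - x0)).
Definition dcusp (x : R) : R :=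
  A * q * pw (q - 1) (x - x0) - B * q * pw (q - 1) (- (x - x0)).
Definition flux_cusp (x : R) : R := (A * q) `^ (p - 1) * pw m (x - x0) -
  (B * q) `^ (p - 1) * pw m (- (x - x0)).
Definition dflux_cusp (x : R) : R := m * ((A * q) `^ (p - 1) * pw (m - 1) (x - x0) +
  (B * q) `^ (p - 1) * pw (m - 1) (- (x - x0))).

Let p20 : 0 < p - 2. Proof. by rewrite subr_gt0. Qed.
Let q_gt1 : 1 < q.
Proof. have hp := p20; apply: lt_le_trans q1; rewrite ltr_pdivlMr//; lra. Qed.
Let m_gt1 : 1 < m.
Proof.
have hp := p20; have hq : 2 / (p - 2) <= q - 1.
  have -> : 2 / (p - 2) = p / (p - 2) - 1 by field; rewrite gt_eqF.
  by rewrite lerD2r.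
have h : 1 < 2 / (p - 2) * (p - 1) by rewrite mulrAC ltr_pdivlMr//; lra.
by apply: lt_le_trans h _; rewrite /m ler_wpM2r//; lra.
Qed.

Let shift (f : R -> R) (x df : R) : is_derive (x - x0) 1 f df ->
  is_derive x 1 (fun y => f (y - x0)) df.
Proof.
move=> hf; have hl : is_derive x 1 (fun y => y - x0) 1.
  by apply: is_derive_eq (is_derive1B (is_derive_id x 1) (is_derive_cst x0 x 1)) _; rewrite subr0.
by apply: is_derive_eq (@is_derive1_comp R f (fun y => y - x0) x _ _ hf hl) _; rewrite mulr1.
Qed.

Let two_sided (s C D x : R) : 1 < s -> is_derive x 1
  (fun y : R => C * pw s (y - x0) + D * pw s (- (y - x0)))
  (C * s * pw (s - 1) (x - x0) - D * s * pw (s - 1) (- (x - x0))).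
Proof.
move=> s1; apply: (@shift (fun y => C * pw s y + D * pw s (- y))).
have h := is_derive1D (is_derive1Z C (is_derive_pw (x - x0) s1)) (is_derive1Z D (is_derive_pwN (x - x0) s1)).
by apply: is_derive_eq h _; ring.
Qed.

Let two_sided_continuous (s C D : R) : 0 < s ->
  continuous (fun y : R => C * pw s (y - x0) + D * pw s (- (y - x0))).
Proof.
move=> s1 x; apply: (@continuous_comp _ _ _ (fun y => y - x0) (fun y => C * pw s y + D * pw s (- y))).
  by apply: cvgB; [exact: cvg_id|exact: cvg_cst].
apply: cvgD; apply: cvgM; do ?[exact: cvg_cst]; first exact: pw_continuous.
exact: pwN_continuous.
Qed.

Lemma is_derive_cusp (x : R) : is_derive x 1 cusp (dcusp x).
Proof. exact: two_sided. Qed.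

Lemma cusp_continuous : continuous cusp.
Proof. by move=> x; exact: is_derive1_continuous (is_derive_cusp x). Qed.

Lemma dcusp_continuous : continuous dcusp.
Proof.
have E : dcusp = (fun y : R => A * q * pw (q - 1) (y - x0) + - (B * q) * pw (q - 1) (- (y - x0))).
  by apply/funext => y; rewrite /dcusp mulNr.
by rewrite E; apply: two_sided_continuous; rewrite subr_gt0.
Qed.

Lemma Fp_dcusp x : Fp p (dcusp x) = flux_cusp x.
Proof.
have q0 : 0 <= q by apply: le_trans (ltW q_gt1); lra.
by rewrite /dcusp Fp_pw// ?mulr_ge0// subr_gt0.
Qed.

Lemma is_derive_flux_cusp (x : R) : is_derive x 1 flux_cusp (dflux_cusp x).
Proof.
have E : flux_cusp = (fun y : R => (A * q) `^ (p - 1) * pw m (y - x0) +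
     - (B * q) `^ (p - 1) * pw m (- (y - x0))).
  by apply/funext => y; rewrite /flux_cusp mulNr.
rewrite E; apply: is_derive_eq (two_sided _ _ _ m_gt1) _.
by rewrite /dflux_cusp; ring.
Qed.

Lemma dflux_cusp_continuous : continuous dflux_cusp.
Proof.
move=> x; apply: cvgM; first exact: cvg_cst.
by apply: two_sided_continuous; rewrite subr_gt0.
Qed.

Lemma dflux_cusp_ge0 x : 0 <= dflux_cusp x.
Proof.
have m0 : 0 <= m by apply: le_trans (ltW m_gt1); lra.
by rewrite /dflux_cusp mulr_ge0// addr_ge0// mulr_ge0 ?powR_ge0 ?pw_ge0.
Qed.

Section time.
Variable k : R.

(** Separation of variables: theta = (1 - k A)^(-1/(p-2)) satisfies d theta / dA = k/(p-2)
    theta^(p-1), the power with which the flux scales. *)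
Definition sep (x t : R) : R := clock (- k) 0 t `^ (- (p - 2)^-1) * cusp x.
Definition dsep (x t : R) : R := clock (- k) 0 t `^ (- (p - 2)^-1) * dcusp x.
Definition source (x t : R) : R :=
  wt p b t * clock (- k) 0 t `^ (- (p - 2)^-1 - 1) * dflux_cusp x.

Let cont2_product (f g : R -> R) : continuous f -> continuous g -> cont2 (fun x t => f t * g x).
Proof.
by move=> cf cg; apply: (@cont2M R (fun _ t => f t) (fun x _ => g x)); [exact: cont2_of_t|exact: cont2_of_x].
Qed.

Lemma sep_flow lo hi t0 t1 : lo <= hi ->
  flow p b lo hi t0 t1 sep dsep (fun s t x => itg s t (source x)).
Proof.
move=> lh; refine (classical_flow (H := sep) (d := dsep) (jx := source) p2 _ _ lh _ _ _ _ _).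
- by apply: cont2_product; [exact: clock_powR_continuous|exact: cusp_continuous].
- by apply: cont2_product; [exact: clock_powR_continuous|exact: dcusp_continuous].
- apply: (@cont2_product (fun t => wt p b t * clock (- k) 0 t `^ (- (p - 2)^-1 - 1))); last exact: dflux_cusp_continuous.
  by move=> t; apply: cvgM; [exact: wt_continuous|exact: clock_powR_continuous].
- by move=> x t; exact: is_derive1Z (is_derive_cusp x).
- move=> x t.
  (* The exponents agree because -(p-1)/(p-2) = -1/(p-2) - 1. *)
  have E : (fun y => wt p b t * Fp p (dsep y t)) =
      (fun y => wt p b t * clock (- k) 0 t `^ (- (p - 2)^-1 - 1) * flux_cusp y).
    apply/funext => y; rewrite /dsep FpM ?powR_ge0// Fp_dcusp -powRrM mulrA.
    congr (_ * _ `^ _ * _); field; have hp := p20; rewrite gt_eqF//.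
  rewrite E; exact: is_derive1Z (is_derive_flux_cusp x).
Qed.

(** The time factors on both sides coincide, which leaves the stationary inequality (F(cusp'))' <=
    k/(p-2) cusp. The bound on k A keeps the truncation in [clock] inactive. *)
Lemma sep_superflow lo hi t0 t1 : lo <= hi ->
  (forall t, t0 <= t <= t1 -> k * age t < 1 / 2) ->
  (forall x, lo <= x <= hi -> dflux_cusp x <= k / (p - 2) * cusp x) ->
  superflow p b lo hi t0 t1 sep dsep.
Proof.
move=> lh kt Gg; exists (fun s t x => itg s t (source x)); first exact: sep_flow.
move=> s t x t0s st tt1 xlh.
pose g r := k / (p - 2) * (wt p b r * clock (- k) 0 r `^ (- (p - 2)^-1 - 1)).
have cg : continuous g.
  move=> r; apply: cvgM; first exact: cvg_cst.
  by apply: cvgM; [exact: wt_continuous|exact: clock_powR_continuous].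
have gE : itg s t g = clock (- k) 0 t `^ (- (p - 2)^-1) - clock (- k) 0 s `^ (- (p - 2)^-1).
  refine (@itg_FTC_oo R s t (fun r => clock (- k) 0 r `^ (- (p - 2)^-1)) g (ltW st) _ cg _).
    exact: clock_powR_continuous.
  move=> r /andP[sr rt].
  have rr : t0 <= r <= t1 by rewrite (le_trans t0s (ltW sr)) (le_trans (ltW rt) tt1).
  have hk : 1 / 2 < 1 + - k * (age r - 0) by have := kt r rr; lra.
  apply: is_derive_eq (is_derive_clock_powR _ hk) _.
  by rewrite /g; ring.
rewrite /sep -mulrBl -gE mulrC -itgZ; last exact: itgbl_cont.
apply: itg_le; [apply: itgbl_cont..|].
- move=> r; apply: cvgM; last exact: cvg_cst.
  by apply: cvgM; [exact: wt_continuous|exact: clock_powR_continuous].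
- by move=> r; apply: cvgM; [exact: cvg_cst|exact: cg].
move=> r _; have -> : cusp x * g r =
    wt p b r * clock (- k) 0 r `^ (- (p - 2)^-1 - 1) * (k / (p - 2) * cusp x).
  by rewrite /g; ring.
apply: ler_wpM2l; last exact: Gg.
by rewrite mulr_ge0 ?powR_ge0// ltW// wt_gt0.
Qed.

End time.

(** The case k = 0: a function constant in time is a subflow because its flux is nondecreasing in
    x. *)
Lemma cusp_subflow lo hi t0 t1 : lo <= hi ->
  subflow p b lo hi t0 t1 (fun x _ => cusp x) (fun x _ => dcusp x).
Proof.
move=> lh; have c1 a t : clock (- 0) 0 t `^ a = 1.
  by rewrite /clock oppr0 mul0r addr0 max_l ?powR1//; lra.
exists (fun s t x => itg s t (source 0 x)).
  have := sep_flow 0 t0 t1 lh.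
  have -> : sep 0 = fun x _ => cusp x by apply/funext => x; apply/funext => t; rewrite /sep c1 mul1r.
  by have -> : dsep 0 = fun x _ => dcusp x by apply/funext => x; apply/funext => t; rewrite /dsep c1 mul1r.
move=> s t x _ _ _ _; rewrite subrr; apply: itg_ge0 => r _.
by rewrite /source mulr_ge0 ?dflux_cusp_ge0// mulr_ge0 ?powR_ge0// ltW// wt_gt0.
Qed.

End profile.
End Separable.

(** * Barenblatt solutions *)

Section Barenblatt.
Context {R : realType}.
Notation mu := (@lebesgue_measure R).
Variables (p b : R).
Hypotheses (p2 : 2 < p) (b0 : b != 0).

Let q := p / (p - 1).
Let m := (p - 1) / (p - 2).
Let c := (p / (p - 2)) `^ (p - 1).

Let p20 : 0 < p - 2. Proof. by rewrite subr_gt0. Qed.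
Let p10 : 0 < p - 1. Proof. by have hp := p20; lra. Qed.
Let q_gt1 : 1 < q. Proof. by rewrite /q ltr_pdivlMr//; lra. Qed.
Let m_gt1 : 1 < m. Proof. by rewrite /m ltr_pdivlMr//; lra. Qed.
Let pn2 : p - 2 != 0. Proof. exact: lt0r_neq0. Qed.
Let pn1 : p - 1 != 0. Proof. exact: lt0r_neq0. Qed.

(* Barenblatt profile (1 - |z|^(p/(p-1)))_+^((p-1)/(p-2)) *)
Definition hump (z : R) : R := pw m (1 - (pw q z + pw q (- z))).
Definition dhump (z : R) : R := m * pw (m - 1) (1 - (pw q z + pw q (- z))) *
  - (q * pw (q - 1) z - q * pw (q - 1) (- z)).

Lemma is_derive_hump (z : R) : is_derive z 1 hump (dhump z).
Proof.
have h1 := is_derive1B (is_derive_cst (1 : R) z 1)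
  (is_derive1D (is_derive_pw z q_gt1) (is_derive_pwN z q_gt1)).
have h := @is_derive1_comp R (pw m) (fun z => 1 - (pw q z + pw q (- z))) z _ _
  (is_derive_pw _ m_gt1) h1.
by apply: is_derive_eq h _; rewrite sub0r.
Qed.

Lemma hump_continuous : continuous hump.
Proof. by move=> z; exact: is_derive1_continuous (is_derive_hump z). Qed.

Lemma dhump_continuous : continuous dhump.
Proof.
have q0 : 0 < q - 1 by rewrite subr_gt0.
have m0 : 0 < m - 1 by rewrite subr_gt0.
have q00 : 0 < q by exact: lt_trans q_gt1.
move=> z; apply: cvgM.
  apply: cvgM; first exact: cvg_cst.
  apply: (@continuous_comp _ _ _ (fun z => 1 - (pw q z + pw q (- z))) (pw (m - 1))).
    apply: cvgB; first exact: cvg_cst.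
    by apply: cvgD; [exact: pw_continuous|exact: pwN_continuous].
  exact: pw_continuous.
apply: cvgN; apply: cvgB; apply: cvgM; do ?[exact: cvg_cst].
  exact: pw_continuous.
exact: pwN_continuous.
Qed.

(** The self-similar profile equation integrated once. The exponents are made for it: (q - 1)(p - 1)
    = 1, (m - 1)(p - 1) = m, and m q = p/(p-2) gives c. *)
Lemma Fp_dhump z : Fp p (dhump z) = - c * (z * hump z).
Proof.
have m0 : 0 <= m by apply: le_trans (ltW m_gt1); lra.
have q0 : 0 <= q by apply: le_trans (ltW q_gt1); lra.
have qq : 0 < q - 1 by rewrite subr_gt0.
pose P := m * q * pw (m - 1) (1 - (pw q z + pw q (- z))).
have P0 : 0 <= P by apply: mulr_ge0; [exact: mulr_ge0|exact: pw_ge0].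
have -> : dhump z = P * pw (q - 1) (- z) - P * pw (q - 1) (- - z).
  by rewrite opprK /dhump /P; ring.
rewrite (Fp_pw (- z) p2 qq P0 P0) opprK.
have -> : (q - 1) * (p - 1) = 1 by rewrite /q; field.
have -> : P `^ (p - 1) = c * hump z.
  rewrite /P (powRM _ (mulr_ge0 m0 q0) (pw_ge0 (m - 1) _)) /hump /c.
  congr (_ * _).
    by congr powR; rewrite /m /q; field; rewrite pn1 pn2.
  rewrite /pw -powRrM; congr powR; rewrite /m; field.
  exact: pn2.
rewrite -mulrBr /pw !powRr1 ?pos_ge0//.
have [z0|z0] := leP 0 z.
  by rewrite (pos_gt0E z0) (@pos_le0E _ (- z)); [ring|lra].
by rewrite (pos_le0E (ltW z0)) (@pos_gt0E _ (- z)); [ring|lra].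
Qed.

Lemma pw_sym_abs (s z : R) : s != 0 -> pw s z + pw s (- z) = `|z| `^ s.
Proof.
move=> s0; have [z0|z0] := leP 0 z.
  by rewrite (@pw_le0E _ _ (- z))// ?oppr_le0// addr0 pw_ge0E// ger0_norm.
by rewrite (@pw_le0E _ _ z)// ?(ltW z0)// add0r pw_ge0E ?oppr_ge0 ?(ltW z0)// ltr0_norm.
Qed.

Let qn0 : q != 0. Proof. by rewrite gt_eqF//; apply: lt_trans q_gt1. Qed.
Let mn0 : m != 0. Proof. by rewrite gt_eqF//; apply: lt_trans m_gt1. Qed.

Let one_powR (a : R) : 1 `^ a = 1 :> R. Proof. by rewrite powR1. Qed.

Lemma hump_le1 z : hump z <= 1.
Proof.
rewrite /hump pw_sym_abs//; have h := powR_ge0 `|z| q.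
have m0 : 0 <= m by apply: le_trans (ltW m_gt1); lra.
rewrite -[leRHS](one_powR m); apply: ge0_ler_powR; rewrite ?nnegrE ?pos_ge0//.
by rewrite /pos ge_max; apply/andP; split; lra.
Qed.

Lemma hump_out (z : R) : 1 <= `|z| -> hump z = 0.
Proof.
move=> z1; rewrite /hump pw_sym_abs// pw_le0E// subr_le0 -(one_powR q).
apply: ge0_ler_powR; rewrite ?nnegrE//.
by apply: le_trans (ltW q_gt1); lra.
Qed.

Lemma hump_in (z : R) : `|z| < 1 -> 0 < hump z.
Proof.
move=> z1; rewrite /hump pw_sym_abs//.
have q0 : 0 < q by exact: lt_trans q_gt1.
have h : `|z| `^ q < 1.
  by rewrite -[ltRHS](one_powR q); apply: gt0_ltr_powR; rewrite ?nnegrE.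
by rewrite pw_ge0E ?powR_gt0 ?subr_gt0// subr_ge0 ltW.
Qed.

Section solution.
Variables (h r y s0 : R).
Hypotheses (h0 : 0 < h) (r0 : 0 < r).

(** The spreading exponent in one dimension. Height falls and width grows by the same factor, so
    mass is conserved. *)
Let g := (2 * p - 2)^-1.
(** The speed of the clock for which a bump of height h and radius r at time s0 solves the equation;
    the matching condition is [rate_id]. *)
Definition rate : R := (2 * p - 2) * c * (h `^ (p - 2) * r `^ (- p)).
Let cl := clock p b rate (age p b s0).

Definition zb (x t : R) : R := (x - y) * r^-1 * cl t `^ (- g).
Definition bar (x t : R) : R := h * cl t `^ (- g) * hump (zb x t).
Definition dbar (x t : R) : R := h * r^-1 * cl t `^ (- (2 * g)) * dhump (zb x t).
(** Both the divergence of the weighted flux and the time derivative of [bar] from s0 on. *)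
Definition jbar (x t : R) : R :=
  h * (- g * rate * wt p b t * cl t `^ (- g - 1)) * (hump (zb x t) + zb x t * dhump (zb x t)).

Lemma rate_gt0 : 0 < rate.
Proof.
have hp := p20; have pp : 0 < p by lra.
have c0 : 0 < c by apply: powR_gt0; exact: divr_gt0.
have e : 0 < 2 * p - 2 by lra.
by apply: mulr_gt0; apply: mulr_gt0 => //; exact: powR_gt0.
Qed.

Let gE : g * (2 * (p - 1)) = 1.
Proof.
have hp := p20; have e : 0 < 2 * p - 2 by lra.
by rewrite /g; field; exact: lt0r_neq0.
Qed.

Let cl_gt0 t : 0 < cl t. Proof. exact: clock_gt0. Qed.

Let rate_id : g * rate * h = c * (h * r^-1) `^ (p - 1) * r^-1.
Proof.
have rn : r != 0 by rewrite gt_eqF.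
have hn : h != 0 by rewrite gt_eqF.
have e1 : (h * r^-1) `^ (p - 1) = h `^ (p - 2) * h * r `^ (- (p - 1)).
  rewrite powRM ?invr_ge0 ?(ltW r0) ?(ltW h0)//; congr (_ * _).
    by rewrite -{3}[h]powRr1 ?(ltW h0)// -powRD ?hn ?implybT//; congr powR; ring.
  by rewrite -(powR_inv1 (ltW r0)) -powRrM mulN1r.
have e2 : r `^ (- p) = r `^ (- (p - 1)) * r^-1.
  by rewrite -(powR_inv1 (ltW r0)) -powRD ?rn ?implybT//; congr powR; ring.
rewrite e1 /rate e2.
have e3 : g * (2 * p - 2) = 1 by rewrite -[RHS]gE; ring.
by transitivity ((g * (2 * p - 2)) * c * (h `^ (p - 2) * (r `^ (- (p - 1)) * r^-1)) * h);
  [ring|rewrite e3; ring].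
Qed.

Let cont2_cl a : cont2 (fun _ t => cl t `^ a).
Proof. by apply: cont2_of_t; exact: clock_powR_continuous. Qed.

Let cont2_zb : cont2 zb.
Proof.
apply: cont2M; last exact: cont2_cl.
apply: cont2M; last exact: cont2_cst.
by move=> z; apply: cvgB; [exact: cvg_fst|exact: cvg_cst].
Qed.

Lemma bar_cont2 : cont2 bar.
Proof.
apply: cont2M; first by apply: cont2M; [exact: cont2_cst|exact: cont2_cl].
by apply: cont2_comp; [exact: hump_continuous|exact: cont2_zb].
Qed.

Lemma dbar_cont2 : cont2 dbar.
Proof.
apply: cont2M; first by apply: cont2M; [exact: cont2_cst|exact: cont2_cl].
by apply: cont2_comp; [exact: dhump_continuous|exact: cont2_zb].
Qed.

Lemma jbar_cont2 : cont2 jbar.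
Proof.
apply: cont2M.
  apply: cont2M; first exact: cont2_cst.
  apply: cont2M; last exact: cont2_cl.
  by apply: cont2M; [exact: cont2_cst|apply: cont2_of_t; exact: wt_continuous].
have hc : cont2 (fun x t => hump (zb x t)) by apply: cont2_comp; [exact: hump_continuous|exact: cont2_zb].
have zc : cont2 (fun x t => zb x t * dhump (zb x t)).
  apply: cont2M; first exact: cont2_zb.
  by apply: cont2_comp; [exact: dhump_continuous|exact: cont2_zb].
by move=> z; apply: cvgD; [exact: hc|exact: zc].
Qed.

Let is_derive_zb (x t : R) : is_derive x 1 (zb ^~ t) (r^-1 * cl t `^ (- g)).
Proof.
have h1 := is_derive1B (is_derive_id x 1) (is_derive_cst y x 1).
have h2 := is_derive1Z (r^-1 * cl t `^ (- g)) h1.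
have E : zb ^~ t = fun x => r^-1 * cl t `^ (- g) * (x - y).
  by apply/funext => w; rewrite /zb; ring.
by rewrite E; apply: is_derive_eq h2 _; rewrite subr0 mulr1.
Qed.

Lemma is_derive_bar (x t : R) : is_derive x 1 (bar ^~ t) (dbar x t).
Proof.
have h1 := @is_derive1_comp R hump (zb ^~ t) x _ _ (is_derive_hump _) (is_derive_zb x t).
have h2 := is_derive1Z (h * cl t `^ (- g)) h1.
apply: is_derive_eq h2 _; rewrite /dbar.
have -> : cl t `^ (- (2 * g)) = cl t `^ (- g) * cl t `^ (- g).
  have cn : cl t != 0 by rewrite gt_eqF ?cl_gt0.
  by rewrite -powRD ?cn ?implybT//; congr powR; ring.
ring.
Qed.

Lemma is_derive_flux_bar (x t : R) :
  is_derive x 1 (fun w => wt p b t * Fp p (dbar w t)) (jbar x t).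
Proof.
have cn : cl t != 0 by rewrite gt_eqF ?cl_gt0.
have hr : 0 <= h * r^-1 by rewrite mulr_ge0 ?invr_ge0 ?ltW.
have E : (fun w => wt p b t * Fp p (dbar w t)) =
   fun w => - c * wt p b t * (h * r^-1) `^ (p - 1) * (cl t)^-1 * (zb w t * hump (zb w t)).
  apply/funext => w; have kk : 0 <= h * r^-1 * cl t `^ (- (2 * g)) by apply: mulr_ge0 => //; exact: powR_ge0.
  rewrite /dbar (FpM p2 _ kk) Fp_dhump.
  rewrite (powRM _ hr (powR_ge0 _ _)) -powRrM.
  have -> : - (2 * g) * (p - 1) = - 1 by rewrite -[in RHS]gE; ring.
  by rewrite powR_inv1 ?(ltW (cl_gt0 t))//; ring.
have h1 := @is_derive1_comp R hump (zb ^~ t) x _ _ (is_derive_hump _) (is_derive_zb x t).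
have h2 := is_derive1M (is_derive_zb x t) h1.
rewrite E; apply: is_derive_eq (is_derive1Z _ h2) _.
have -> : jbar x t = - (g * rate * h) * (wt p b t * cl t `^ (- g - 1)) *
    (hump (zb x t) + zb x t * dhump (zb x t)) by rewrite /jbar; ring.
rewrite rate_id.
have -> : cl t `^ (- g - 1) = cl t `^ (- g) * (cl t)^-1.
  by rewrite -(powR_inv1 (ltW (cl_gt0 t))) -powRD ?cn ?implybT.
rewrite /comp; ring.
Qed.

Lemma bar_subflow lo hi t0 t1 : lo <= hi -> s0 <= t0 ->
  subflow p b lo hi t0 t1 bar dbar.
Proof.
move=> lh st0; exists (fun s t x => itg s t (jbar x)).
  refine (classical_flow (H := bar) (d := dbar) (jx := jbar) p2 _ _ lh _ _ _ _ _).
  - exact: bar_cont2.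
  - exact: dbar_cont2.
  - exact: jbar_cont2.
  - exact: is_derive_bar.
  - exact: is_derive_flux_bar.
move=> s t x t0s st tt1 _.
have cb : continuous (bar x) by exact: cont2_t bar_cont2.
have cj : continuous (jbar x) by exact: cont2_t jbar_cont2.
suff -> : itg s t (jbar x) = bar x t - bar x s by exact: lexx.
refine (@itg_FTC_oo R s t (bar x) (jbar x) (ltW st) cb cj _) => w /andP[sw wt1].
have hw : 1 / 2 < 1 + rate * (age p b w - age p b s0).
  have h1 : 0 <= age p b w - age p b s0.
    by rewrite subr_ge0; apply: age_le => //; exact: le_trans st0 (le_trans t0s (ltW sw)).
  by have h2 := mulr_ge0 (ltW rate_gt0) h1; lra.
have dc := is_derive_clock_powR p2 b0 (- g) hw.
have dz : is_derive w 1 (zb x) ((x - y) * r^-1 * (- g * rate * wt p b w * cl w `^ (- g - 1))).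
  exact: is_derive1Z dc.
have dg := @is_derive1_comp R hump (zb x) w _ _ (is_derive_hump _) dz.
have db := is_derive1M (is_derive1Z h dc) dg.
apply: is_derive_eq db _; rewrite /comp /jbar /zb /cl; ring.
Qed.

Lemma bar_start x : bar x s0 <= h.
Proof.
have c1 : cl s0 = 1 by rewrite /cl /clock subrr mulr0 addr0 max_l//; lra.
by rewrite /bar c1 powR1 mulr1 ler_piMr ?hump_le1// ltW.
Qed.

Lemma bar_start_out (x : R) : r <= `|x - y| -> bar x s0 = 0.
Proof.
have c1 : cl s0 = 1 by rewrite /cl /clock subrr mulr0 addr0 max_l//; lra.
move=> rx; rewrite /bar hump_out ?mulr0// /zb c1 powR1 mulr1 normrM.
by rewrite (ger0_norm (x := r^-1)) ?invr_ge0 ?(ltW r0)// ler_pdivlMr// mul1r.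
Qed.

Lemma bar_out (x t : R) : r * cl t `^ g <= `|x - y| -> bar x t = 0.
Proof.
move=> rx; rewrite /bar hump_out ?mulr0// /zb normrM (ger0_norm (powR_ge0 _ _)) normrM.
rewrite (ger0_norm (x := r^-1)) ?invr_ge0 ?(ltW r0)// powRN.
by rewrite ler_pdivlMr ?powR_gt0// mul1r ler_pdivlMr// mulrC.
Qed.

Lemma bar_in (x t : R) : `|x - y| < r * cl t `^ g -> 0 < bar x t.
Proof.
move=> rx; apply: mulr_gt0; first by apply: mulr_gt0 => //; exact: powR_gt0.
apply: hump_in.
rewrite /zb normrM (ger0_norm (powR_ge0 _ _)) normrM.
rewrite (ger0_norm (x := r^-1)) ?invr_ge0 ?(ltW r0)// powRN.
by rewrite ltr_pdivrMr ?powR_gt0// mul1r ltr_pdivrMr// mulrC.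
Qed.

End solution.
End Barenblatt.

(** * The interface *)

Section Assembly.
Context {R : realType}.
Notation mu := (@lebesgue_measure R).
Variables (p b : R) (T : \bar R) (u0 : R -> R) (u : R -> R -> R).
Hypotheses (p2 : 2 < p) (b0 : b != 0).
Hypothesis hu : cauchy_solution p b 1 T u0 u.

Local Notation age := (age p b).
Let w x t := expR (b * t) * u x t.
Let q := p / (p - 2).

Let p20 : 0 < p - 2. Proof. by rewrite subr_gt0. Qed.
Let q_gt1 : 1 < q. Proof. by rewrite /q ltr_pdivlMr//; lra. Qed.
Let q0 : 0 < q. Proof. exact: lt_trans q_gt1. Qed.

Lemma age_lt s t : s < t -> age s < age t.
Proof.
move=> st; rewrite -subr_gt0 -(itg_FTC (ltW st) (is_derive_age p2 b0) (@wt_continuous R p b)).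
apply: (itg_gt0 (x := (s + t) / 2)); [exact: wt_continuous|by move=> r; exact: ltW (wt_gt0 p b r)|lra|lra|].
exact: wt_gt0.
Qed.

(** Weak solutions are flows only from positive times on, while data are ordered at s0, possibly 0.
    The comparison starts slightly later, where uniform continuity costs a slack k, and k is
    arbitrary. *)
Lemma compare_from s0 t1 lo hi (v1 v2 : R -> R -> R) : 0 <= s0 -> s0 < t1 -> lo < hi ->
  cont2 v1 -> cont2 v2 ->
  (forall s, s0 < s -> s < t1 -> exists d1 d2,
     subflow p b lo hi s t1 v1 d1 /\ superflow p b lo hi s t1 v2 d2) ->
  (forall t, s0 <= t <= t1 -> v1 lo t <= v2 lo t) ->
  (forall t, s0 <= t <= t1 -> v1 hi t <= v2 hi t) ->
  (forall x, lo <= x <= hi -> v1 x s0 <= v2 x s0) ->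
  forall x, lo <= x <= hi -> v1 x t1 <= v2 x t1.
Proof.
move=> s00 st lh c1 c2 fl blo bhi bs x xlh.
apply/ler_addgt0Pr => k k0.
have cD : cont2 (fun x t => v1 x t - v2 x t) by move=> z; apply: cvgB; [exact: c1|exact: c2].
have := cont2_tube lo hi s0 cD k0.
move=> /nbhs_ballP[r /= r0 hr].
(* Close enough to s0 for the slack k, and kept before t1 by the midpoint. *)
pose s := Num.min (s0 + r / 2) ((s0 + t1) / 2).
have ss : s0 < s by rewrite lt_min; apply/andP; split; lra.
have st1 : s < t1 by rewrite gt_min; apply/orP; right; lra.
have sr : s <= s0 + r / 2 by rewrite ge_min lexx.
have [d1 [d2 [f1 f2]]] := fl s ss st1.
have in_s t : s <= t <= t1 -> s0 <= t <= t1.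
  by move=> /andP[a1 a2]; rewrite a2 andbT (le_trans (ltW ss) a1).
apply: (flow_comparison p2 (ltW lh) st1 f1 f2) => //.
- by move=> t /in_s tt; apply: le_trans (blo t tt) _; rewrite lerDl ltW.
- by move=> t /in_s tt; apply: le_trans (bhi t tt) _; rewrite lerDl ltW.
move=> y ylh.
have bl : ball s0 r s by rewrite /ball/= ltr_distlC; apply/andP; split; lra.
have := hr s bl y ylh; have := bs y ylh.
move: (v1 y s) (v2 y s) (v1 y s0) (v2 y s0) => a1 a2 a3 a4 h1.
by rewrite ler_norml => /andP[_ h2]; lra.
Qed.

Lemma weak_flows (lo hi s t1 : R) : lo < hi -> 0 < s -> s < t1 -> (t1%:E < T)%E ->
  exists d K, flow p b lo hi s t1 (reduced b t1 u) d K /\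
    forall r t x, K r t x = reduced b t1 u x t - reduced b t1 u x r.
Proof.
move=> lh s0 st tT; have [d fd] := weak_flow p2 hu lh s0 st tT.
by exists d; eexists; split; [exact: fd|].
Qed.

Lemma weak_subflow (lo hi s t1 : R) : lo < hi -> 0 < s -> s < t1 -> (t1%:E < T)%E ->
  exists d, subflow p b lo hi s t1 (reduced b t1 u) d.
Proof.
move=> lh s0 st tT; have [d [K [fd KE]]] := weak_flows lh s0 st tT.
by exists d, K => // r t x *; rewrite KE.
Qed.

Lemma weak_superflow (lo hi s t1 : R) : lo < hi -> 0 < s -> s < t1 -> (t1%:E < T)%E ->
  exists d, superflow p b lo hi s t1 (reduced b t1 u) d.
Proof.
move=> lh s0 st tT; have [d [K [fd KE]]] := weak_flows lh s0 st tT.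
by exists d, K => // r t x *; rewrite KE.
Qed.

Let reduced_w t1 x t : 0 <= t <= t1 -> reduced b t1 u x t = w x t.
Proof. exact: reduced_id. Qed.

Lemma u_ge0 x t : 0 < t -> (t%:E < T)%E -> 0 <= u x t.
Proof. by move=> t0 tT; have [[_ up _ _ _] _ _] := hu; exact: up. Qed.

Lemma weak_le_super (lo hi t1 : R) (H dH : R -> R -> R) : lo < hi -> 0 < t1 -> (t1%:E < T)%E -> cont2 H ->
  (forall s, 0 < s -> s < t1 -> superflow p b lo hi s t1 H dH) ->
  (forall t, 0 <= t <= t1 -> w lo t <= H lo t) ->
  (forall t, 0 <= t <= t1 -> w hi t <= H hi t) ->
  (forall x, lo <= x <= hi -> w x 0 <= H x 0) ->
  forall x, lo <= x <= hi -> w x t1 <= H x t1.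
Proof.
move=> lh t10 tT cH fH blo bhi b00 x xlh.
have t11 : 0 <= t1 <= t1 by rewrite lexx ltW.
have t00 : 0 <= (0 : R) <= t1 by rewrite lexx ltW.
rewrite -(reduced_w x t11).
refine (@compare_from 0 t1 lo hi (reduced b t1 u) H (lexx _) t10 lh _ cH _ _ _ _ x xlh).
- exact: reduced_cont2 hu _ t10 tT.
- move=> s s0 st; have [d fd] := weak_subflow lh s0 st tT.
  by exists d, dH; split => //; exact: fH.
- by move=> t tt; rewrite reduced_w//; exact: blo.
- by move=> t tt; rewrite reduced_w//; exact: bhi.
- by move=> y yy; rewrite reduced_w//; exact: b00.
Qed.

Lemma sub_le_weak (s0 lo hi t1 : R) (H dH : R -> R -> R) : lo < hi -> 0 <= s0 -> s0 < t1 ->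
  (t1%:E < T)%E -> cont2 H ->
  (forall s, s0 < s -> s < t1 -> subflow p b lo hi s t1 H dH) ->
  (forall t, s0 <= t <= t1 -> H lo t <= w lo t) ->
  (forall t, s0 <= t <= t1 -> H hi t <= w hi t) ->
  (forall x, lo <= x <= hi -> H x s0 <= w x s0) ->
  forall x, lo <= x <= hi -> H x t1 <= w x t1.
Proof.
move=> lh s00 st1 tT cH fH blo bhi b00 x xlh.
have t10 : 0 < t1 by exact: le_lt_trans st1.
have in0 t : s0 <= t <= t1 -> 0 <= t <= t1.
  by move=> /andP[h1 ->]; rewrite (le_trans s00 h1).
have t11 : s0 <= t1 <= t1 by rewrite lexx ltW.
have t00 : s0 <= s0 <= t1 by rewrite lexx ltW.
rewrite -(reduced_w x (in0 _ t11)).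
refine (@compare_from s0 t1 lo hi H (reduced b t1 u) s00 st1 lh cH _ _ _ _ _ x xlh).
- exact: reduced_cont2 hu _ t10 tT.
- move=> s ss st; have [d fd] := weak_superflow lh (le_lt_trans s00 ss) st tT.
  by exists dH, d; split => //; exact: fH.
- by move=> t tt; rewrite reduced_w ?in0//; exact: blo.
- by move=> t tt; rewrite reduced_w ?in0//; exact: bhi.
- by move=> y yy; rewrite reduced_w ?in0//; exact: b00.
Qed.

Lemma small_age (k : R) : 0 <= k -> exists2 delta, 0 < delta & forall t, t <= delta -> k * age t < 1 / 2.
Proof.
move=> k0; have c0 : continuous (fun t => k * age t).
  by move=> t; apply: cvgM; [exact: cvg_cst|exact: age_continuous].
have e4 : 0 < 1 / 4 :> R by lra.
have /cvgrPdist_le /(_ _ e4) := c0 0; rewrite age0 mulr0.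
move=> /nbhs_ballP[r /= r0 hr]; exists (r / 2); first by rewrite divr_gt0.
move=> t tr; have bl : ball 0 r (r / 2).
  by rewrite /ball/= sub0r normrN ger0_norm; [lra|rewrite divr_ge0// ltW].
have := hr _ bl; rewrite /= sub0r normrN => h1.
have h2 : k * age t <= k * age (r / 2) by rewrite ler_wpM2l// age_le.
by have h3 := ler_norm (k * age (r / 2)); lra.
Qed.

Lemma cusp_le_sep (s A B x0 k x t : R) : p / (p - 2) <= s -> 0 <= A -> 0 <= B -> 0 <= k -> 0 <= t ->
  cusp s A B x0 x <= sep p b s A B x0 k x t.
Proof.
move=> hs A0 B0 k0 t0; rewrite /sep ler_peMl//.
  by rewrite addr_ge0 ?mulr_ge0 ?pw_ge0.
have h : 0 <= k * age t by rewrite mulr_ge0// age_ge0.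
have [c0 c1] : 0 < clock p b (- k) 0 t /\ clock p b (- k) 0 t <= 1.
  by split; [exact: clock_gt0|rewrite /clock ge_max; apply/andP; split; lra].
rewrite powRN invf_ge1 ?powR_gt0//.
have E : 1 `^ (p - 2)^-1 = 1 :> R by rewrite powR1.
rewrite -[leRHS]E.
by apply: ge0_ler_powR; rewrite ?nnegrE// ?(ltW c0)// invr_ge0 ltW.
Qed.

Lemma cusp_at_center (s M x0 x : R) : p / (p - 2) <= s -> cusp s M M x0 x = M * `|x - x0| `^ s.
Proof.
move=> hs; rewrite /cusp -mulrDr pw_sym_abs// gt_eqF//.
by apply: lt_le_trans hs; exact: q0.
Qed.

(** For the exponent q = p/(p-2) the flux derivative of M |x - x0|^q is a multiple of |x - x0|^q on
    the whole line, so k and delta depend on M but neither on x0 nor on rho. The barrier is 0 at its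
    centre at all times. *)
Lemma vanish M : 0 < M -> exists2 delta, 0 < delta &
  forall x0 rho t1, 0 < rho -> 0 < t1 -> t1 <= delta -> (t1%:E < T)%E ->
  (forall t, 0 <= t <= t1 -> w (x0 - rho) t <= M * rho `^ q) ->
  (forall t, 0 <= t <= t1 -> w (x0 + rho) t <= M * rho `^ q) ->
  (forall y, x0 - rho <= y <= x0 + rho -> u0 y <= M * `|y - x0| `^ q) ->
  u x0 t1 = 0.
Proof.
move=> M0; have M0' := ltW M0; have hq := q_gt1; have hp := p20.
pose m := (q - 1) * (p - 1).
have m1 : m - 1 = q by rewrite /m /q; field; rewrite gt_eqF.
have m0 : 0 < m by lra.
(* The solution of k/(p-2) M = m (M q)^(p-1), with equality in the stationary inequality. *)
pose k := (p - 2) * (m * (M * q) `^ (p - 1) / M).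
have k0 : 0 <= k.
  by rewrite mulr_ge0 ?(ltW p20)// divr_ge0 ?(ltW M0)// mulr_ge0 ?powR_ge0// ltW.
have [delta d0 hd] := small_age k0; exists delta => // x0 rho t1 r0 t10 t1d tT bl br bi.
have qq : p / (p - 2) <= q by [].
have lh : x0 - rho < x0 + rho by lra.
have cst x : x0 - rho <= x <= x0 + rho -> x0 - rho <= x <= x0 + rho -> True by [].
have bound y t : `|y - x0| = rho -> 0 <= t <= t1 -> w y t <= M * rho `^ q ->
    w y t <= sep p b q M M x0 k y t.
  move=> yr /andP[t0 _] h; apply: le_trans h (le_trans _ (cusp_le_sep _ _ qq _ _ k0 t0)) => //.
  by rewrite cusp_at_center// yr.
have := @weak_le_super (x0 - rho) (x0 + rho) t1 (sep p b q M M x0 k) (dsep p b q M M x0 k) lh t10 tT.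
move=> /(_ _ _ _ _ _ x0 _) cmp.
have : w x0 t1 <= sep p b q M M x0 k x0 t1.
  apply: cmp.
  (* The rectangle is arbitrary; only the continuity of the barrier is extracted. *)
  - exact: flow_cont (sep_flow p2 b0 x0 qq M0' M0' k 0 1 (lexx 0)).
  - move=> s s0 st; apply: (sep_superflow p2 b0 qq M0' M0' (ltW lh)).
      by move=> t /andP[_ tt]; apply: hd; exact: le_trans tt t1d.
    move=> x _; rewrite /dflux_cusp -/m m1 -mulrDr le_eqVlt; apply/orP; left; apply/eqP.
    by rewrite /cusp -mulrDr /k; field; rewrite !gt_eqF.
  - move=> t tt; apply: bound => //; last exact: bl.
    by rewrite (_ : x0 - rho - x0 = - rho) ?normrN ?gtr0_norm//; ring.
  - move=> t tt; apply: bound => //; last exact: br.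
    by rewrite (_ : x0 + rho - x0 = rho) ?gtr0_norm//; ring.
  - move=> y yy; apply: le_trans (cusp_le_sep _ _ qq M0' M0' k0 (lexx 0)).
    have [_ _ ui] := hu.
    by rewrite cusp_at_center// /w mulr0 expR0 mul1r ui; exact: bi.
  - by apply/andP; split; lra.
rewrite /sep cusp_at_center// subrr normr0 powR0 ?gt_eqF ?q0// !mulr0 => wle.
apply/eqP; rewrite eq_le u_ge0// andbT.
by move: wle; rewrite /w pmulr_rle0 ?expR_gt0.
Qed.

Section initial_data.
Variables (alpha C : R).
Hypotheses (halpha : p / (p - 2) < alpha) (hC : 0 < C) (hT : (0 < T)%E).
Hypothesis u0_ge0 : forall x, 0 <= u0 x.
Hypothesis u0_cont : continuous u0.
Hypothesis u0_supp : ereal_sup [set x%:E | x in [set x | 0 < u0 x]] = 0%E.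
Hypothesis u0_asymp : u0 x / (C * (- x) `^ alpha) @[x --> 0^'-] --> (1 : R).

Let w0 x : w x 0 = u0 x.
Proof. by have [_ _ ui] := hu; rewrite /w mulr0 expR0 mul1r ui. Qed.

Lemma u0_right (x : R) : 0 <= x -> u0 x = 0.
Proof.
have pos_zero (y : R) : 0 < y -> u0 y = 0.
  move=> y0; apply/eqP; rewrite eq_le u0_ge0 andbT leNgt; apply/negP => uy.
  have : (y%:E <= ereal_sup [set x%:E | x in [set x | (0 < u0 x)%R]])%E.
    by apply: ereal_sup_ubound; exists y.
  by rewrite u0_supp lee_fin leNgt y0.
rewrite le_eqVlt => /predU1P[<-|]; last exact: pos_zero.
have : u0 @ 0^'+ --> u0 0 by apply: cvg_at_right_filter; exact: u0_cont.
have : u0 @ 0^'+ --> (0 : R).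
  apply: cvg_near_cst; near=> y; apply: pos_zero; near: y; exact: nbhs_right_gt.
by move=> h1 h2; exact: (cvg_unique _ h2 h1).
Unshelve. all: by end_near. Qed.

Lemma u0_left eta : 0 < eta -> exists2 r, 0 < r & forall x, - r < x -> x < 0 ->
  (C - eta) * (- x) `^ alpha <= u0 x <= (C + eta) * (- x) `^ alpha.
Proof.
move=> eta0; have e0 : 0 < eta / C by rewrite divr_gt0.
move/cvgrPdist_le : u0_asymp => /(_ _ e0).
rewrite near_withinE => /nbhs_ballP[r /= r0 hr]; exists r => // x xr x0.
have bl : ball 0 r x by rewrite /ball/= sub0r normrN ltr0_norm//; lra.
have := hr x bl x0.
have y0 : 0 < (- x) `^ alpha by rewrite powR_gt0 ?oppr_gt0.
have z0 : 0 < C * (- x) `^ alpha by rewrite mulr_gt0.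
rewrite distrC ler_distl => /andP[].
rewrite ler_pdivlMr// ler_pdivrMr// => h1 h2.
have e1 : eta / C * (C * (- x) `^ alpha) = eta * (- x) `^ alpha.
  by field; rewrite gt_eqF.
by move: h1 h2; rewrite mulrBl mulrDl e1 => h1 h2; apply/andP; split; lra.
Qed.

Lemma horizon : exists2 tau : R, 0 < tau & (tau%:E < T)%E.
Proof.
move: hT; case: T => [r||]//=.
  by rewrite lte_fin => r0; exists (r / 2); [rewrite divr_gt0|rewrite lte_fin; lra].
by move=> _; exists 1; [|exact: ltry].
Qed.

Lemma origin_vanish : exists2 delta, 0 < delta & (delta%:E < T)%E /\
  forall t, 0 <= t <= delta -> u 0 t = 0.
Proof.
have [tau tau0 tauT] := horizon.
(* The tolerance eta = C gives u0 <= 2 C (-x)^alpha near 0. On distances at most 1 this is below 2 C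
   |x|^q, as alpha > q. *)
have [r r0 hr] := u0_left hC.
pose rho := Num.min (r / 2) 1.
have rho0 : 0 < rho by rewrite lt_min; apply/andP; split; lra.
have rho1 : rho <= 1 by rewrite ge_min lexx orbT.
have rhor : rho < r by rewrite gt_min; apply/orP; left; lra.
have [S [S0 hS]] := cont2_bound (- rho) rho 0 tau (reduced_cont2 hu tau0 tauT).
(* The first term dominates the initial data, the second the lateral values, which are at most S. *)
pose M := 2 * C + S / rho `^ q.
have rq : 0 < rho `^ q by rewrite powR_gt0.
have Sr : 0 < S / rho `^ q by rewrite divr_gt0.
have M0 : 0 < M by rewrite addr_gt0// mulr_gt0.
have [delta d0 hd] := vanish M0.
exists (Num.min delta tau); first by rewrite lt_min d0.
have dT : ((Num.min delta tau)%:E < T)%E by apply: le_lt_trans tauT; rewrite lee_fin ge_min lexx orbT.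
split => // t /andP[]; rewrite le_eqVlt => /predU1P[<- _|t0].
  by have [_ _ ui] := hu; rewrite ui u0_right.
rewrite le_min => /andP[td ttau].
have SM : S <= M * rho `^ q.
  by rewrite /M mulrDl divfK ?gt_eqF// lerDr mulr_ge0// ltW// mulr_gt0.
have lat x s : `|x| = rho -> 0 <= s <= t -> w x s <= M * rho `^ q.
  move=> xr /andP[s0 st]; apply: le_trans SM.
  have ss : 0 <= s <= tau by rewrite s0 (le_trans st ttau).
  rewrite -(reduced_w x ss); apply: le_trans (ler_norm _) _; apply: hS => //.
  by rewrite -ler_norml xr.
apply: (hd 0 rho t) => //.
- by apply: le_lt_trans tauT; rewrite lee_fin.
- by move=> s ss; apply: lat => //; rewrite sub0r normrN gtr0_norm.
- by move=> s ss; apply: lat => //; rewrite add0r gtr0_norm.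
move=> y /andP[y1 y2]; rewrite subr0.
have [y0|y0] := leP 0 y; first by rewrite u0_right// mulr_ge0 ?powR_ge0// ltW.
have yr : - r < y by lra.
have /andP[_ h] := hr y yr y0; apply: le_trans h _.
have yn : 0 < - y by lra.
have CM : C + C <= M by rewrite /M mulr_natl mulr2n lerDl ltW.
have CC : 0 <= C + C by rewrite addr_ge0// ltW.
have yq : (- y) `^ alpha <= (- y) `^ q.
  by apply: ger_powR; [apply/andP; split; lra|exact: ltW].
by rewrite ltr0_norm//; exact: (ler_pM CC (powR_ge0 _ _) CM yq).
Qed.

Section after_origin.
Variable d1 : R.
Hypotheses (d10 : 0 < d1) (d1T : (d1%:E < T)%E).
Hypothesis u_origin : forall t, 0 <= t <= d1 -> u 0 t = 0.

Let ltT t : t <= d1 -> (t%:E < T)%E.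
Proof. by move=> td; apply: le_lt_trans d1T; rewrite lee_fin. Qed.

Let w_origin t : 0 <= t <= d1 -> w 0 t = 0.
Proof. by move=> tt; rewrite /w u_origin// mulr0. Qed.

Lemma w_ge0 x t : 0 <= t -> t <= d1 -> 0 <= w x t.
Proof.
rewrite le_eqVlt => /predU1P[<- _|t0 td]; first by rewrite w0.
by rewrite /w mulr_ge0 ?expR_ge0// u_ge0// ltT.
Qed.

(* Reflection across the midpoint of x and y. *)
Lemma w_mono t x y : 0 < t -> t <= d1 -> 0 <= x -> x <= y -> w x t <= w y t.
Proof.
move=> t0 td x0; rewrite le_eqVlt => /predU1P[->//|xy].
pose L := (x + y) / 2.
have L0 : 0 < L by rewrite divr_gt0//; lra.
have xL : 0 <= x <= L by apply/andP; split => //; rewrite /L; lra.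
have tT := ltT td.
have tt : 0 <= t <= t by rewrite lexx ltW.
have cv := reduced_cont2 hu t0 tT.
have cr := @cont2_reflect R (2 * L) (reduced b t u) cv.
have E : 2 * L - x = y by rewrite /L; field.
rewrite -E -(reduced_w x tt) -(reduced_w (2 * L - x) tt).
(* On [0, L] the function is compared with its mirror image: on the left it is 0, at L the two
   agree, and initially both vanish or the image is nonnegative. *)
refine (@compare_from 0 t 0 L (reduced b t u) (fun x t0 => reduced b t u (2 * L - x) t0) (lexx _) t0 L0 cv cr _ _ _ _ x xL).
- move=> s s0 st.
  have [e1 f1] := weak_subflow L0 s0 st tT.
  have LL : L < 2 * L by lra.
  have [e2 [K [f2 KE]]] := weak_flows LL s0 st tT.
  exists e1; eexists; split; first exact: f1.
  eexists; first by have := flow_reflect p2 (2 * L) (ltW LL) f2; rewrite subrr (_ : 2 * L - L = L); [exact: id|ring].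
  by move=> s' t' z _ _ _ _; have := KE s' t' (2 * L - z); rewrite /= => ->; exact: lexx.
- move=> s /andP[s0 st]; have ss : 0 <= s <= t by rewrite s0.
  rewrite !reduced_w// w_origin ?w_ge0//; first exact: le_trans td.
  by rewrite s0 (le_trans st td).
- by move=> s _; rewrite (_ : 2 * L - L = L)//; ring.
- move=> z /andP[z0 _]; have ss : 0 <= (0 : R) <= t by rewrite lexx ltW.
  rewrite !reduced_w// w0 u0_right// w_ge0//; exact: ltW.
Qed.

(* If w(x, s) is large compared with x^(p/(p-2)), a Barenblatt solution centred
   at 2 x and started below w at time s reaches the origin before time d1. *)
Lemma growth_bound : exists2 K, 0 < K &
  forall x s, 0 < x -> 0 <= s -> s <= d1 / 2 -> w x s <= K * x `^ q.
Proof.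
pose c := (p / (p - 2)) `^ (p - 1).
have hp := p20; have hq := q0; have hd1 := d10.
have c0 : 0 < c by apply: powR_gt0; exact: q0.
have p22 : 0 < 2 * p - 2 by lra.
have A0 : 0 < age d1 - age (d1 / 2) by rewrite subr_gt0; apply: age_lt; lra.
(* If the radius, starting from x, has not passed 2 x by time d1, then rate (A(d1) - A(d1/2)) <=
   2^(2p-2). With rate = (2p-2) c h^(p-2) x^(-p) this reads h^(p-2) <= Q x^p. The restriction s <=
   d1/2 leaves a fixed time for spreading. *)
pose Q := 2 `^ (2 * p - 2) / (age d1 - age (d1 / 2)) / ((2 * p - 2) * c).
have Q0 : 0 < Q by rewrite !divr_gt0 ?mulr_gt0 ?powR_gt0.
exists (Q `^ (p - 2)^-1); first exact: powR_gt0.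
move=> x s x0 s0 sd.
have [h0|h0] := leP (w x s) 0.
  by apply: le_trans h0 _; rewrite mulr_ge0 ?powR_ge0.
have sp : 0 < s.
  move: s0; rewrite le_eqVlt => /predU1P[s0|//].
  by move: h0; rewrite -s0 w0 u0_right ?ltxx// ltW.
set h := w x s in h0 *.
have sd1 : s < d1 by lra.
pose cl := clock p b (rate p h x) (age s).
pose g := (2 * p - 2)^-1.
pose rho := cl d1 `^ g.
have cl0 t : 0 < cl t by exact: clock_gt0.
have r0 : 0 < rate p h x by exact: rate_gt0.
have g0 : 0 < g by rewrite invr_gt0.
(* Wide enough to contain the origin and the support of the Barenblatt solution up to time d1. *)
pose L := x * (2 + rho).
have rho0 : 0 <= rho by exact: powR_ge0.
have L2 : 2 * x <= L by rewrite /L mulrC ler_wpM2l ?(ltW x0)//; lra.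
have Lr : x * rho <= L by rewrite /L ler_wpM2l ?(ltW x0)//; lra.
have lh : 2 * x - L < 2 * x + L by lra.
have in0 : 2 * x - L <= 0 <= 2 * x + L by apply/andP; split; lra.
have out z t : `|z - 2 * x| = L -> s <= t <= d1 -> bar p b h x (2 * x) s z t <= w z t.
  move=> zL /andP[st td]; rewrite (bar_out p2)//; first by rewrite w_ge0// (le_trans (ltW sp)).
  rewrite zL; refine (le_trans (ler_wpM2l (ltW x0) _) Lr).
  apply: ge0_ler_powR; rewrite ?nnegrE ?(ltW (cl0 _)) ?(ltW g0)//.
  rewrite /cl /clock ge_max !le_max lexx orbT andbT; apply/orP; left.
  by rewrite lerD2l ler_wpM2l ?(ltW r0)// lerD2r; exact: age_le.
have : bar p b h x (2 * x) s 0 d1 <= w 0 d1.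
  refine (@sub_le_weak s (2 * x - L) (2 * x + L) d1 (bar p b h x (2 * x) s)
    (dbar p b h x (2 * x) s) lh s0 sd1 d1T _ _ _ _ _ 0 in0).
  - exact: bar_cont2.
  - by move=> s' ss' _; exact: (bar_subflow p2 b0 (2 * x) h0 x0 d1 (ltW lh) (ltW ss')).
  - move=> t; apply: out.
    by rewrite (_ : 2 * x - L - 2 * x = - L) ?normrN ?gtr0_norm//; [lra|ring].
  - move=> t; apply: out.
    by rewrite (_ : 2 * x + L - 2 * x = L) ?gtr0_norm//; [lra|ring].
  (* Inside the initial support one has z > x, so monotonicity of w gives w(z, s) >= w(x, s) = h,
     the maximal height of the bump. *)
  move=> z _; have [zx|zx] := leP x `|z - 2 * x|.
    by rewrite (bar_start_out b p2 h s x0 zx) w_ge0// ltW.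
  apply: le_trans (bar_start b p2 x (2 * x) s h0 z) _.
  apply: w_mono => //; [exact: ltW|exact: ltW|].
  by move: zx; rewrite ltr_norml => /andP[h1 _]; lra.
rewrite w_origin ?lexx ?(ltW d10)// => bar0.
have rho2 : rho <= 2.
  (* A radius x rho > 2 x would make the subsolution positive at the origin, where w vanishes. *)
  rewrite leNgt; apply/negP => rho2.
  have lt0 : `|0 - 2 * x| < x * cl d1 `^ (2 * p - 2)^-1.
    by rewrite sub0r normrN gtr0_norm ?mulr_gt0// mulrC ltr_pM2l.
  have bp : 0 < bar p b h x (2 * x) s 0 d1 := bar_in p2 h0 x0 lt0.
  by move: (lt_le_trans bp bar0); rewrite ltxx.
have cl2 : cl d1 <= 2 `^ (2 * p - 2).
  have -> : cl d1 = rho `^ (2 * p - 2).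
    by rewrite /rho -powRrM mulVf ?gt_eqF// powRr1// ltW.
  by apply: ge0_ler_powR; rewrite ?nnegrE ?(ltW p22).
have ra : rate p h x * (age d1 - age (d1 / 2)) <= 2 `^ (2 * p - 2).
  apply: le_trans cl2; rewrite /cl /clock le_max; apply/orP; left.
  have : rate p h x * (age d1 - age (d1 / 2)) <= rate p h x * (age d1 - age s).
    by rewrite ler_wpM2l ?(ltW r0)// lerB// age_le.
  lra.
have hx : h `^ (p - 2) <= Q * x `^ p.
  have E : h `^ (p - 2) = rate p h x * (x `^ p / ((2 * p - 2) * c)).
    rewrite /rate -/c powRN; field.
    by rewrite !gt_eqF ?powR_gt0.
  rewrite E /Q.
  have -> : 2 `^ (2 * p - 2) / (age d1 - age (d1 / 2)) / ((2 * p - 2) * c) * x `^ p =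
    2 `^ (2 * p - 2) / (age d1 - age (d1 / 2)) * (x `^ p / ((2 * p - 2) * c)) by ring.
  apply: ler_wpM2r; first by rewrite divr_ge0 ?powR_ge0// mulr_ge0// ltW.
  by rewrite ler_pdivlMr.
have -> : h = (h `^ (p - 2)) `^ (p - 2)^-1.
  by rewrite -powRrM mulfV ?gt_eqF// powRr1// ltW.
have -> : Q `^ (p - 2)^-1 * x `^ q = (Q * x `^ p) `^ (p - 2)^-1.
  by rewrite powRM ?(ltW Q0) ?powR_ge0// -powRrM.
apply: ge0_ler_powR; rewrite ?nnegrE ?powR_ge0 ?invr_ge0 ?(ltW p20)//.
by rewrite mulr_ge0 ?powR_ge0// ltW.
Qed.

Lemma right_vanish : exists2 delta, 0 < delta <= d1 &
  forall x t, 0 <= x -> 0 <= t <= delta -> u x t = 0.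
Proof.
have [K K0 hK] := growth_bound; have hq := q0; have hd1 := d10.
(* The barrier centred at x has radius x: its left end is the origin, where w = 0, and at its right
   end w <= K (2 x)^q. This amplitude does not depend on x. *)
have M0 : 0 < K * 2 `^ q by rewrite mulr_gt0 ?powR_gt0.
have [delta d0 hd] := vanish M0.
exists (Num.min delta (d1 / 2)).
  by apply/andP; split; [rewrite lt_min d0 divr_gt0|rewrite ge_min; apply/orP; right; lra].
move=> x t x0 /andP[t0]; rewrite le_min => /andP[td td1].
have td' : t <= d1 by lra.
move: t0; rewrite le_eqVlt => /predU1P[<-|t0].
  by have [_ _ ui] := hu; rewrite ui u0_right.
move: x0; rewrite le_eqVlt => /predU1P[<-|x0].
  by apply: u_origin; rewrite (ltW t0).
apply: (hd x x t) => //.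
- exact: ltT.
- move=> s /andP[s0 st]; rewrite subrr w_origin ?mulr_ge0 ?powR_ge0// ?(ltW K0)//.
  by rewrite s0 (le_trans st td').
- move=> s /andP[s0 st].
  have x2 : 0 < 2 * x by rewrite mulr_gt0.
  have -> : x + x = 2 * x by ring.
  have := hK (2 * x) s x2 s0 (le_trans st td1).
  by rewrite powRM ?(ltW x0)// mulrA.
- move=> y /andP[y0 _]; rewrite u0_right; last by move: y0; rewrite subrr.
  by rewrite mulr_ge0 ?powR_ge0// ltW.
Qed.

End after_origin.

End initial_data.

End Assembly.

(** * The two-sided bound left of the interface *)

Section Conclusion.
Context {R : realType}.
Variables (p b : R) (T : \bar R) (u0 : R -> R) (u : R -> R -> R).
Hypotheses (p2 : 2 < p) (b0 : b != 0).
Hypothesis hu : cauchy_solution p b 1 T u0 u.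
Variables (alpha C : R).
Hypotheses (halpha : p / (p - 2) < alpha) (hC : 0 < C) (hT : (0 < T)%E).
Hypothesis u0_ge0 : forall x, 0 <= u0 x.
Hypothesis u0_cont : continuous u0.
Hypothesis u0_supp : ereal_sup [set x%:E | x in [set x | 0 < u0 x]] = 0%E.
Hypothesis u0_asymp : u0 x / (C * (- x) `^ alpha) @[x --> 0^'-] --> (1 : R).

Let w x t := expR (b * t) * u x t.

Lemma pwD (s t y : R) : 0 < s -> 0 < t -> pw (s + t) y = pw s y * pw t y.
Proof.
move=> s0 t0; have st : s + t != 0 by rewrite gt_eqF// addr_gt0.
by rewrite /pw powRD// (negbTE st).
Qed.

(** The ratio of the two sides is a constant times (-x)^(alpha(p-2) - p), a positive power, so every
    k > 0 is admissible on a short enough interval. *)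
Lemma near_cusp_super k B : 0 < k -> 0 < B -> exists2 r, 0 < r & forall x, - r < x -> x <= 0 ->
  dflux_cusp p alpha 0 B 0 x <= k / (p - 2) * cusp alpha 0 B 0 x.
Proof.
move=> k0 B0; have hp := p2; have ha := halpha.
have p20 : 0 < p - 2 by lra.
have al0 : 0 < alpha by apply: lt_trans ha; rewrite divr_gt0//; lra.
have al1 : 1 < alpha by apply: lt_trans ha; rewrite ltr_pdivlMr//; lra.
pose m := (alpha - 1) * (p - 1).
have ma : 0 < m - 1 - alpha.
  move: ha; rewrite ltr_pdivrMr// => h.
  by rewrite (_ : m - 1 - alpha = alpha * (p - 2) - p) ?subr_gt0// /m; ring.
have m0 : 0 < m by lra.
have Ba : 0 < (B * alpha) `^ (p - 1) by rewrite powR_gt0// mulr_gt0.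
have mB : 0 < m * (B * alpha) `^ (p - 1) by rewrite mulr_gt0.
have e0 : 0 < k / (p - 2) * B / (m * (B * alpha) `^ (p - 1)) 
  by apply: divr_gt0 => //; apply: mulr_gt0 => //; exact: divr_gt0.
have /nbhs_ballP[r /= r0 hr] := pw_small ma e0; exists r => // x xr x0.
have bl : ball 0 r (- x) by rewrite /ball/= sub0r !normrN ler0_norm//; lra.
have := hr _ bl; rewrite /= ler_pdivlMr// => h.
rewrite /dflux_cusp /cusp subr0 !mul0r add0r powR0; last by rewrite gt_eqF//; lra.
rewrite mul0r add0r -/m (_ : m - 1 = alpha + (m - 1 - alpha)); last by ring.
rewrite pwD//.
have -> : m * ((B * alpha) `^ (p - 1) * (pw alpha (- x) * pw (m - 1 - alpha) (- x))) =
  pw alpha (- x) * (pw (m - 1 - alpha) (- x) * (m * (B * alpha) `^ (p - 1))) by ring.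
rewrite (_ : k / (p - 2) * (B * pw alpha (- x)) = pw alpha (- x) * (k / (p - 2) * B)); last by ring.
by rewrite ler_wpM2l// pw_ge0.
Qed.

Lemma interface_bounds eps : 0 < eps -> exists x_eps delta_eps : R,
  [/\ x_eps < 0, 0 < delta_eps, (delta_eps%:E < T)%E &
      forall x t : R, x_eps < x -> 0 <= t <= delta_eps ->
        (C - eps) * pw alpha (- x) <= w x t /\
        w x t <= (C + eps) * pw alpha (- x) *
          (1 - eps * (p - 2) `^ (1 - p) * age p b t) `^ (- (p - 2)^-1)].
Proof.
move=> eps0; have hp := p2; have ha := halpha; have hc := hC.
have p20 : 0 < p - 2 by lra.
have al0 : 0 < alpha by apply: lt_trans ha; rewrite divr_gt0//; lra.
have qa : p / (p - 2) <= alpha by exact: ltW.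
have [d1 d10 [d1T uo]] := origin_vanish p2 b0 hu halpha hC hT u0_ge0 u0_cont u0_supp u0_asymp.
have [d2 /andP[d20 d21] right0] := right_vanish p2 b0 hu u0_ge0 u0_cont u0_supp d10 d1T uo.
(* Half of eps covers the asymptotics of u0, the other half the change of w(-r, t) in time along the
   left side. *)
have eps2 : 0 < eps / 2 by rewrite divr_gt0.
have [r1 r10 hr1] := u0_left hC u0_asymp eps2.
(* Chosen to match the stated bound: [age] contributes 1 / (b (p-2)), which completes the factor to
   eps b^(-1) (p-2)^(-p). *)
pose k := eps * (p - 2) `^ (1 - p).
have k0 : 0 < k by rewrite mulr_gt0// powR_gt0.
have B0 : 0 < C + eps by rewrite addr_gt0.
have [r2 r20 hr2] := near_cusp_super k0 B0.
pose r := Num.min r1 r2 / 2.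
have rm0 : 0 < Num.min r1 r2 by rewrite lt_min r10.
have r0 : 0 < r by rewrite divr_gt0.
have rr1 : r < r1.
  have : Num.min r1 r2 <= r1 by rewrite ge_min lexx.
  by rewrite /r; lra.
have rr2 : r < r2.
  have : Num.min r1 r2 <= r2 by rewrite ge_min lexx orbT.
  by rewrite /r; lra.
have w0 x : w x 0 = u0 x by have [_ _ ui] := hu; rewrite /w mulr0 expR0 mul1r ui.
have ra : 0 < r `^ alpha by rewrite powR_gt0.
have cv := reduced_cont2 hu d10 d1T.
have er : 0 < eps / 2 * r `^ alpha by rewrite mulr_gt0.
have [d3 d30 hd3] : exists2 d3, 0 < d3 & forall t, 0 <= t <= d1 -> t <= d3 ->
    `|w (- r) t - u0 (- r)| <= eps / 2 * r `^ alpha.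
  have := @cont2_t R _ (- r) cv 0; move=> /cvgrPdist_le /(_ _ er) /nbhs_ballP[s /= s0 hs].
  exists (s / 2); first by rewrite divr_gt0.
  move=> t tt ts; have /andP[t0 _] := tt.
  have bl : ball 0 s t by rewrite /ball/= sub0r normrN ger0_norm//; lra.
  have := hs t bl; rewrite /= !reduced_id//; last by rewrite lexx ltW.
  by rewrite -/(w (- r) 0) w0 distrC.
have [d4 d40 hd4] := small_age p2 b0 (ltW k0).
pose delta := Num.min (Num.min d2 d3) d4.
have delta0 : 0 < delta by rewrite !lt_min d20 d30.
have dd2 : delta <= d2 by rewrite !ge_min lexx.
have dd3 : delta <= d3 by rewrite !ge_min lexx !orbT.
have dd4 : delta <= d4 by rewrite !ge_min lexx !orbT.
exists (- r), delta; split => //; first by rewrite oppr_lt0.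
  by apply: le_lt_trans d1T; rewrite lee_fin (le_trans dd2).
move=> x t xr /andP[t0 td].
have pw0 y : 0 <= y -> pw alpha (- y) = 0 by move=> y0; rewrite pw_le0E ?oppr_le0// gt_eqF.
have [x0|x0] := leP 0 x.
  by rewrite pw0// /w right0 ?t0 ?(le_trans td dd2)// !mulr0 mul0r.
have init y : - r <= y <= 0 -> (C - eps) * pw alpha (- y) <= u0 y <= (C + eps) * pw alpha (- y).
  move=> /andP[yr]; rewrite le_eqVlt => /predU1P[->|y0].
    by rewrite pw0// !mulr0 (u0_right u0_ge0 u0_cont u0_supp)// lexx.
  have yr1 : - r1 < y by lra.
  have /andP[h1 h2] := hr1 y yr1 y0.
  have y0' : 0 <= - y by lra.
  rewrite pw_ge0E//; have h := mulr_ge0 (ltW eps2) (powR_ge0 (- y) alpha).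
  by apply/andP; split; move: h1 h2 h; move: ((- y) `^ alpha) => Y; lra.
have left s : 0 <= s <= t -> (C - eps) * pw alpha (- - r) <= w (- r) s <= (C + eps) * pw alpha (- - r).
  move=> /andP[s0 st].
  have sd : s <= delta by exact: le_trans td.
  have ss : 0 <= s <= d1 by rewrite s0 (le_trans sd (le_trans dd2 d21)).
  have := hd3 s ss (le_trans sd dd3); rewrite ler_norml => /andP[h3 h4].
  have nr0 : - r < 0 by rewrite oppr_lt0.
  have nr1 : - r1 < - r by rewrite ltrN2.
  have := hr1 (- r) nr1 nr0; rewrite opprK => /andP[h1 h2].
  rewrite pw_ge0E ?(ltW r0)//.
  by apply/andP; split; move: h1 h2 h3 h4; move: (r `^ alpha) (w (- r) s) => Y W; lra.
have xx : - r <= x <= 0 by rewrite !ltW.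
have nr0 : - r < 0 by rewrite oppr_lt0.
have cuspE D y : cusp alpha 0 D 0 y = D * pw alpha (- y).
  by rewrite /cusp subr0 mul0r add0r.
(* At t = 0 the bounds are those on u0; the comparison lemmas need t > 0. *)
move: t0; rewrite le_eqVlt => /predU1P[<-|t0].
  rewrite w0 age0 mulr0 subr0 powR1 mulr1.
  by have /andP[] := init x xx.
have tT : (t%:E < T)%E.
  by apply: le_lt_trans d1T; rewrite lee_fin (le_trans td (le_trans dd2 d21)).
have w_orig s : 0 <= s <= t -> w 0 s = 0.
  move=> /andP[s0 st]; rewrite /w uo ?mulr0// s0/=.
  exact: le_trans st (le_trans td (le_trans dd2 d21)).
split.
  (* A stationary cusp needs a nonnegative amplitude; otherwise the lower bound is at most 0 and w
     >= 0 suffices. *)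
  have [Ce|Ce] := leP (C - eps) 0.
    apply: (@le_trans _ _ 0); first by rewrite mulr_le0_ge0// pw_ge0.
    by rewrite /w mulr_ge0 ?expR_ge0// (u_ge0 hu).
  rewrite -cuspE.
  refine (@sub_le_weak R p b T u0 u p2 hu 0 (- r) 0 t (fun x _ => cusp alpha 0 (C - eps) 0 x)
    (fun x _ => dcusp alpha 0 (C - eps) 0 x) nr0 (lexx 0) t0 tT _ _ _ _ _ x xx).
  - by apply: (@cont2_of_x R (cusp alpha 0 (C - eps) 0)); exact: (cusp_continuous p2 qa).
  - by move=> s _ _; exact: (cusp_subflow p2 b0 0 qa (lexx 0) (ltW Ce) s t (ltW nr0)).
  - by move=> s ss; rewrite cuspE; have /andP[] := left s ss.
  - by move=> s ss; rewrite cuspE pw0// mulr0 -/(w 0 s) w_orig.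
  - by move=> y yy; rewrite cuspE -/(w y 0) w0; have /andP[] := init y yy.
have cuspS y s : 0 <= s -> (C + eps) * pw alpha (- y) <= sep p b alpha 0 (C + eps) 0 k y s.
  by move=> s0; rewrite -cuspE; exact: (cusp_le_sep p2 b0 0 y qa (lexx 0) (ltW B0) (ltW k0) s0).
have := @weak_le_super R p b T u0 u p2 hu (- r) 0 t (sep p b alpha 0 (C + eps) 0 k)
  (dsep p b alpha 0 (C + eps) 0 k) nr0 t0 tT.
move=> /(_ _ _ _ _ _ x xx) cmp.
have : w x t <= sep p b alpha 0 (C + eps) 0 k x t.
  apply: cmp.
  - exact: flow_cont (sep_flow p2 b0 0 qa (lexx 0) (ltW B0) k 0 1 (lexx 0)).
  - move=> s s0 st; apply: (sep_superflow p2 b0 qa (lexx 0) (ltW B0) (ltW nr0)).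
      by move=> s' /andP[_ st']; apply: hd4; exact: le_trans st' (le_trans td dd4).
    by move=> y /andP[y1 y2]; apply: hr2 => //; lra.
  - move=> s ss; have /andP[_ h] := left s ss; apply: le_trans h (cuspS _ _ _).
    by have /andP[] := ss.
  - move=> s ss; rewrite -/(w 0 s) w_orig//; have /andP[s0 _] := ss.
    by apply: le_trans (cuspS 0 s s0); rewrite pw0// mulr0.
  - move=> y yy; rewrite -/(w y 0) w0; have /andP[_ h] := init y yy.
    by apply: le_trans h (cuspS _ _ _).
move=> h; apply: le_trans h _.
have hk := hd4 t (le_trans td dd4).
rewrite /sep cuspE /clock max_l; last by lra.
by rewrite subr0 mulNr -/k mulrC.
Qed.

End Conclusion.

Theorem mainTheorem6 (R : realType) (p b alpha C : R) (T : \bar R)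
    (u0 : R -> R) (u : R -> R -> R)
    (hp : 2 < p) (hb : b != 0) (halpha : p / (p - 2) < alpha) (hC : 0 < C)
    (hT : (0 < T)%E)
    (u0_ge0 : forall x, 0 <= u0 x)
    (u0_cont : continuous u0)
    (u0_supp : ereal_sup [set x%:E | x in [set x | 0 < u0 x]] = 0%E)
    (u0_asymp : u0 x / (C * (- x) `^ alpha) @[x --> 0^'-] --> (1 : R))
    (hu : the_cauchy_solution p b 1 T u0 u) :
  forall eps : R, 0 < eps ->
  exists x_eps delta_eps : R,
    [/\ x_eps < 0, 0 < delta_eps, (delta_eps%:E < T)%E &
        forall x t : R, x_eps < x -> 0 <= t <= delta_eps ->
          (C - eps) * Num.max (- x) 0 `^ alpha * expR (- (b * t)) <= u x t
          /\
          u x t <= (C + eps) * Num.max (- x) 0 `^ alpha * expR (- (b * t)) *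
            (1 - eps * b^-1 * (p - 2) `^ (- p) *
                 (1 - expR (- (b * (p - 2) * t)))) `^ (1 / (2 - p))].
Proof.
have sol : cauchy_solution p b 1 T u0 u by case: hu => [[_ [[]]]|[_ _ []]].
move=> eps eps0.
have [xe [de [xe0 de0 deT h]]] :=
  interface_bounds hp hb sol halpha hC hT u0_ge0 u0_cont u0_supp u0_asymp eps0.
exists xe, de; split => // x t xx tt; have [lower upper] := h x t xx tt.
have p20 : 0 < p - 2 by rewrite subr_gt0.
have pn : p - 2 != 0 by exact: lt0r_neq0.
have e1 : expR (- (b * t)) * expR (b * t) = 1 by rewrite -expRD addNr expR0.
have uE : u x t = expR (- (b * t)) * (expR (b * t) * u x t) by rewrite mulrA e1 mul1r.
have kE : eps * (p - 2) `^ (1 - p) * age p b t =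
    eps * b^-1 * (p - 2) `^ (- p) * (1 - expR (- (b * (p - 2) * t))).
  have -> : (p - 2) `^ (1 - p) = (p - 2) * (p - 2) `^ (- p).
    by rewrite powRD ?pn ?implybT// powRr1// ltW.
  by rewrite /age; field; rewrite hb pn.
have gE : - (p - 2)^-1 = 1 / (2 - p).
  have pn' : 2 - p != 0 by rewrite -opprB oppr_eq0.
  by field; rewrite pn pn'.
split.
  by rewrite uE mulrC ler_wpM2l ?expR_ge0.
rewrite uE mulrAC [X in _ <= X]mulrC -kE -gE.
by rewrite ler_wpM2l ?expR_ge0.
Qed.
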